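(* Let $n$ be a positive integer, let $\mathcal A$ be an abelian $n$-truncated DG-category, let $\mathcal C=H^0(\mathcal A)$, and let $(\mathcal C,\mathbb E,\mathfrak s)$ denote the natural extriangulated structure on $\mathcal C$. For a conflation $A\xrightarrow{f}B\xrightarrow{g}C\overset{\delta}{\dashrightarrow}$ in this extriangulated category, there are long exact sequences (of functors on $\mathcal C^{\mathrm{op}}$, respectively on $\mathcal C$) $$0\to\mathcal C(-,\Omega^{n-1}A)\xrightarrow{\Omega^{n-1}f\circ-}\mathcal C(-,\Omega^{n-1}B)\xrightarrow{\Omega^{n-1}g\circ-}\mathcal C(-,\Omega^{n-1}C)\to\cdots\to\mathcal C(-,\Omega A)\xrightarrow{\Omega f\circ-}\mathcal C(-,\Omega B)\xrightarrow{\Omega g\circ-}\mathcal C(-,\Omega C)\to$$ $$\to\mathcal C(-,A)\xrightarrow{f\circ-}\mathcal C(-,B)\xrightarrow{g\circ-}\mathcal C(-,C)\xrightarrow{\delta\cdot-}\mathbb E(-,A)\to\mathbb E(-,B)\to\mathbb E(-,C)\to\cdots\to\mathbb E^m(-,A)\to\mathbb E^m(-,B)\to\mathbb E^m(-,C)\to\cdots$$ and $$0\to\mathcal C(\Sigma^{n-1}C,-)\xrightarrow{-\circ\Sigma^{n-1}g}\mathcal C(\Sigma^{n-1}B,-)\xrightarrow{-\circ\Sigma^{n-1}f}\mathcal C(\Sigma^{n-1}A,-)\to\cdots\to\mathcal C(\Sigma C,-)\xrightarrow{-\circ\Sigma g}\mathcal C(\Sigma B,-)\xrightarrow{-\circ\Sigma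 f}\mathcal C(\Sigma A,-)\to$$ $$\to\mathcal C(C,-)\xrightarrow{-\circ g}\mathcal C(B,-)\xrightarrow{-\circ f}\mathcal C(A,-)\xrightarrow{-\cdot\delta}\mathbb E(C,-)\to\mathbb E(B,-)\to\mathbb E(A,-)\to\cdots\to\mathbb E^m(C,-)\to\mathbb E^m(B,-)\to\mathbb E^m(A,-)\to\cdots.$$
   Context: **DG-categories.** Let $k$ be a commutative ring. DG-categories are $k$-linear with cohomological grading (differential $d$ of degree $+1$). All DG-categories $\mathcal A$ are assumed non-positive: $\mathcal A(X,Y)^i=0$ for $i>0$. A morphism $f$ is closed if $d(f)=0$. $H^0(\mathcal A)$ is the homotopy category. **Exactness.** For a chain map $\varphi:M\to N$ let $\mathrm{Fib}(\varphi)=\mathrm{Cone}(\varphi)[-1]$ be the complex $\mathrm{Fib}(\varphi)^i=M^i\oplus N^{i-1}$, $d(m,h)=(dm,-\varphi(m)-dh)$. A 3-term homotopy complex $(f,g,h)$ consists of closed degree-$0$ morphisms $f:X\to Y$, $g:Y\to Z$ and a degree $-1$ morphism $h:X\to Z$ with $d(h)=-g\circ f$. It is left exact (a homotopy kernel of $g$) if for every object $W$ and every $i\le 0$ the chain map $\mathcal A(W,X)\to \mathrm{Fib}(g\circ-:\mathcal A(W,Y)\to\mathcal A(W,Z))$, $u\mapsto (f\circ u,h\circ u)$, induces an isomorphism on $H^i$. It is right exact (a homotopy cokernel of $f$) if for every $W$ and $i\le0$ the chain map $\mathcal A(Z,W)\to\mathrm{Fib}(-\circ f:\mathcal A(Y,W)\to\mathcal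 A(X,W))$, $u\mapsto(u\circ g,(-1)^{|u|}u\circ h)$, induces an isomorphism on $H^i$. It is a homotopy short exact sequence if it is both. A morphism $(f,g,h)\to(f',g',h')$ of 3-term homotopy complexes is $(x,y,z,s,s',t)$ with $x,y,z$ closed of degree $0$ between the respective objects, $s:X\to Y'$, $s':Y\to Z'$ of degree $-1$, $t:X\to Z'$ of degree $-2$, $d(s)=f'x-yf$, $d(s')=g'y-zg$, $d(t)=zh-s'f-g's-h'x$. **Abelian $n$-truncated DG-categories.** A closed degree-$0$ morphism $f:X\to Y$ is an $n$-monomorphism if for every $W$ the map $H^i(f\circ-):H^i(\mathcal A(W,X))\to H^i(\mathcal A(W,Y))$ is injective for $i=-n+1$ and bijective for all $i\le -n$; it is an $n$-epimorphism if it is an $n$-monomorphism in $\mathcal A^{\mathrm{op}}$. $\mathcal A$ is $n$-truncated if $H^i(\mathcal A(X,Y))=0$ for all $X,Y$ and all $i\le -n$. $\mathcal A$ is abelian $n$-truncated if it is $n$-truncated and: (i) $H^0(\mathcal A)$ is additive and every closed degree-$0$ morphism has a homotopy kernel and a homotopy cokernel; (ii) every right exact $(f,g,h)$ with $f$ an $n$-monomorphism is a homotopy short exact sequence; (iii) every left exact $(f,g,h)$ with $g$ an $n$-epimorphism is a homotopy short exact sequence. **Loops and suspensions.** A loop object of $X$ is $(\Omega X,h_X)$ with $h_X:\Omega X\to X$ closed of degree $-1$ such that $h_X\circ-:H^i(\mathcal A(W,\Omega X))\to H^{i-1}(\mathcal A(W,X))$ is an isomorphism for all $W$, $i\le 0$.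 A suspension object is $(\Sigma X,h^X)$ with $h^X:X\to\Sigma X$ closed of degree $-1$ such that $-\circ h^X:H^i(\mathcal A(\Sigma X,W))\to H^{i-1}(\mathcal A(X,W))$ is an isomorphism for all $W$, $i\le0$. They exist for all objects here and give functors $\Omega,\Sigma:H^0(\mathcal A)\to H^0(\mathcal A)$: $\Omega f=f'$ iff $h_Yf'-fh_X$ is a boundary; $\Sigma f=f'$ iff $f'h^X-h^Yf$ is a boundary. **The extriangulated structure.** $\mathcal A$ is an exact DG-category with conflations all homotopy short exact sequences, and hence (Chen) $\mathcal C=H^0(\mathcal A)$ is an extriangulated category (Nakaoka–Palu) as follows. $\mathbb E(C,A)$ is the set of equivalence classes of homotopy short exact sequences $(f,g,h)$ with first object $A$ and last object $C$, two being equivalent if there is a morphism of the form $(\mathrm{id}_A,b,\mathrm{id}_C,s,s',t)$ between them. For $\delta\in\mathbb E(C,A)$ and $c:C'\to C$, $\delta\cdot c=\mathbb E(c,A)(\delta)$ is the unique class in $\mathbb E(C',A)$ admitting a morphism of the form $(\mathrm{id}_A,b,c,s,s',t)$ to a representative of $\delta$; for $a:A\to A'$, $a\cdot\delta=\mathbb E(C,a)(\delta)$ is the unique class in $\mathbb E(C,A')$ receiving a morphism of the form $(a,b,\mathrm{id}_C,s,s',t)$ from a representative of $\delta$; the $k$-module structure is the Baer sum. $\mathfrak s$ sends the class of $(f,g,h)$ to the (isomorphism class of the) sequence $A\xrightarrow fB\xrightarrow gC$ in $\mathcal C$; one then writes $A\xrightarrow fB\xrightarrow gC\overset\delta\dashrightarrow$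 and calls it a conflation. **Higher extensions.** $\mathbb E^1=\mathbb E$ and $\mathbb E^{m+1}(C,A)=\int^{X\in\mathcal C}\mathbb E^{m}(X,A)\otimes_k\mathbb E(C,X)$ (coend; the positive extensions of Gorsky–Nakaoka–Palu). The maps $\mathbb E^m(-,A)\to\mathbb E^m(-,B)\to\mathbb E^m(-,C)$ are induced by $f,g$, and the connecting maps $\mathbb E^m(-,C)\to\mathbb E^{m+1}(-,A)$ by $\delta$; dually for the second sequence. **Remaining connecting maps.** A conflation extends to a left triangle $\Omega C\xrightarrow{w}A\xrightarrow fB\xrightarrow gC$, where $w$ is the closed degree-$0$ morphism, unique up to homotopy, for which there are $h':\Omega C\to B$ of degree $-1$ with $d(h')=-f\circ w$ and $\eta$ of degree $-2$ with $d(\eta)=g\circ h'-h\circ w-h_C$; dually it extends to a right triangle $A\to B\to C\xrightarrow{w'}\Sigma A$. The connecting maps $\mathcal C(-,\Omega^{j}C)\to\mathcal C(-,\Omega^{j-1}A)$ are composition with $\Omega^{j-1}w$ up to sign, and $\mathcal C(\Sigma^jA,-)\to\mathcal C(\Sigma^{j-1}C,-)$ are composition with $\Sigma^{j-1}w'$ up to sign. *)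

(* Defs.v *)
From HB Require Import structures.
From mathcomp Require Import all_boot all_order all_algebra.
From mathcomp Require Import zify boolp.

Set Implicit Arguments.
Unset Strict Implicit.
Unset Printing Implicit Defensive.

Import Order.TTheory GRing.Theory Num.Theory.
Local Open Scope ring_scope.

(* The quotient of {x | P x} by R; its elements are the R-classes, as sets.
   R is used directly, not its generated equivalence. *)
Definition quo (T : Type) (P : T -> Prop) (R : T -> T -> Prop) :=
  {S : T -> Prop | exists2 x, P x & S = (fun y => P y /\ R x y)}.

Definition qcls (T : Type) (P : T -> Prop) (R : T -> T -> Prop) (x : T)
    (Px : P x) : quo P R :=
  exist _ (fun y => P y /\ R x y) (ex_intro2 _ _ x Px erefl).

Definition qrepr (T : Type) (P : T -> Prop) (R : T -> T -> Prop)
  (q : quo P R) : T := s2val (cid2 (svalP q)).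

Lemma qreprP (T : Type) (P : T -> Prop) (R : T -> T -> Prop) (q : quo P R) :
  P (qrepr q).
Proof. exact: s2valP. Qed.

Definition qin (T : Type) (P : T -> Prop) (R : T -> T -> Prop) (q : quo P R)
  (x : T) : Prop := sval q x.

(* The unique x such that P x; the default x0 is returned only when there is
   no such x or more than one. *)
Definition the (T : Type) (x0 : T) (P : T -> Prop) : T :=
  if pselect (exists x, unique P x) is left e then sval (cid e) else x0.

(* A graded module with a differential is a module M = \bigoplus_i M^i:
   [cx_deg i] is the submodule M^i, and elements of M need not be homogeneous.
   [precx] only carries the data, [cx] also the axioms. *)
Record precx (k : comPzRingType) := PreCx {
  cx_mod :> lmodType k;
  cx_deg : int -> cx_mod -> Prop;
  cx_d : cx_mod -> cx_mod }.

Arguments cx_deg {k p} i x.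
Arguments cx_d {k p} x.

Record cx (k : comPzRingType) := Cx {
  cx_pre :> precx k;
  cx_deg0 : forall i, cx_deg i (0 : cx_pre);
  cx_degL : forall i (a : k) (x y : cx_pre),
    cx_deg i x -> cx_deg i y -> cx_deg i (a *: x + y);
  cx_span : forall x : cx_pre, exists (s : seq int) (c : int -> cx_pre),
    (forall i, cx_deg i (c i)) /\ x = \sum_(i <- s) c i;
  cx_indep : forall (s : seq int) (c : int -> cx_pre),
    uniq s -> (forall i, cx_deg i (c i)) -> \sum_(i <- s) c i = 0 ->
    forall i, i \in s -> c i = 0;
  cx_dL : forall (a : k) (x y : cx_pre),
    cx_d (a *: x + y) = a *: cx_d x + cx_d y;
  cx_d_deg : forall i (x : cx_pre), cx_deg i x -> cx_deg (i + 1) (cx_d x);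
  cx_dd : forall x : cx_pre, cx_d (cx_d x) = 0 }.

Section Cohomology.
Variable k : comPzRingType.

Definition cycle (M : precx k) (i : int) (x : M) := cx_deg i x /\ cx_d x = 0.

Definition boundary (M : precx k) (i : int) (x : M) :=
  exists2 y : M, cx_deg (i - 1) y & x = cx_d y.

(* Injectivity, surjectivity, bijectivity of the map H^i(M) -> H^j(N)
   induced by phi; only the restriction of phi to M^i matters. *)
Definition Hinj (M N : precx k) (i j : int) (phi : M -> N) :=
  forall x, cycle i x -> boundary j (phi x) -> boundary i x.

Definition Hsurj (M N : precx k) (i j : int) (phi : M -> N) :=
  forall y, cycle j y -> exists2 x, cycle i x & boundary j (y - phi x).

Definition Hbij (M N : precx k) (i j : int) (phi : M -> N) :=
  Hinj i j phi /\ Hsurj i j phi.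

Definition Fib (M N : precx k) (phi : M -> N) : precx k :=
  @PreCx k (M * N)%type
    (fun i x => cx_deg i x.1 /\ cx_deg (i - 1) x.2)
    (fun x => (cx_d x.1, - phi x.1 - cx_d x.2)).

End Cohomology.

Record dgcat (k : comPzRingType) := DGCat {
  ob :> Type;
  dhom : ob -> ob -> cx k;
  did : forall X, dhom X X;
  dcomp : forall X Y Z, dhom Y Z -> dhom X Y -> dhom X Z;
  dcompLl : forall X Y Z (a : k) (g g' : dhom Y Z) (f : dhom X Y),
    dcomp (a *: g + g') f = a *: dcomp g f + dcomp g' f;
  dcompLr : forall X Y Z (a : k) (g : dhom Y Z) (f f' : dhom X Y),
    dcomp g (a *: f + f') = a *: dcomp g f + dcomp g f';
  dcompA : forall X Y Z W (h : dhom Z W) (g : dhom Y Z) (f : dhom X Y),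
    dcomp h (dcomp g f) = dcomp (dcomp h g) f;
  dcomp1m : forall X Y (f : dhom X Y), dcomp (did Y) f = f;
  dcompm1 : forall X Y (f : dhom X Y), dcomp f (did X) = f;
  deg_did : forall X, cx_deg 0 (did X);
  deg_dcomp : forall X Y Z i j (g : dhom Y Z) (f : dhom X Y),
    cx_deg i g -> cx_deg j f -> cx_deg (i + j) (dcomp g f);
  d_dcomp : forall X Y Z i (g : dhom Y Z) (f : dhom X Y), cx_deg i g ->
    cx_d (dcomp g f) = dcomp (cx_d g) f + (-1) ^+ `|i|%N *: dcomp g (cx_d f);
  dhom_nonpos : forall X Y i (f : dhom X Y), 0 < i -> cx_deg i f -> f = 0 }.

Arguments dhom {k d} _ _.
Arguments did {k d} X.
Arguments dcomp {k d X Y Z} g f.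
Notation "g ∘ f" := (dcomp g f) (at level 40, left associativity) : ring_scope.

Section Exactness.
Variables (k : comPzRingType) (A : dgcat k).

Definition closed0 (X Y : A) (f : dhom X Y) := cycle 0 f.

Record h3 (X Y Z : A) := H3 {
  h3f : dhom X Y;
  h3g : dhom Y Z;
  h3h : dhom X Z;
  h3f_closed : closed0 h3f;
  h3g_closed : closed0 h3g;
  h3h_deg : cx_deg (-1) h3h;
  h3h_d : cx_d h3h = - (h3g ∘ h3f) }.

Definition left_exact (X Y Z : A) (xi : h3 X Y Z) :=
  forall (W : A) (i : int), i <= 0 ->
    Hbij i i (fun u : dhom W X =>
      (h3f xi ∘ u, h3h xi ∘ u) : Fib (fun v : dhom W Y => h3g xi ∘ v)).

Definition right_exact (X Y Z : A) (xi : h3 X Y Z) :=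
  forall (W : A) (i : int), i <= 0 ->
    Hbij i i (fun u : dhom Z W =>
      (u ∘ h3g xi, (-1) ^+ `|i|%N *: (u ∘ h3h xi))
        : Fib (fun v : dhom Y W => v ∘ h3f xi)).

Definition short_exact (X Y Z : A) (xi : h3 X Y Z) :=
  left_exact xi /\ right_exact xi.

Record h3_mor (X Y Z X' Y' Z' : A) (xi : h3 X Y Z) (xi' : h3 X' Y' Z')
    (x : dhom X X') (y : dhom Y Y') (z : dhom Z Z')
    (s : dhom X Y') (s' : dhom Y Z') (t : dhom X Z') : Prop := {
  h3m_x : closed0 x;
  h3m_y : closed0 y;
  h3m_z : closed0 z;
  h3m_s : cx_deg (-1) s;
  h3m_s' : cx_deg (-1) s';
  h3m_t : cx_deg (-2) t;
  h3m_ds : cx_d s = h3f xi' ∘ x - y ∘ h3f xi;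
  h3m_ds' : cx_d s' = h3g xi' ∘ y - z ∘ h3g xi;
  h3m_dt : cx_d t = z ∘ h3h xi - s' ∘ h3f xi - h3g xi' ∘ s - h3h xi' ∘ x }.

Definition has_mor (X Y Z X' Y' Z' : A) (xi : h3 X Y Z) (xi' : h3 X' Y' Z')
    (x : dhom X X') (y : dhom Y Y') (z : dhom Z Z') :=
  exists s s' t, h3_mor xi xi' x y z s s' t.

Definition nmono (n : nat) (X Y : A) (f : dhom X Y) :=
  forall W : A,
    Hinj (1 - n%:Z) (1 - n%:Z) (fun u : dhom W X => f ∘ u) /\
    forall i : int, i <= - n%:Z -> Hbij i i (fun u : dhom W X => f ∘ u).

Definition nepi (n : nat) (X Y : A) (f : dhom X Y) :=
  forall W : A,
    Hinj (1 - n%:Z) (1 - n%:Z) (fun u : dhom Y W => u ∘ f) /\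
    forall i : int, i <= - n%:Z -> Hbij i i (fun u : dhom Y W => u ∘ f).

Definition truncated (n : nat) :=
  forall (X Y : A) (i : int) (f : dhom X Y),
    i <= - n%:Z -> cycle i f -> boundary i f.

Definition homotopic (X Y : A) (f g : dhom X Y) := boundary 0 (f - g).

Definition H0 (X Y : A) : Type := quo (@closed0 X Y) (@homotopic X Y).

Definition H0cls (X Y : A) (f : dhom X Y) (cf : closed0 f) : H0 X Y :=
  qcls (@homotopic X Y) cf.

Lemma closed0_0 (X Y : A) : closed0 (0 : dhom X Y).
Proof.
split; first exact: cx_deg0.
by have := cx_dL (-1) (0 : dhom X Y) 0; rewrite scaler0 add0r scaleN1r addNr.
Qed.

Lemma closed0L (X Y : A) (a : k) (f g : dhom X Y) :
  closed0 f -> closed0 g -> closed0 (a *: f + g).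
Proof.
move=> [df cf] [dg cg]; split; first exact: cx_degL.
by rewrite cx_dL cf cg scaler0 addr0.
Qed.

Lemma closed0D (X Y : A) (f g : dhom X Y) :
  closed0 f -> closed0 g -> closed0 (f + g).
Proof. by move=> cf cg; rewrite -[f]scale1r; apply: closed0L. Qed.

Lemma closed0Z (X Y : A) (a : k) (f : dhom X Y) :
  closed0 f -> closed0 (a *: f).
Proof.
by move=> cf; rewrite -[_ *: _]addr0; apply: closed0L => //; apply: closed0_0.
Qed.

Lemma dcomp0m (X Y Z : A) (f : dhom X Y) : (0 : dhom Y Z) ∘ f = 0.
Proof.
by have := dcompLl (-1) (0 : dhom Y Z) 0 f; rewrite scaler0 add0r scaleN1r addNr.
Qed.

Lemma dcompm0 (X Y Z : A) (g : dhom Y Z) : g ∘ (0 : dhom X Y) = 0.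
Proof.
by have := dcompLr (-1) g (0 : dhom X Y) 0; rewrite scaler0 add0r scaleN1r addNr.
Qed.

Lemma closed0_comp (X Y Z : A) (g : dhom Y Z) (f : dhom X Y) :
  closed0 g -> closed0 f -> closed0 (g ∘ f).
Proof.
move=> [dg cg] [df cf]; split; first by have := deg_dcomp dg df; rewrite addr0.
by rewrite (d_dcomp _ dg) cg cf dcomp0m dcompm0 scaler0 addr0.
Qed.

Lemma closed0_id (X : A) : closed0 (did X).
Proof.
split; first exact: deg_did.
have := d_dcomp (did X) (deg_did X).
by rewrite !dcomp1m dcompm1 scale1r -[LHS]addr0 => /addrI <-.
Qed.

Definition H0zero (X Y : A) : H0 X Y := H0cls (closed0_0 X Y).
Definition H0add (X Y : A) (f g : H0 X Y) : H0 X Y :=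
  H0cls (closed0D (qreprP f) (qreprP g)).
Definition H0scale (X Y : A) (a : k) (f : H0 X Y) : H0 X Y :=
  H0cls (closed0Z a (qreprP f)).
Definition H0id (X : A) : H0 X X := H0cls (closed0_id X).
Definition H0comp (X Y Z : A) (g : H0 Y Z) (f : H0 X Y) : H0 X Z :=
  H0cls (closed0_comp (qreprP g) (qreprP f)).

Definition H0_zero_object (Z : A) := H0id Z = H0zero Z Z.

Record H0_biproduct (X1 X2 X : A) (i1 : H0 X1 X) (i2 : H0 X2 X)
    (p1 : H0 X X1) (p2 : H0 X X2) : Prop := {
  bip11 : H0comp p1 i1 = H0id X1;
  bip22 : H0comp p2 i2 = H0id X2;
  bip12 : H0comp p1 i2 = H0zero X2 X1;
  bip21 : H0comp p2 i1 = H0zero X1 X2;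
  bip_sum : H0add (H0comp i1 p1) (H0comp i2 p2) = H0id X }.

Definition H0_additive :=
  (exists Z : A, H0_zero_object Z) /\
  forall X1 X2 : A, exists (X : A) (i1 : H0 X1 X) (i2 : H0 X2 X)
    (p1 : H0 X X1) (p2 : H0 X X2), H0_biproduct i1 i2 p1 p2.

Definition H0_iso (X Y : A) (f : H0 X Y) :=
  exists2 g : H0 Y X, H0comp g f = H0id X & H0comp f g = H0id Y.

End Exactness.

Record abelian_dgcat (k : comPzRingType) (n : nat) := AbelianDGCat {
  ab_dg :> dgcat k;
  ab_truncated : truncated ab_dg n;
  ab_additive : H0_additive ab_dg;
  ab_ker : forall (Y Z : ab_dg) (g : dhom Y Z), closed0 g ->
    exists (X : ab_dg) (xi : h3 X Y Z), h3g xi = g /\ left_exact xi;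
  ab_coker : forall (X Y : ab_dg) (f : dhom X Y), closed0 f ->
    exists (Z : ab_dg) (xi : h3 X Y Z), h3f xi = f /\ right_exact xi;
  ab_mono : forall (X Y Z : ab_dg) (xi : h3 X Y Z),
    right_exact xi -> nmono n (h3f xi) -> short_exact xi;
  ab_epi : forall (X Y Z : ab_dg) (xi : h3 X Y Z),
    left_exact xi -> nepi n (h3g xi) -> short_exact xi }.

Section Algebra.
Variables (k : comPzRingType) (A : dgcat k).
Implicit Types X Y Z W : A.

Lemma dcompDl X Y Z (g g' : dhom Y Z) (f : dhom X Y) :
  (g + g') ∘ f = g ∘ f + g' ∘ f.
Proof. by have := dcompLl 1 g g' f; rewrite !scale1r. Qed.

Lemma dcompDr X Y Z (g : dhom Y Z) (f f' : dhom X Y) :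
  g ∘ (f + f') = g ∘ f + g ∘ f'.
Proof. by have := dcompLr 1 g f f'; rewrite !scale1r. Qed.

Lemma dcompZl X Y Z a (g : dhom Y Z) (f : dhom X Y) :
  (a *: g) ∘ f = a *: (g ∘ f).
Proof. by have := dcompLl a g 0 f; rewrite dcomp0m !addr0. Qed.

Lemma dcompZr X Y Z a (g : dhom Y Z) (f : dhom X Y) :
  g ∘ (a *: f) = a *: (g ∘ f).
Proof. by have := dcompLr a g f 0; rewrite dcompm0 !addr0. Qed.

Lemma dcompNl X Y Z (g : dhom Y Z) (f : dhom X Y) : (- g) ∘ f = - (g ∘ f).
Proof. by rewrite -scaleN1r dcompZl scaleN1r. Qed.

Lemma dcompNr X Y Z (g : dhom Y Z) (f : dhom X Y) : g ∘ (- f) = - (g ∘ f).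
Proof. by rewrite -scaleN1r dcompZr scaleN1r. Qed.

Lemma cx_d0 (M : cx k) : cx_d (0 : M) = 0.
Proof.
by have := cx_dL (-1) (0 : M) 0; rewrite scaler0 add0r scaleN1r addNr.
Qed.

Lemma cx_dD (M : cx k) (x y : M) : cx_d (x + y) = cx_d x + cx_d y.
Proof. by have := cx_dL 1 x y; rewrite !scale1r. Qed.

Lemma cx_dZ (M : cx k) a (x : M) : cx_d (a *: x) = a *: cx_d x.
Proof. by have := cx_dL a x 0; rewrite cx_d0 !addr0. Qed.

Lemma cx_dN (M : cx k) (x : M) : cx_d (- x) = - cx_d x.
Proof. by rewrite -scaleN1r cx_dZ scaleN1r. Qed.

Lemma cx_degD (M : cx k) i (x y : M) :
  cx_deg i x -> cx_deg i y -> cx_deg i (x + y).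
Proof. by move=> dx dy; rewrite -[x]scale1r; apply: cx_degL. Qed.

Lemma cx_degZ (M : cx k) i a (x : M) : cx_deg i x -> cx_deg i (a *: x).
Proof.
by move=> dx; rewrite -[_ *: _]addr0; apply: cx_degL => //; apply: cx_deg0.
Qed.

Lemma cx_degN (M : cx k) i (x : M) : cx_deg i x -> cx_deg i (- x).
Proof. by rewrite -scaleN1r; apply: cx_degZ. Qed.

Lemma deg_dcomp_eq X Y Z i j l (g : dhom Y Z) (f : dhom X Y) :
  cx_deg i g -> cx_deg j f -> i + j = l -> cx_deg l (g ∘ f).
Proof. by move=> dg df <-; apply: deg_dcomp. Qed.

Lemma dcomp_dl X Y Z i (e : dhom Y Z) (u : dhom X Y) :
  cx_deg i e -> cx_d u = 0 -> cx_d e ∘ u = cx_d (e ∘ u).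
Proof. by move=> de cu; rewrite (d_dcomp _ de) cu dcompm0 scaler0 addr0. Qed.

Lemma dcomp_dr X Y Z i (u : dhom Y Z) (e : dhom X Y) :
  cycle i u -> u ∘ cx_d e = (-1) ^+ `|i|%N *: cx_d (u ∘ e).
Proof.
move=> [du cu]; rewrite (d_dcomp _ du) cu dcomp0m add0r scalerA.
by rewrite -exprD addnn -mul2n exprM sqrrN expr1n expr1n scale1r.
Qed.

Lemma homotopic_refl X Y (f : dhom X Y) : homotopic f f.
Proof. by exists 0; [exact: cx_deg0 | rewrite subrr cx_d0]. Qed.

Lemma H0cls_inj X Y (f g : dhom X Y) (cf : closed0 f) (cg : closed0 g) :
  H0cls cf = H0cls cg -> homotopic f g.
Proof.
move=> /(congr1 (@proj1_sig _ _)) /= /(congr1 (fun S => S g)) E.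
suff [] : closed0 g /\ homotopic f g by [].
by rewrite E; split=> //; apply: homotopic_refl.
Qed.

Lemma qrepr_H0cls X Y (f : dhom X Y) (cf : closed0 f) :
  homotopic (qrepr (H0cls cf)) f.
Proof.
have : sval (H0cls cf) f by split=> //; exact: homotopic_refl.
by rewrite (s2valP' (cid2 (svalP (H0cls cf)))) => -[].
Qed.

End Algebra.

Section Loops.
Variables (k : comPzRingType) (A : dgcat k).

Definition is_loop (X L : A) (h : dhom L X) :=
  cycle (-1) h /\
  forall (W : A) (i : int), i <= 0 ->
    Hbij i (i - 1) (fun u : dhom W L => h ∘ u).

Definition is_suspension (X S : A) (h : dhom X S) :=
  cycle (-1) h /\
  forall (W : A) (i : int), i <= 0 ->
    Hbij i (i - 1) (fun u : dhom S W => u ∘ h).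

Record loops := Loops {
  lp : A -> A;
  lph : forall X, dhom (lp X) X;
  lphP : forall X, is_loop (lph X) }.

Record suspensions := Suspensions {
  su : A -> A;
  suh : forall X, dhom X (su X);
  suhP : forall X, is_suspension (suh X) }.

Definition lp_map (L : loops) (X Y : A) (f : H0 X Y) : H0 (lp L X) (lp L Y) :=
  the (H0zero _ _) (fun f' => exists f0 f0', [/\ qin f f0, qin f' f0' &
    boundary (-1) (lph L Y ∘ f0' - f0 ∘ lph L X)]).

Definition su_map (S : suspensions) (X Y : A) (f : H0 X Y) :
    H0 (su S X) (su S Y) :=
  the (H0zero _ _) (fun f' => exists f0 f0', [/\ qin f f0, qin f' f0' &
    boundary (-1) (f0' ∘ suh S X - suh S Y ∘ f0)]).

Fixpoint lpn (L : loops) (j : nat) (X : A) : A :=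
  if j is j'.+1 then lpn L j' (lp L X) else X.

Fixpoint lpn_map (L : loops) (j : nat) (X Y : A) (f : H0 X Y) {struct j} :
    H0 (lpn L j X) (lpn L j Y) :=
  match j return H0 (lpn L j X) (lpn L j Y) with
  | 0 => f
  | j'.+1 => lpn_map L j' (lp_map L f)
  end.

Fixpoint sun (S : suspensions) (j : nat) (X : A) : A :=
  if j is j'.+1 then sun S j' (su S X) else X.

Fixpoint sun_map (S : suspensions) (j : nat) (X Y : A) (f : H0 X Y)
    {struct j} : H0 (sun S j X) (sun S j Y) :=
  match j return H0 (sun S j X) (sun S j Y) with
  | 0 => f
  | j'.+1 => sun_map S j' (su_map S f)
  end.

End Loops.

Section LoopsExist.
Variables (k : comPzRingType) (n : nat) (A : abelian_dgcat k n).

Lemma sgnK (M : lmodType k) (m : nat) (x : M) :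
  (-1) ^+ m *: ((-1) ^+ m *: x) = x.
Proof.
by rewrite scalerA -exprD addnn -mul2n exprM sqrrN expr1n expr1n scale1r.
Qed.

Lemma zero_contractible : exists (Z : A) (e : dhom Z Z),
  cx_deg (-1) e /\ did Z = cx_d e.
Proof.
have [[Z /H0cls_inj [e de E]] _] := ab_additive A.
by exists Z, e; split=> //; rewrite -E subr0.
Qed.

Lemma loop_exists (X : A) : exists (L : A) (h : dhom L X), is_loop h.
Proof.
have [Z [e [de Ee]]] := zero_contractible.
have [L [xi [g0 Lxi]]] := ab_ker (closed0_0 Z X).
exists L, (h3h xi); split.
  by split; [exact: h3h_deg | rewrite h3h_d g0 dcomp0m oppr0].
move=> W i /(Lxi W) [inj sur]; split.
- move=> u cu [q dq Eq]; apply: inj => //.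
  have [du du0] := cu; have [df cf] := h3f_closed xi.
  exists (e ∘ (h3f xi ∘ u), - q) => /=.
    split; last exact: cx_degN.
    by apply: (deg_dcomp_eq de (deg_dcomp df du)); lia.
  rewrite g0 dcomp0m oppr0 add0r cx_dN opprK -Eq; congr (_, _).
  rewrite -(dcomp_dl de) -?Ee ?dcomp1m //.
  by rewrite (d_dcomp _ df) cf du0 dcomp0m dcompm0 scaler0 addr0.
- move=> y [dy cy].
  have [|u cu [[m q] [/= dm dq] [_ E]]] := sur (0, y).
    split=> /=; first by split=> //; apply: cx_deg0.
    by rewrite cx_d0 cy dcompm0 !oppr0 addr0.
  exists u => //; exists (- q); first exact: cx_degN.
  by move: E; rewrite g0 dcomp0m oppr0 add0r cx_dN.
Qed.

Lemma suspension_exists (X : A) :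
  exists (S : A) (h : dhom X S), is_suspension h.
Proof.
have [Z [e [de Ee]]] := zero_contractible.
have [S [xi [f0 Rxi]]] := ab_coker (closed0_0 X Z).
exists S, (h3h xi); split.
  by split; [exact: h3h_deg | rewrite h3h_d f0 dcompm0 oppr0].
move=> W i /(Rxi W) [inj sur]; split.
- move=> u cu [q dq Eq]; apply: inj => //.
  have [du du0] := cu; have [dg cg] := h3g_closed xi.
  have cug : cycle i (u ∘ h3g xi).
    split; first by apply: (deg_dcomp_eq du dg); rewrite addr0.
    by rewrite (d_dcomp _ du) cg du0 dcomp0m dcompm0 scaler0 addr0.
  exists ((-1) ^+ `|i|%N *: (u ∘ h3g xi ∘ e), - ((-1) ^+ `|i|%N *: q)) => /=.
    split; last by apply/cx_degN/cx_degZ.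
    by apply/cx_degZ/(deg_dcomp_eq cug.1 de); lia.
  rewrite f0 dcompm0 oppr0 add0r cx_dN !cx_dZ opprK -Eq; congr (_, _).
  by rewrite -(dcomp_dr _ cug) -Ee dcompm1.
- move=> y [dy cy].
  have [|u cu [[m q] [/= dm dq] [_ E]]] := sur (0, (-1) ^+ `|i|%N *: y).
    split=> /=; first by split; [exact: cx_deg0 | exact: cx_degZ].
    by rewrite cx_d0 cx_dZ cy scaler0 dcomp0m !oppr0 addr0.
  exists u => //; exists (- ((-1) ^+ `|i|%N *: q)).
    by apply/cx_degN/cx_degZ.
  move: E; rewrite f0 dcompm0 oppr0 add0r cx_dN cx_dZ -scalerBr.
  by move=> /(congr1 (fun v => (-1) ^+ `|i|%N *: v)); rewrite sgnK scalerN.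
Qed.

Lemma loops_exist : inhabited (loops A).
Proof.
pose L X := cid (loop_exists X); pose h X := cid (svalP (L X)).
by constructor; apply: (@Loops _ _ (fun X => sval (L X))
  (fun X => sval (h X))) => X; exact: svalP (h X).
Qed.

Lemma suspensions_exist : inhabited (suspensions A).
Proof.
pose S X := cid (suspension_exists X); pose h X := cid (svalP (S X)).
by constructor; apply: (@Suspensions _ _ (fun X => sval (S X))
  (fun X => sval (h X))) => X; exact: svalP (h X).
Qed.

End LoopsExist.

Section Extensions.
Variables (k : comPzRingType) (n : nat) (D : abelian_dgcat k n).
Implicit Types A B C : D.

Definition split_seq A B C (xi : h3 A B C) :=
  exists (i1 : H0 A B) (i2 : H0 C B) (p1 : H0 B A) (p2 : H0 B C),
    [/\ H0_biproduct i1 i2 p1 p2, qin i1 (h3f xi) & qin p2 (h3g xi)].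

Lemma qin_cycle A B (f : H0 A B) (f0 : dhom A B) : qin f f0 -> closed0 f0.
Proof. by case: f => S [x cx E]; rewrite /qin /= E => -[]. Qed.

Lemma homotopic_trans A B (f g h : dhom A B) :
  homotopic f g -> homotopic g h -> homotopic f h.
Proof.
move=> [e de Ee] [e' de' Ee']; exists (e + e'); first exact: cx_degD.
by rewrite cx_dD -Ee -Ee' addrA subrK.
Qed.

Lemma homotopic_sym A B (f g : dhom A B) : homotopic f g -> homotopic g f.
Proof.
by move=> [e de Ee]; exists (- e); [exact: cx_degN | rewrite cx_dN -Ee opprB].
Qed.

Lemma homotopicD A B (f f' g g' : dhom A B) :
  homotopic f f' -> homotopic g g' -> homotopic (f + g) (f' + g').
Proof.
move=> [e de Ee] [e' de' Ee']; exists (e + e'); first exact: cx_degD.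
by rewrite cx_dD -Ee -Ee' opprD addrACA.
Qed.

Lemma splitting_exact A B C (xi : h3 A B C) (i2 : dhom C B) (p1 : dhom B A) :
  closed0 i2 -> closed0 p1 ->
  homotopic (p1 ∘ h3f xi) (did A) -> homotopic (h3g xi ∘ i2) (did C) ->
  homotopic (h3f xi ∘ p1 + i2 ∘ h3g xi) (did B) -> short_exact xi.
Proof.
case: xi => i1 p2 h ci1 cp2 dh Eh /= ci2 cp1 [e1 de1 E1] [e2 de2 E2] [e de E].
have deg0 (X Y Z : D) (g : dhom Y Z) (f : dhom X Y) i :
    closed0 g -> cx_deg i f -> cx_deg i (g ∘ f).
  by move=> [dg _] df; apply: (deg_dcomp_eq dg df); rewrite add0r.
have deg0' (X Y Z : D) (g : dhom Y Z) (f : dhom X Y) i :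
    cx_deg i g -> closed0 f -> cx_deg i (g ∘ f).
  by move=> dg [df _]; apply: (deg_dcomp_eq dg df); rewrite addr0.
have dl0 (X Y Z : D) (g : dhom Y Z) (f : dhom X Y) :
    closed0 g -> cx_d (g ∘ f) = g ∘ cx_d f.
  by move=> [dg cg]; rewrite (d_dcomp _ dg) cg dcomp0m add0r scale1r.
have dr0 (X Y Z : D) (g : dhom Y Z) (f : dhom X Y) i :
    cx_deg i g -> closed0 f -> cx_d (g ∘ f) = cx_d g ∘ f.
  by move=> dg [df cf]; rewrite (d_dcomp _ dg) cf dcompm0 scaler0 addr0.
split=> W i _; split.
- move=> u [du cu] [[m q] [/= dm dq] [Em Eq]].
  exists (p1 ∘ m - e1 ∘ u).
    apply: cx_degD; first exact: deg0.
    by apply: cx_degN; apply: (deg_dcomp_eq de1 du); lia.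
  rewrite cx_dD cx_dN dl0 // -Em -(dcomp_dl de1 cu) -E1.
  by rewrite dcompDl dcompNl dcomp1m -dcompA opprB addrC subrK.
- case=> m q [[/= dm dq] [cm Ecq]].
  have cq : p2 ∘ m + cx_d q = 0 by rewrite -[LHS]opprK opprD Ecq oppr0.
  pose m' := - (i2 ∘ q + e ∘ m).
  have dm' : cx_deg (i - 1) m'.
    apply/cx_degN/cx_degD; first exact: deg0.
    by apply: (deg_dcomp_eq de dm); lia.
  have Em' : cx_d m' = m - i1 ∘ (p1 ∘ m).
    rewrite cx_dN cx_dD dl0 // -(dcomp_dl de cm) -E dcompDl dcompDl dcompNl.
    rewrite dcomp1m -[in X in _ + (_ + X - _)]dcompA -!dcompA.
    rewrite [in X in X + _](_ : cx_d q = - (p2 ∘ m)); last first.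
      by apply/eqP; rewrite -addr_eq0 addrC cq.
    rewrite dcompNr [_ + i2 ∘ _]addrC addrA addrA addNr add0r.
    by rewrite opprB.
  pose r := q - h ∘ (p1 ∘ m) + p2 ∘ m'.
  have dr : cx_deg (i - 1) r.
    apply: cx_degD; last exact: deg0.
    apply: cx_degD => //; apply: cx_degN.
    by apply: (deg_dcomp_eq dh (deg0 _ _ _ _ _ _ cp1 dm)); lia.
  have cr : cx_d r = 0.
    rewrite cx_dD cx_dD cx_dN [cx_d (p2 ∘ _)]dl0 // Em'.
    rewrite -(dcomp_dl dh) ?Eh; last by rewrite dl0 // cm dcompm0.
    rewrite dcompNl opprK dcompDr dcompNr !dcompA.
    by rewrite addrACA addrC addrA subrr add0r addrC.
  exists (p1 ∘ m).
    by split; [exact: deg0 | rewrite dl0 // cm dcompm0].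
  exists (m' - i2 ∘ r, e2 ∘ r) => /=.
    split; first by apply: cx_degD => //; apply/cx_degN/deg0.
    by apply: (deg_dcomp_eq de2 dr); lia.
  congr (_, _).
    by rewrite cx_dD cx_dN dl0 // cr dcompm0 oppr0 addr0 Em'.
  rewrite -(dcomp_dl de2 cr) -E2 dcompDl dcompNl dcomp1m dcompDr dcompNr.
  rewrite -dcompA opprB opprB addrACA addrC.
  rewrite [X in _ = X]addrA subrK /r.
  by rewrite [RHS]addrC addrK.
- move=> u cu [[m q] [/= dm dq] [Em Eq]]; have [du _] := cu.
  exists (m ∘ i2 - (-1) ^+ `|i|%N *: (u ∘ e2)).
    apply: cx_degD; first exact: deg0'.
    by apply/cx_degN/cx_degZ; apply: (deg_dcomp_eq du de2); lia.
  rewrite cx_dD cx_dN cx_dZ (dr0 _ _ _ _ _ _ dm) // -Em -(dcomp_dr _ cu) -E2.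
  by rewrite dcompDr dcompNr dcompm1 dcompA opprB addrC subrK.
- case=> m q [[/= dm dq] [cm Ecq]]; have cym : cycle i m by [].
  have cq : m ∘ i1 + cx_d q = 0 by rewrite -[LHS]opprK opprD Ecq oppr0.
  pose sg := (-1) ^+ `|i|%N : k.
  pose m' := - (q ∘ p1 + sg *: (m ∘ e)).
  have dm' : cx_deg (i - 1) m'.
    apply/cx_degN/cx_degD; first exact: deg0'.
    by apply: cx_degZ; apply: (deg_dcomp_eq dm de); lia.
  have Em' : cx_d m' = m - m ∘ i2 ∘ p2.
    rewrite cx_dN cx_dD cx_dZ (dr0 _ _ _ _ _ _ dq) // -(dcomp_dr _ cym) -E.
    rewrite !dcompDr dcompNr dcompm1 !dcompA.
    rewrite [in X in X + _](_ : cx_d q = - (m ∘ i1)); last first.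
      by apply/eqP; rewrite -addr_eq0 addrC cq.
    by rewrite dcompNl !addrA addNr add0r opprB.
  have cu : cycle i (m ∘ i2).
    by split; [exact: deg0' | rewrite (dr0 _ _ _ _ _ _ dm) // cm dcomp0m].
  pose r := q - sg *: (m ∘ i2 ∘ h) + m' ∘ i1.
  have dr : cx_deg (i - 1) r.
    apply: cx_degD; last exact: deg0'.
    apply: cx_degD => //; apply/cx_degN/cx_degZ.
    exact: (deg_dcomp_eq cu.1 dh).
  have cr : cx_d r = 0.
    rewrite cx_dD cx_dD cx_dN cx_dZ -(dcomp_dr _ cu) (dr0 _ _ _ _ _ _ dm') //.
    rewrite Em' Eh dcompNr opprK dcompDl dcompNl !dcompA.
    by rewrite addrACA addrC addrA subrr add0r addrC.
  exists (m ∘ i2) => //.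
  exists (m' - r ∘ p1, (-1) ^+ `|i - 1|%N *: (r ∘ e1)) => /=.
    split; first by apply: cx_degD => //; apply/cx_degN/deg0'.
    by apply: cx_degZ; apply: (deg_dcomp_eq dr de1); lia.
  congr (_, _).
    by rewrite cx_dD cx_dN (dr0 _ _ _ _ _ _ dr) // cr dcomp0m oppr0 addr0 Em'.
  have cyr : cycle (i - 1) r by [].
  rewrite cx_dZ -(dcomp_dr _ cyr) -E1 dcompDr dcompNr dcompm1 dcompDl dcompNl.
  rewrite -(dcompA r) opprB opprB addrACA addrC.
  rewrite [X in _ = X]addrA subrK /r.
  by rewrite [RHS]addrC addrK.
Qed.

Lemma split_exists A C :
  exists s : {B : D & h3 A B C}, short_exact (projT2 s) /\ split_seq (projT2 s).
Proof.
have [_ /(_ A C) [B [i1 [i2 [p1 [p2 bp]]]]]] := ab_additive D.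
have /H0cls_inj E1 := bip11 bp; have /H0cls_inj E2 := bip22 bp.
have /H0cls_inj [h dh Eh] := bip21 bp; have /H0cls_inj E := bip_sum bp.
have dh1 : cx_d (- h) = - (qrepr p2 ∘ qrepr i1) by rewrite cx_dN -Eh subr0.
pose xi := H3 (qreprP i1) (qreprP p2) (cx_degN dh) dh1.
have qin_repr (X Y : D) (f : H0 X Y) : qin f (qrepr f).
  rewrite /qin (s2valP' (cid2 (svalP f))).
  by split; [exact: qreprP | exact: homotopic_refl].
exists (existT _ B xi); split => /=.
  apply: (@splitting_exact _ _ _ xi _ _ (qreprP i2) (qreprP p1) E1 E2).
  apply: homotopic_trans E; apply: homotopic_sym.
  by apply: homotopicD; apply: qrepr_H0cls.
by exists i1, i2, p1, p2; split; rewrite //=; apply: qin_repr.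
Qed.

Definition ext_rep (C A : D) := {B : D & h3 A B C}.

Definition ext (C A : D) : Type :=
  quo (fun s : ext_rep C A => short_exact (projT2 s))
      (fun s s' => exists b, has_mor (projT2 s) (projT2 s') (did A) b (did C)).

Definition ext_zero (C A : D) : ext C A :=
  qcls (P := fun s : ext_rep C A => short_exact (projT2 s)) _
    (proj1 (svalP (cid (split_exists A C)))).

Definition ext_pull (C' C A : D) (c : H0 C' C) (delta : ext C A) : ext C' A :=
  the (ext_zero C' A) (fun eps => exists c0 s s' b,
    [/\ qin c c0, qin eps s, qin delta s' &
        has_mor (projT2 s) (projT2 s') (did A) b c0]).

Definition ext_push (C A A' : D) (a : H0 A A') (delta : ext C A) : ext C A' :=
  the (ext_zero C A') (fun eps => exists a0 s s' b,
    [/\ qin a a0, qin delta s, qin eps s' &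
        has_mor (projT2 s) (projT2 s') a0 b (did C)]).

(* eps is the direct sum of delta1 and delta2, formed along the given
   coproduct injections of the end terms. *)
Definition ext_dsum (C1 A1 C2 A2 C A : D) (i1 : H0 A1 A) (i2 : H0 A2 A)
    (j1 : H0 C1 C) (j2 : H0 C2 C)
    (delta1 : ext C1 A1) (delta2 : ext C2 A2) (eps : ext C A) :=
  exists s1 s2 s, [/\ qin delta1 s1, qin delta2 s2, qin eps s &
  exists i10 i20 j10 j20, [/\ qin i1 i10, qin i2 i20, qin j1 j10, qin j2 j20 &
  exists (m1 : H0 (projT1 s1) (projT1 s)) (m2 : H0 (projT1 s2) (projT1 s))
    r1 r2 m10 m20,
    [/\ H0_biproduct m1 m2 r1 r2, qin m1 m10, qin m2 m20,
        has_mor (projT2 s1) (projT2 s) i10 m10 j10 &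
        has_mor (projT2 s2) (projT2 s) i20 m20 j20]]].

(* The Baer sum: the direct sum of delta1 and delta2, pulled back along the
   diagonal of C and pushed out along the codiagonal of A. *)
Definition ext_add (C A : D) (delta1 delta2 : ext C A) : ext C A :=
  the (ext_zero C A) (fun sigma =>
    exists (AA CC : D) (i1 i2 : H0 A AA) (p1 p2 : H0 AA A)
      (j1 j2 : H0 C CC) (q1 q2 : H0 CC C) (eps : ext CC AA),
      [/\ H0_biproduct i1 i2 p1 p2, H0_biproduct j1 j2 q1 q2,
          ext_dsum i1 i2 j1 j2 delta1 delta2 eps &
          sigma = ext_push (H0add p1 p2) (ext_pull (H0add j1 j2) eps)]).

Definition ext_scale (C A : D) (a : k) (delta : ext C A) : ext C A :=
  ext_push (H0scale a (H0id A)) delta.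

(* A --f--> B --g--> C --delta--> is a conflation: the sequence (f, g) is
   isomorphic, with identities on A and C, to the one underlying delta. *)
Definition conflation (A B C : D) (f : H0 A B) (g : H0 B C)
    (delta : ext C A) :=
  exists (s : ext_rep C A) (b : H0 B (projT1 s)) (f0 : H0 A (projT1 s))
    (g0 : H0 (projT1 s) C),
    [/\ qin delta s, qin f0 (h3f (projT2 s)), qin g0 (h3g (projT2 s)),
        H0_iso b & H0comp b f = f0 /\ H0comp g0 b = g].

(* The morphisms w and w' extending a conflation to a left and a right
   triangle. The connecting maps of the long exact sequences are compositions
   with their iterated loops and suspensions; the customary signs are omitted,
   as they change neither kernels nor images. *)
Definition left_conn (L : loops D) (C A : D) (delta : ext C A) :
    H0 (lp L C) A :=
  the (H0zero _ _) (fun w => exists w0 s,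
    [/\ qin w w0, qin delta s &
     exists (h' : dhom (lp L C) (projT1 s)) (eta : dhom (lp L C) C),
      [/\ cx_deg (-1) h', cx_d h' = - (h3f (projT2 s) ∘ w0), cx_deg (-2) eta &
          cx_d eta = h3g (projT2 s) ∘ h' - h3h (projT2 s) ∘ w0 - lph L C]]).

Definition right_conn (S : suspensions D) (C A : D) (delta : ext C A) :
    H0 C (su S A) :=
  the (H0zero _ _) (fun w => exists w0 s,
    [/\ qin w w0, qin delta s &
     exists (h' : dhom (projT1 s) (su S A)) (eta : dhom A (su S A)),
      [/\ cx_deg (-1) h', cx_d h' = - (w0 ∘ h3g (projT2 s)), cx_deg (-2) eta &
          cx_d eta = h' ∘ h3f (projT2 s) - w0 ∘ h3h (projT2 s) - suh S A]]).

End Extensions.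

(* The data of a category, and of a k-module. The laws are stated separately,
   since for extension groups they are theorems about [ext_add] etc. *)
Record catdata := CatData {
  c_ob :> Type;
  c_hom : c_ob -> c_ob -> Type;
  c_id : forall X, c_hom X X;
  c_comp : forall X Y Z, c_hom Y Z -> c_hom X Y -> c_hom X Z }.

Definition c_op (C : catdata) : catdata :=
  @CatData C (fun X Y => c_hom Y X) (@c_id C)
    (fun X Y Z g f => c_comp f g).

Definition H0cat (k : comPzRingType) (A : dgcat k) : catdata :=
  @CatData A (@H0 k A) (@H0id k A) (@H0comp k A).

Record moddata (k : comPzRingType) := ModData {
  m_car :> Type;
  m_zero : m_car;
  m_add : m_car -> m_car -> m_car;
  m_scale : k -> m_car -> m_car }.

Arguments m_zero {k m}.
Arguments m_add {k m}.
Arguments m_scale {k m}.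

Section Functors.
Variables (k : comPzRingType) (C : catdata).

Record is_module (M : moddata k) : Prop := {
  mod_addA : associative (@m_add k M);
  mod_addC : commutative (@m_add k M);
  mod_add0 : left_id m_zero (@m_add k M);
  mod_opp : forall x : M, exists y, m_add y x = m_zero;
  mod_scaleA : forall a b (x : M),
    m_scale a (m_scale b x) = m_scale (a * b) x;
  mod_scale1 : forall x : M, m_scale 1 x = x;
  mod_scaleDr : forall a (x y : M),
    m_scale a (m_add x y) = m_add (m_scale a x) (m_scale a y);
  mod_scaleDl : forall a b (x : M),
    m_scale (a + b) x = m_add (m_scale a x) (m_scale b x) }.

Definition is_linear (M N : moddata k) (u : M -> N) :=
  (forall x y, u (m_add x y) = m_add (u x) (u y)) /\
  (forall a x, u (m_scale a x) = m_scale a (u x)).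

Record funct := Funct {
  f_ob :> C -> moddata k;
  f_map : forall W W', c_hom W W' -> f_ob W -> f_ob W' }.

Record is_functor (F : funct) : Prop := {
  func_mod : forall W, is_module (F W);
  func_lin : forall W W' (c : c_hom W W'), is_linear (f_map (f := F) c);
  func_id : forall W (x : F W), f_map (c_id W) x = x;
  func_comp : forall W W' W'' (c' : c_hom W' W'') (c : c_hom W W') (x : F W),
    f_map (c_comp c' c) x = f_map c' (f_map c x) }.

Definition trans (F G : funct) := forall W, F W -> G W.

Definition is_natural (F G : funct) (u : trans F G) :=
  (forall W, is_linear (u W)) /\
  (forall W W' (c : c_hom W W') (x : F W),
     u W' (f_map c x) = f_map c (u W x)).

Definition mono_at (F G : funct) (u : trans F G) :=
  forall W (x : F W), u W x = m_zero -> x = m_zero.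

Definition exact_at (F G H : funct) (u : trans F G) (v : trans G H) :=
  forall W (y : G W), v W y = m_zero <-> exists x, u W x = y.

(* The sequence of functors
     0 -> LX (n-1) -> LY (n-1) -> LZ (n-1) -> LX (n-2) -> ... -> LZ 1 ->
       -> LX 0 -> LY 0 -> LZ 0 -> EX 0 -> EY 0 -> EZ 0 -> EX 1 -> ...
   consists of k-module valued functors and natural k-linear maps, and is
   exact at each term. *)
Record long_exact (n : nat) (LX LY LZ EX EY EZ : nat -> funct)
    (lu : forall j, trans (LX j) (LY j)) (lv : forall j, trans (LY j) (LZ j))
    (lw : forall j, trans (LZ j.+1) (LX j))
    (conn : trans (LZ 0%N) (EX 0%N))
    (eu : forall m, trans (EX m) (EY m)) (ev : forall m, trans (EY m) (EZ m))
    (ew : forall m, trans (EZ m) (EX m.+1)) : Prop := {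
  les_LX : forall j, (j < n)%N -> is_functor (LX j);
  les_LY : forall j, (j < n)%N -> is_functor (LY j);
  les_LZ : forall j, (j < n)%N -> is_functor (LZ j);
  les_EX : forall m, is_functor (EX m);
  les_EY : forall m, is_functor (EY m);
  les_EZ : forall m, is_functor (EZ m);
  les_lu : forall j, (j < n)%N -> is_natural (lu j);
  les_lv : forall j, (j < n)%N -> is_natural (lv j);
  les_lw : forall j, (j.+1 < n)%N -> is_natural (lw j);
  les_conn : is_natural conn;
  les_eu : forall m, is_natural (eu m);
  les_ev : forall m, is_natural (ev m);
  les_ew : forall m, is_natural (ew m);
  les_mono : mono_at (lu n.-1);
  les_exact_LY : forall j, (j < n)%N -> exact_at (lu j) (lv j);
  les_exact_LZ : forall j, (j.+1 < n)%N -> exact_at (lv j.+1) (lw j);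
  les_exact_LX : forall j, (j.+1 < n)%N -> exact_at (lw j) (lu j);
  les_exact_LZ0 : exact_at (lv 0%N) conn;
  les_exact_EX0 : exact_at conn (eu 0%N);
  les_exact_EY : forall m, exact_at (eu m) (ev m);
  les_exact_EZ : forall m, exact_at (ev m) (ew m);
  les_exact_EX : forall m, exact_at (ew m) (eu m.+1) }.

(* [b_ob M Z X] is contravariant in Z and covariant in X. *)
Record bimod := Bimod {
  b_ob :> C -> C -> moddata k;
  b_pull : forall Z' Z X, c_hom Z' Z -> b_ob Z X -> b_ob Z' X;
  b_push : forall Z X X', c_hom X X' -> b_ob Z X -> b_ob Z X' }.

Section Coend.
Variables M N : bimod.

(* The coend \int^Y M(Y,X) \otimes_k N(Z,Y), presented by the generators
   [Tensor alpha beta] and the relations [ceq] (module axioms, k-bilinearity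
   and the balancing relation). *)
Inductive cterm (Z X : C) : Type :=
  | Tensor (Y : C) (alpha : M Y X) (beta : N Z Y)
  | CZero
  | CAdd (t t' : cterm Z X)
  | CScale (a : k) (t : cterm Z X).

Arguments CZero {Z X}.

Inductive ceq (Z X : C) : cterm Z X -> cterm Z X -> Prop :=
  | ceq_refl t : ceq t t
  | ceq_sym t t' : ceq t t' -> ceq t' t
  | ceq_trans t t' t'' : ceq t t' -> ceq t' t'' -> ceq t t''
  | ceq_add t1 t1' t2 t2' :
      ceq t1 t1' -> ceq t2 t2' -> ceq (CAdd t1 t2) (CAdd t1' t2')
  | ceq_scale a t t' : ceq t t' -> ceq (CScale a t) (CScale a t')
  | ceq_addA t t' t'' : ceq (CAdd t (CAdd t' t'')) (CAdd (CAdd t t') t'')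
  | ceq_addC t t' : ceq (CAdd t t') (CAdd t' t)
  | ceq_add0 t : ceq (CAdd CZero t) t
  | ceq_opp t : ceq (CAdd (CScale (-1) t) t) CZero
  | ceq_scaleA a b t : ceq (CScale a (CScale b t)) (CScale (a * b) t)
  | ceq_scale1 t : ceq (CScale 1 t) t
  | ceq_scaleDr a t t' :
      ceq (CScale a (CAdd t t')) (CAdd (CScale a t) (CScale a t'))
  | ceq_scaleDl a b t : ceq (CScale (a + b) t) (CAdd (CScale a t) (CScale b t))
  | ceq_tensDl Y (alpha alpha' : M Y X) (beta : N Z Y) :
      ceq (Tensor (m_add alpha alpha') beta)
          (CAdd (Tensor alpha beta) (Tensor alpha' beta))
  | ceq_tensDr Y (alpha : M Y X) (beta beta' : N Z Y) :
      ceq (Tensor alpha (m_add beta beta'))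
          (CAdd (Tensor alpha beta) (Tensor alpha beta'))
  | ceq_tensZl a Y (alpha : M Y X) (beta : N Z Y) :
      ceq (Tensor (m_scale a alpha) beta) (CScale a (Tensor alpha beta))
  | ceq_tensZr a Y (alpha : M Y X) (beta : N Z Y) :
      ceq (Tensor alpha (m_scale a beta)) (CScale a (Tensor alpha beta))
  | ceq_balance Y Y' (y : c_hom Y Y') (alpha : M Y' X) (beta : N Z Y) :
      ceq (Tensor (b_pull y alpha) beta) (Tensor alpha (b_push y beta)).

Definition coend_car (Z X : C) : Type := quo (fun _ => True) (@ceq Z X).

Definition ccls (Z X : C) (t : cterm Z X) : coend_car Z X :=
  qcls (x := t) (@ceq Z X) I.

Definition coend_mod (Z X : C) : moddata k :=
  @ModData k (coend_car Z X)
    (ccls CZero)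
    (fun x y => ccls (CAdd (qrepr x) (qrepr y)))
    (fun a x => ccls (CScale a (qrepr x))).

Definition tensor (Z Y X : C) (alpha : M Y X) (beta : N Z Y) : coend_mod Z X :=
  ccls (Tensor alpha beta).

End Coend.

Arguments CZero {M N Z X}.

Fixpoint cterm_map (M M' N N' : bimod) (Z Z' X X' : C)
    (phi : forall Y, M Y X -> M' Y X') (psi : forall Y, N Z Y -> N' Z' Y)
    (t : cterm M N Z X) : cterm M' N' Z' X' :=
  match t with
  | Tensor Y alpha beta => Tensor (phi Y alpha) (psi Y beta)
  | CZero => CZero
  | CAdd t t' => CAdd (cterm_map phi psi t) (cterm_map phi psi t')
  | CScale a t => CScale a (cterm_map phi psi t)
  end.

Definition coend_map (M M' N N' : bimod) (Z Z' X X' : C)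
    (phi : forall Y, M Y X -> M' Y X') (psi : forall Y, N Z Y -> N' Z' Y)
    (x : coend_mod M N Z X) : coend_mod M' N' Z' X' :=
  ccls (cterm_map phi psi (qrepr x)).

Definition coend (M N : bimod) : bimod :=
  @Bimod (coend_mod M N)
    (fun Z' Z X c => coend_map (fun Y => id) (fun Y => b_pull c))
    (fun Z X X' a => coend_map (fun Y => b_push a) (fun Y => id)).

End Functors.

Definition presheaf (k : comPzRingType) (C : catdata) (M : bimod k C) (X : C) :
    funct k (c_op C) :=
  @Funct k (c_op C) (fun W => M W X) (fun W W' c => b_pull (c : @c_hom C W' W)).

Definition copresheaf (k : comPzRingType) (C : catdata) (M : bimod k C) (Z : C) :
    funct k C :=
  @Funct k C (fun W => M Z W) (fun W W' c => b_push c).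

Section LongSequences.
Variables (k : comPzRingType) (n : nat) (D : abelian_dgcat k n).

Definition H0mod : bimod k (H0cat D) :=
  @Bimod k (H0cat D)
    (fun Z X : D => @ModData k (H0 Z X) (H0zero Z X)
                      (@H0add k D Z X) (@H0scale k D Z X))
    (fun Z' Z X c f => H0comp f c)
    (fun Z X X' a f => H0comp a f).

Definition E1 : bimod k (H0cat D) :=
  @Bimod k (H0cat D)
    (fun C A : D => @ModData k (ext C A) (ext_zero C A)
                      (@ext_add k n D C A) (@ext_scale k n D C A))
    (@ext_pull k n D) (@ext_push k n D).

(* Note the shift: [Ext m] is E^{m+1}. *)
Fixpoint Ext (m : nat) : bimod k (H0cat D) :=
  if m is m'.+1 then coend (Ext m') E1 else E1.

Definition pushT (M : bimod k (H0cat D)) (X X' : D) (a : H0 X X') :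
    trans (presheaf M X) (presheaf M X') :=
  fun W => b_push (a : c_hom (c := H0cat D) X X').

Definition pullT (M : bimod k (H0cat D)) (Z Z' : D) (c : H0 Z' Z) :
    trans (copresheaf M Z) (copresheaf M Z') :=
  fun W => b_pull (c : c_hom (c := H0cat D) Z' Z).

Definition conn_contra (C A : D) (delta : ext C A) :
    trans (presheaf H0mod C) (presheaf (Ext 0) A) :=
  fun W (c : H0 W C) => ext_pull c delta.

Definition conn_covar (C A : D) (delta : ext C A) :
    trans (copresheaf H0mod A) (copresheaf (Ext 0) C) :=
  fun W (a : H0 A W) => ext_push a delta.

(* Left multiplication by delta, E^{m+1}(-,C) -> E^{m+2}(-,A). As
   E^{m+1} = E^m \otimes E is bracketed to the left, it acts on the first
   factor recursively. *)
Fixpoint delta_contra (C A : D) (delta : ext C A) (m : nat) :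
    forall W : D, Ext m W C -> Ext m.+1 W A :=
  match m return forall W : D, Ext m W C -> Ext m.+1 W A with
  | 0 => fun W gamma =>
      tensor (M := E1) (N := E1) (delta : E1 C A) (gamma : E1 W C)
  | m'.+1 => fun W => @coend_map k (H0cat D) (Ext m') (Ext m'.+1) E1 E1
               W W C A (@delta_contra C A delta m') (fun Y => id)
  end.

Definition ext_conn_contra (C A : D) (delta : ext C A) (m : nat) :
    trans (presheaf (Ext m) C) (presheaf (Ext m.+1) A) :=
  @delta_contra C A delta m.

Definition ext_conn_covar (C A : D) (delta : ext C A) (m : nat) :
    trans (copresheaf (Ext m) A) (copresheaf (Ext m.+1) C) :=
  fun W gamma => tensor (M := Ext m) (N := E1) gamma (delta : E1 C A).

End LongSequences.

Arguments pushT {k n D} M {X X'} a W _.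
Arguments pullT {k n D} M {Z Z'} c W _.
Arguments ext_conn_contra {k n D C A} delta m W _.
Arguments ext_conn_covar {k n D C A} delta m W _.

(* Main.v *)
(* A three-term homotopy complex xi : X -> Y -> Z is a twisted complex T, so that
   left exactness says that Hom(W, T) is acyclic in all degrees but the top one,
   and right exactness is the same condition in the opposite DG-category.  Every
   lifting argument then consists in writing down a cycle and using that it is a
   boundary.

   Pullbacks of short exact sequences come from an octahedral construction: if
   B -> E -> W is short exact and u : E -> C restricts to an n-epimorphism
   B -> C with kernel A, then u is again an n-epimorphism and A -> ker u -> W is
   short exact.  A morphism of extensions is null-homotopic on the left end iff it
   is on the right end; this gives the uniqueness of pullbacks and pushouts and
   the usual six-term exact sequences.

   Any finite family of classes in E(-, A) is pulled back from a single class e,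
   and the Baer sum satisfies u^* e + v^* e = (u + v)^* e, so the module laws for
   E are those of the Hom-groups of C.

   For the higher extensions, E(-, A) is weakly effaceable (each class dies on a
   deflation) and E(Z, -) is half exact.  This forces a Tor_1-vanishing: if
   a (x) b = 0 in the coend, then b = u_* b' with u^* a = 0.  Hence tensoring with
   E preserves exactness of F -> G -> H with H weakly effaceable, and both long
   exact sequences propagate from E^m to E^{m+1}. *)

From HB Require Import structures.
From mathcomp Require Import all_boot all_order all_algebra.
From mathcomp Require Import zify boolp.
Require Import Defs.

Set Implicit Arguments.
Unset Strict Implicit.
Unset Printing Implicit Defensive.

Import Order.TTheory GRing.Theory Num.Theory.
Local Open Scope ring_scope.

(** * Identities in a DG-category *)

(** The bound n enters through one fact: a cycle of degree -n is a boundary, whence the first map of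
    a left exact sequence is injective on cohomology in degree 1 - n, and dually. Being an
    n-epimorphism thus becomes a condition in the single degree 1 - n, easy to pass to composites
    and factors, and axiom (iii) converts it back into exactness. The same injectivity is the zero
    at the start of the long sequences.

    Statements about short exact sequences are proved on one side and transported through the
    opposite DG-category. Higher extensions are not symmetric in this way: E^(m+1) is bracketed as
    E^m (x) E, so the covariant variable lives in the first factor and the contravariant one in the
    second. The Tor-vanishing is therefore proved for an abstract pair of functors and used in both
    variances.

    Its obstacle is that a derivation of a (x) b = 0 may pass through arbitrary terms. A term gets a
    value only relative to an element from which all its second factors are obtained, and this
    element has to be refined during the derivation. *)

Inductive zexp :=
  | ZVar of nat | ZZero | ZAdd of zexp & zexp | ZOpp of zexp.

Section ZExp.
Variable V : zmodType.
Implicit Types (e : zexp) (s : seq V).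

Fixpoint zeval s e : V :=
  match e with
  | ZVar i => nth 0 s i
  | ZZero => 0
  | ZAdd a b => zeval s a + zeval s b
  | ZOpp a => - zeval s a
  end.

Fixpoint zcoef e (i : nat) : int :=
  match e with
  | ZVar j => if i == j then 1 else 0
  | ZZero => 0
  | ZAdd a b => zcoef a i + zcoef b i
  | ZOpp a => - zcoef a i
  end.

Lemma zevalE s e : zeval s e = \sum_(i < size s) s`_i *~ zcoef e i.
Proof.
elim: e => [j||a IHa b IHb|a IHa] /=.
- case: (ltnP j (size s)) => [lt_js|le_sj].
    rewrite (bigD1 (Ordinal lt_js)) //= eqxx mulr1z big1 ?addr0 // => i.
    by rewrite -val_eqE /= => /negPf ->.
  rewrite nth_default // big1 // => i _.
  by case: eqP => // eij; move: le_sj; rewrite -eij leqNgt ltn_ord.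
- by rewrite big1.
- by rewrite IHa IHb -big_split /=; apply: eq_bigr => i _; rewrite mulrzDr.
- by rewrite IHa -sumrN; apply: eq_bigr => i _; rewrite mulrNz.
Qed.

Definition zcheck n e e' := all (fun i => zcoef e i == zcoef e' i) (iota 0 n).

Lemma zcheckP s e e' : zcheck (size s) e e' -> zeval s e = zeval s e'.
Proof.
move=> /allP E; rewrite !zevalE; apply: eq_bigr => i _.
by rewrite (eqP (E i _)) // mem_iota add0n ltn_ord.
Qed.

End ZExp.

Ltac zindex x s :=
  lazymatch s with
  | x :: _ => constr:(0%N)
  | _ :: ?s' => let i := zindex x s' in constr:(S i)
  end.

Ltac zatoms s e :=
  lazymatch e with
  | (?a + ?b)%R => let s1 := zatoms s a in zatoms s1 b
  | (- ?a)%R => zatoms s a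
  | 0%R => s
  | _ => lazymatch s with
         | context [e :: _] => s
         | _ => constr:(e :: s)
         end
  end.

Ltac zreify s e :=
  lazymatch e with
  | (?a + ?b)%R => let a' := zreify s a in let b' := zreify s b in
                 constr:(ZAdd a' b')
  | (- ?a)%R => let a' := zreify s a in constr:(ZOpp a')
  | 0%R => constr:(ZZero)
  | _ => let i := zindex e s in constr:(ZVar i)
  end.

(** Decides identities valid in every abelian group, by comparing the integer coefficients of the
    atoms on both sides. Composites such as [g ∘ f] count as atoms, so they have to be normalised
    beforehand. *)
Ltac zmod :=
  lazymatch goal with
  | |- @eq ?T ?a ?b =>
    let s0 := constr:(@nil T) in
    let s1 := zatoms s0 a in let s := zatoms s1 b in
    let ea := zreify s a in let eb := zreify s b in
    refine (@zcheckP _ s ea eb _); vm_compute; reflexivity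
  end.

Section Basics.
Variables (k : comPzRingType) (A : dgcat k).
Implicit Types X Y Z W : A.

Lemma deg_cast (M : precx k) i j (x : M) : cx_deg i x -> i = j -> cx_deg j x.
Proof. by move=> dx <-. Qed.

(** The differential lands in degree 1, where non-positivity leaves only 0. Closedness of degree-0
    morphisms is therefore never a separate obligation. *)
Lemma d_deg0 X Y (f : dhom X Y) : cx_deg 0 f -> cx_d f = 0.
Proof. by move=> /cx_d_deg df; apply: dhom_nonpos df. Qed.

Lemma closed0_deg X Y (f : dhom X Y) : cx_deg 0 f -> closed0 f.
Proof. by move=> df; split=> //; apply: d_deg0. Qed.

(** After composites are associated to the right, the leftmost factors met by [dg] are structure
    maps and homotopies of degree 0, -1 or -2. These three cases of the Leibniz rule keep signs
    depending on a variable degree out of the calculations. *)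
Lemma dc0 X Y Z (g : dhom Y Z) (f : dhom X Y) :
  cx_deg 0 g -> cx_d (g ∘ f) = g ∘ cx_d f.
Proof. by move=> dg; rewrite (d_dcomp _ dg) (d_deg0 dg) dcomp0m add0r scale1r. Qed.

Lemma dcm1 X Y Z (g : dhom Y Z) (f : dhom X Y) :
  cx_deg (-1) g -> cx_d (g ∘ f) = cx_d g ∘ f - g ∘ cx_d f.
Proof. by move=> dg; rewrite (d_dcomp _ dg) /= expr1 scaleN1r. Qed.

Lemma dcm2 X Y Z (g : dhom Y Z) (f : dhom X Y) :
  cx_deg (-2) g -> cx_d (g ∘ f) = cx_d g ∘ f + g ∘ cx_d f.
Proof. by move=> dg; rewrite (d_dcomp _ dg) /= sqrrN expr1n scale1r. Qed.

End Basics.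

Ltac deg_ev :=
  lazymatch goal with
  | |- cx_deg _ (dcomp _ _) => eapply deg_dcomp; [deg_ev | deg_ev]
  | |- cx_deg _ (GRing.opp _) => eapply cx_degN; deg_ev
  | |- cx_deg _ (cx_d _) => eapply cx_d_deg; deg_ev
  | |- cx_deg _ (did _) => eapply deg_did
  | |- _ => eassumption
  end.

Ltac dgd :=
  rewrite ?(dcompDl, dcompDr, dcompNl, dcompNr, dcomp0m, dcompm0, dcomp1m,
            dcompm1);
  repeat first [apply: cx_degD | apply: cx_degN | apply: cx_deg0 ];
  (eapply deg_cast; [deg_ev | lia]).

Ltac dnorm :=
  rewrite ?(dcompDl, dcompDr, dcompNl, dcompNr, dcomp0m, dcompm0, dcomp1m,
            dcompm1, oppr0, addr0, add0r); rewrite -?dcompA.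

Ltac dpush1 :=
  match goal with
  | |- context [cx_d (?x + ?y)] => rewrite (cx_dD x y)
  | |- context [cx_d (- ?x)] => rewrite (cx_dN x)
  | |- context [cx_d 0] => rewrite cx_d0
  | |- context [cx_d (cx_d ?x)] => rewrite (cx_dd x)
  | H : cx_deg _ ?g |- context [cx_d (?g ∘ ?f)] =>
      first [rewrite (dc0 f H) | rewrite (dcm1 f H) | rewrite (dcm2 f H)]
  | H : cx_d ?x = _ |- context [cx_d ?x] => rewrite H
  | H : cx_deg 0 ?f |- context [cx_d ?f] => rewrite (d_deg0 H)
  | |- context [cx_d (did ?X)] => rewrite (d_deg0 (deg_did X))
  end.

(* Every relation available in a proof has the form d x = ..., so pushing d
   inwards and substituting decides the identities that occur. *)
Ltac dg := dnorm; repeat (dpush1; dnorm); zmod.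

Ltac dga := lazymatch goal with |- cx_deg _ _ => dgd | |- _ => dg end.

(** * Three-term complexes as twisted complexes *)

Section Acyclic.
Variables (k : comPzRingType) (A : dgcat k).
Implicit Types X Y Z W : A.

(* Cycles and boundaries of Hom(W, T), where T is the twisted complex of xi, with
   the signs arranged so that no sign depends on i. *)
Definition lcyc X Y Z (xi : h3 X Y Z) W (i : int)
    (a : dhom W X) (b : dhom W Y) (c : dhom W Z) : Prop :=
  [/\ cx_deg i a, cx_deg (i - 1) b & cx_deg (i - 2) c] /\
  [/\ cx_d a = 0, cx_d b = h3f xi ∘ a & cx_d c = h3g xi ∘ b + h3h xi ∘ a].

Definition lbnd X Y Z (xi : h3 X Y Z) W (i : int)
    (a : dhom W X) (b : dhom W Y) (c : dhom W Z) : Prop :=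
  exists a' b' c',
  [/\ cx_deg (i - 1) a', cx_deg (i - 2) b' & cx_deg (i - 3) c'] /\
  [/\ cx_d a' = a, cx_d b' = h3f xi ∘ a' - b &
      cx_d c' = c + h3g xi ∘ b' + h3h xi ∘ a'].

(** A triple can be nonzero up to i = 2, where its last component has degree 0. Acyclicity at i = 2
    would make every map to Z lift along g up to homotopy, hence the bound 1. *)
Definition acyclic X Y Z (xi : h3 X Y Z) :=
  forall W i (a : dhom W X) b c, i <= 1 -> lcyc xi i a b c -> lbnd xi i a b c.

(** Up to shift and signs, Hom(W, T) is the cone of Hom(W, X) -> Fib. Acyclicity in degree i amounts
    to injectivity on H^i together with surjectivity on H^(i-1); at i = 1 the injectivity is void,
    as degree-1 morphisms vanish. *)
Lemma left_exactP X Y Z (xi : h3 X Y Z) : left_exact xi <-> acyclic xi.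
Proof.
case: xi => f g h [df cf] [dg_ cg] dh Eh; split.
- move=> lx W i a b c le_i1 [[da db dc] /= [Ea Eb Ec]].
  have [a0 [da0 Ea0]] : exists a0, cx_deg (i - 1) a0 /\ cx_d a0 = a.
    have [lt0i|le_i0] := ltP 0 i.
      exists 0; split; first exact: cx_deg0.
      by rewrite cx_d0 (dhom_nonpos lt0i da).
    have [inj _] := lx W i le_i0.
    have [//||a0 da0 ->] := inj a; last by exists a0.
    exists (b, - c) => /=; first by split; dgd.
    by congr (_, _) => /=; dg.
  have le_i0 : i - 1 <= 0 by lia.
  have [_ sur] := lx W (i - 1) le_i0.
  (* Having chosen the primitive [a0] of a, what is left of (b, c) is a cycle of Fib of degree i -
     1; surjectivity there supplies a closed correction [a1] of [a0]. *)
  have [|a1 [da1 Ea1] [[m q] [/= dm dq] [Em Eq]]] :=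
      sur (b - f ∘ a0, - c - h ∘ a0).
    split; first by split=> /=; dgd.
    by congr (_, _) => /=; dg.
  exists (a0 + a1), (- m), q; split; first by split; dgd.
  split=> /=; [by dg| |].
  + by rewrite cx_dN -Em; dg.
  + have -> : cx_d q = - (- c - h ∘ a0 - h ∘ a1) - g ∘ m by rewrite Eq; dg.
    by dg.
- move=> ac W i le_i0; split.
  + move=> u [du Eu] [[m q] [/= dm dq] [Em Eq]].
    have [||a' [b0 [c0 [[da' db0 dc0] [Ea' Eb0 Ec0]]]]] := ac W i u m (- q).
    - by lia.
    - split; first by split; dgd.
      by split=> //=; dnorm; rewrite Eq; dg.
    - by exists a'.
  + move=> [m q] [[/= dm dq] [Em Eq]].
    have Eq' : cx_d q = - (g ∘ m).
      by rewrite -[LHS]addr0 -Eq; zmod.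
    (* A cycle of Fib of degree i is a cycle of T of degree i + 1 with zero first component, so i <=
       0 calls for acyclicity up to degree 1. *)
    have [||a' [b' [c' [[da' db' dc'] /= [Ea' Eb' Ec']]]]] :=
      ac W (i + 1) 0 m (- q).
    - by lia.
    - split; first by split; dgd.
      by split=> /=; dg.
    exists a'; first by split=> //; dgd.
    exists (- b', c') => /=; first by split; dgd.
    by congr (_, _) => /=; dg.
Qed.

(** The lifting property of a homotopy kernel: a map b with a contraction c of g ∘ b lifts along f,
    and the lift comes with its homotopies. *)
Lemma acyclic1 X Y Z (xi : h3 X Y Z) W (b : dhom W Y) (c : dhom W Z) :
  acyclic xi -> cx_deg 0 b -> cx_deg (-1) c -> cx_d c = h3g xi ∘ b ->
  exists a' b' c', [/\ cx_deg 0 a', cx_deg (-1) b' & cx_deg (-2) c'] /\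
    cx_d b' = h3f xi ∘ a' - b /\
    cx_d c' = c + h3g xi ∘ b' + h3h xi ∘ a'.
Proof.
move=> ac db dc Ec; have [||a' [b' [c' [[da' db' dc'] [_ Eb' Ec']]]]] := ac W 1 0 b c.
- by [].
- split; first by split; dgd.
  by split=> //; dg.
- by exists a', b', c'; split=> //; split; dgd.
Qed.

(** The uniqueness counterpart of [acyclic1]: applied to the difference of two lifts, it shows them
    to be homotopic. *)
Lemma acyclic0 X Y Z (xi : h3 X Y Z) W (a : dhom W X) b c :
  acyclic xi -> [/\ cx_deg 0 a, cx_deg (-1) b & cx_deg (-2) c] ->
  cx_d b = h3f xi ∘ a -> cx_d c = h3g xi ∘ b + h3h xi ∘ a -> boundary 0 a.
Proof.
move=> ac [da db dc] Eb Ec; have [||a' [b0 [c0 [[da' db0 dc0] [Ea' Eb0 Ec0]]]]] := ac W 0 a b c.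
- by [].
- by split; [split=> //; dgd | split=> //; exact: d_deg0].
- by exists a'.
Qed.

(** The six entries of a morphism form a triangular map of twisted complexes; with the signs of
    [lcyc], the entry t occurs negated. *)
Lemma h3_mor_lcyc X Y Z X' Y' Z' (xi : h3 X Y Z) (xi' : h3 X' Y' Z')
    x y z s s' t W i (a : dhom W X) b c :
  h3_mor xi xi' x y z s s' t -> lcyc xi i a b c ->
  lcyc xi' i (x ∘ a) (y ∘ b + s ∘ a) (z ∘ c + s' ∘ b - t ∘ a).
Proof.
case: xi xi' => f g h [df cf] [dg_ cg] dh Eh [f' g' h' [df' cf'] [dg' cg'] dh' Eh'].
case=> [[dx _] [dy _] [dz _] ds ds' dt Es Es' Et] /= [[da db dc] /= [Ea Eb Ec]].
move: Es Es' Et => /= Es Es' Et.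
split; first by split; dgd.
by split=> /=; dg.
Qed.

(* The hypotheses make the endomorphism unipotent for the filtration of T. *)
Lemma acyclic_endo X Y Z (xi : h3 X Y Z) x y z s s' t :
  h3_mor xi xi x y z s s' t ->
  homotopic x (did X) -> homotopic y (did Y) -> homotopic z (did Z) ->
  (forall W i (a : dhom W X) b c, i <= 1 -> lcyc xi i a b c ->
    lbnd xi i (x ∘ a) (y ∘ b + s ∘ a) (z ∘ c + s' ∘ b - t ∘ a)) ->
  acyclic xi.
Proof.
case: xi => f g h [df cf] [dg_ cg] dh Eh.
case=> [[dx _] [dy _] [dz _] ds ds' dt _ _ _] [al dal Eal] [be dbe Ebe] [ga dga Ega].
move=> kill W i a b c lei [[da db dc] /= [Ea Eb Ec]].
have {}Eal : cx_d al = x - did X by [].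
have {}Ebe : cx_d be = y - did Y by [].
have {}Ega : cx_d ga = z - did Z by [].
have [|/= a' [b0 [c0 [[da' db0 dc0] /= [Ea' Eb0 Ec0]]]]] := kill W i a b c lei.
  by split; split.
(* As x = 1 + d al and a is closed, subtracting al ∘ a turns the primitive of x ∘ a into one of a.
   The cycle that remains has first component 0, and two further rounds clear b and c in the same
   way. *)
pose a1 := a' - al ∘ a; have da1 : cx_deg (i - 1) a1 by rewrite /a1; dgd.
have Ea1 : cx_d a1 = a by rewrite /a1; dg.
clearbody a1.
have [|/= a2 [b' [c1 [[da2 db' dc1] /= [Ea2 Eb' Ec1]]]]] :=
  kill W i 0 (b - f ∘ a1) (c + h ∘ a1) lei.
  by split; split=> /=; dga.
have {}Ea2 : cx_d a2 = 0 by rewrite Ea2; dg.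
pose b2 := b' + be ∘ (b - f ∘ a1); have db2 : cx_deg (i - 2) b2 by rewrite /b2; dgd.
have Eb2 : cx_d b2 = f ∘ a2 - (b - f ∘ a1) by rewrite /b2; dg.
clearbody b2.
have [|/= a3 [b3 [c3 [[da3 db3 dc3] /= [Ea3 Eb3 Ec3]]]]] :=
  kill W i 0 0 (c + h ∘ a1 + g ∘ b2 + h ∘ a2) lei.
  by split; split=> /=; dga.
exists (a1 + a2 + a3), (b2 + b3), (c3 - ga ∘ (c + h ∘ a1 + g ∘ b2 + h ∘ a2)).
split; first by split; dgd.
by split=> /=; dg.
Qed.

End Acyclic.

(** * Morphisms of three-term complexes *)

Section Morphisms.
Variables (k : comPzRingType) (A : dgcat k).
Implicit Types X Y Z W : A.

Lemma has_mor_comp X Y Z X' Y' Z' X'' Y'' Z'' (xi : h3 X Y Z)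
    (xi' : h3 X' Y' Z') (xi'' : h3 X'' Y'' Z'') x1 y1 z1 x2 y2 z2 :
  has_mor xi xi' x1 y1 z1 -> has_mor xi' xi'' x2 y2 z2 ->
  has_mor xi xi'' (x2 ∘ x1) (y2 ∘ y1) (z2 ∘ z1).
Proof.
case: xi xi' xi'' => f g h [df cf] [dg_ cg] dh Eh
  [f' g' h' [df' cf'] [dg' cg'] dh' Eh']
  [f2 g2 h2 [df2 cf2] [dg2 cg2] dh2 Eh2].
case=> s1 [s1' [t1 [[dx1 c1] [dy1 c2] [dz1 c3] ds1 ds1' dt1 /= Es1 Es1' Et1]]].
case=> s2 [s2' [t2 [[dx2 c4] [dy2 c5] [dz2 c6] ds2 ds2' dt2 /= Es2 Es2' Et2]]].
exists (y2 ∘ s1 + s2 ∘ x1), (z2 ∘ s1' + s2' ∘ y1),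
  (z2 ∘ t1 + t2 ∘ x1 - s2' ∘ s1).
split=> /=; first [by apply: closed0_comp | dga].
Qed.

Lemma has_mor_homotopic X Y Z X' Y' Z' (xi : h3 X Y Z) (xi' : h3 X' Y' Z')
    x y z x' y' z' :
  closed0 x' -> closed0 y' -> closed0 z' ->
  homotopic x' x -> homotopic y' y -> homotopic z' z ->
  has_mor xi xi' x y z -> has_mor xi xi' x' y' z'.
Proof.
case: xi xi' => f g h [df cf] [dg_ cg] dh Eh
  [f' g' h' [df' cf'] [dg' cg'] dh' Eh'].
move=> cx' cy' cz' [al dal /esym Eal] [be dbe /esym Ebe] [ga dga_ /esym Ega].
case=> s [s' [t [[dx c1] [dy c2] [dz c3] ds ds' dt /= Es Es' Et]]].
exists (s + f' ∘ al - be ∘ f), (s' + g' ∘ be - ga ∘ g), (t + ga ∘ h + h' ∘ al).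
split=> //=; dga.
Qed.

Lemma has_mor_id X Y Z (xi : h3 X Y Z) : has_mor xi xi (did X) (did Y) (did Z).
Proof.
case: xi => f g h [df cf] [dg_ cg] dh Eh; exists 0, 0, 0.
by split=> /=; first [apply: closed0_id | dga].
Qed.

Lemma has_mor_add X Y Z X' Y' Z' (xi : h3 X Y Z) (xi' : h3 X' Y' Z')
    x1 y1 z1 x2 y2 z2 :
  has_mor xi xi' x1 y1 z1 -> has_mor xi xi' x2 y2 z2 ->
  has_mor xi xi' (x1 + x2) (y1 + y2) (z1 + z2).
Proof.
case=> s1 [s1' [t1 [c1 c2 c3 ds1 ds1' dt1 Es1 Es1' Et1]]].
case=> s2 [s2' [t2 [c4 c5 c6 ds2 ds2' dt2 Es2 Es2' Et2]]].
exists (s1 + s2), (s1' + s2'), (t1 + t2).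
by split; first [exact: closed0D | dga].
Qed.

Lemma has_mor_scale X Y Z X' Y' Z' (xi : h3 X Y Z) (xi' : h3 X' Y' Z')
    (a : k) x y z :
  has_mor xi xi' x y z -> has_mor xi xi' (a *: x) (a *: y) (a *: z).
Proof.
case=> s [s' [t [c1 c2 c3 ds ds' dt Es Es' Et]]].
exists (a *: s), (a *: s'), (a *: t).
split; first [exact: closed0Z | exact: cx_degZ |
  by rewrite cx_dZ (Es, Es', Et) !scalerBr !(dcompZl, dcompZr)].
Qed.

Lemma has_mor_sub X Y Z X' Y' Z' (xi : h3 X Y Z) (xi' : h3 X' Y' Z')
    x1 y1 z1 x2 y2 z2 :
  has_mor xi xi' x1 y1 z1 -> has_mor xi xi' x2 y2 z2 ->
  has_mor xi xi' (x1 - x2) (y1 - y2) (z1 - z2).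
Proof.
move=> m1 /(has_mor_scale (-1)); rewrite !scaleN1r; exact: has_mor_add.
Qed.

(** Adding such a morphism changes the left end by r ∘ f and leaves the right end alone. [mor_null]
    with l = 0 is a converse, and [has_mor_factr] is the mirror image. *)
Lemma has_mor_fact X Y Z X' Y' Z' (xi : h3 X Y Z) (xi' : h3 X' Y' Z')
    (r : dhom Y X') : closed0 r ->
  has_mor xi xi' (r ∘ h3f xi) (h3f xi' ∘ r) 0.
Proof.
case: xi xi' => f g h [df cf] [dg_ cg] dh Eh
  [f' g' h' [df' cf'] [dg' cg'] dh' Eh'] [dr cr] /=.
exists 0, (- (h' ∘ r)), 0.
by split=> /=; first [apply: closed0_deg; dgd | dga].
Qed.

Lemma has_mor_factr X Y Z X' Y' Z' (xi : h3 X Y Z) (xi' : h3 X' Y' Z')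
    (l : dhom Z Y') : closed0 l ->
  has_mor xi xi' 0 (l ∘ h3g xi) (h3g xi' ∘ l).
Proof.
case: xi xi' => f g h [df cf] [dg_ cg] dh Eh
  [f' g' h' [df' cf'] [dg' cg'] dh' Eh'] [dl cl] /=.
exists (l ∘ h), 0, 0.
by split=> /=; first [apply: closed0_deg; dgd | dga].
Qed.

(** The map y ∘ f lifts along f', because g' ∘ y ∘ f has the contraction s' ∘ f - z ∘ h: s' moves it
    to z ∘ g ∘ f, which h contracts. *)
Lemma left_fill X Y Z X' Y' Z' (xi : h3 X Y Z) (xi' : h3 X' Y' Z') y z :
  acyclic xi' -> closed0 y -> closed0 z ->
  homotopic (h3g xi' ∘ y) (z ∘ h3g xi) -> exists x, has_mor xi xi' x y z.
Proof.
case: xi xi' => f g h [df cf] [dg_ cg] dh Eh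
  [f' g' h' [df' cf'] [dg' cg'] dh' Eh'] ac [dy cy] [dz cz].
case=> s' ds' /= /esym Es'; rewrite sub0r in ds'.
have [|||x [s [c' [[dx ds dc'] /= [Es Ec']]]]] :=
  acyclic1 (b := y ∘ f) (c := s' ∘ f - z ∘ h) ac; try by rewrite /=; dga.
exists x, s, s', (- c').
by split=> //=; first [exact: closed0_deg | dga].
Qed.

(** The difference y - l ∘ g becomes null after g', hence lifts along f' to r. Then x and r ∘ f
    become homotopic after f', and uniqueness of lifts identifies them. *)
Lemma mor_null X Y Z X' Y' Z' (xi : h3 X Y Z) (xi' : h3 X' Y' Z') x y z
    (l : dhom Z Y') :
  acyclic xi' -> has_mor xi xi' x y z -> closed0 l ->
  homotopic z (h3g xi' ∘ l) ->
  exists2 r : dhom Y X', closed0 r & homotopic x (r ∘ h3f xi).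
Proof.
case: xi xi' => f g h [df cf] [dg_ cg] dh Eh
  [f' g' h' [df' cf'] [dg' cg'] dh' Eh'] ac.
case=> s [s' [t [[dx c1] [dy c2] [dz c3] ds ds' dt /= Es Es' Et]]].
move=> [dl cl] [e de /= /esym Ee]; rewrite sub0r in de.
have [|||r [b [c [[dr db dc] /= [Eb Ec]]]]] :=
  acyclic1 (b := y - l ∘ g) (c := s' + e ∘ g) ac; try by rewrite /=; dga.
exists r; first exact: closed0_deg.
by apply: (@acyclic0 _ _ _ _ _ _ _ _ (s - l ∘ h - b ∘ f)
  (e ∘ h - t - c ∘ f) ac) => /=; first [by split; dgd | dg].
Qed.

End Morphisms.

(** * The opposite DG-category *)

Section SignInvolution.
Variables (k : comPzRingType) (M : cx k).
Implicit Types (x y : M) (l : seq (int * M)).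

Definition hom_seq l := forall p, p \in l -> cx_deg p.1 p.2.

(** The involution multiplying the degree-i component by (-1)^i. Decompositions into components are
    only known to exist, so it is introduced as a relation and then shown to be single-valued. *)
Definition sgn_rel x y := exists l,
  [/\ hom_seq l, x = \sum_(p <- l) p.2 &
      y = \sum_(p <- l) (-1) ^+ `|p.1|%N *: p.2].

Lemma sgn_rel_ex x : exists y, sgn_rel x y.
Proof.
have [s [c [dc ->]]] := cx_span x.
eexists; exists [seq (i, c i) | i <- s]; split; last by [].
  by move=> p /mapP[i _ ->].
by rewrite big_map.
Qed.

Lemma sgn_rel_hom i x : cx_deg i x -> sgn_rel x ((-1) ^+ `|i|%N *: x).
Proof.
move=> dx; exists [:: (i, x)]; rewrite !big_seq1; split=> // p.
by rewrite inE => /eqP ->.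
Qed.

Lemma sgn_relL a x y x' y' :
  sgn_rel x y -> sgn_rel x' y' -> sgn_rel (a *: x + x') (a *: y + y').
Proof.
move=> [l [dl -> ->]] [l' [dl' -> ->]].
exists ([seq (p.1, a *: p.2) | p <- l] ++ l'); split.
- by move=> p; rewrite mem_cat => /orP[/mapP[q /dl dq ->]|/dl' //]; apply: cx_degZ.
- by rewrite big_cat big_map /= scaler_sumr.
- rewrite big_cat big_map /= scaler_sumr; congr (_ + _).
  by apply: eq_bigr => p _; rewrite !scalerA mulrC.
Qed.

(** [cx_indep] concerns sums over distinct degrees, whereas a decomposition in [sgn_rel] may repeat
    a degree; this grouping connects the two. *)
Lemma sum_by_degree (l : seq (int * M)) (F : int -> M -> M) :
  (forall i, F i 0 = 0) -> (forall i x y, F i (x + y) = F i x + F i y) ->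
  \sum_(p <- l) F p.1 p.2 =
  \sum_(i <- undup (map fst l)) F i (\sum_(p <- l | p.1 == i) p.2).
Proof.
move=> F0 FD.
have FS i (r : seq (int * M)) (P : pred (int * M)) :
    F i (\sum_(p <- r | P p) p.2) = \sum_(p <- r | P p) F i p.2.
  by apply: (big_morph (F i)); [apply: FD|apply: F0].
transitivity (\sum_(i <- undup (map fst l)) \sum_(p <- l | p.1 == i) F p.1 p.2).
  under [RHS]eq_bigr do rewrite big_mkcond.
  rewrite exchange_big /= big_seq [RHS]big_seq; apply: eq_bigr => p pl.
  rewrite (bigD1_seq p.1) ?undup_uniq ?mem_undup ?map_f //= eqxx.
  rewrite big1 ?addr0 // => i /negPf; rewrite eq_sym => -> //.
by apply: eq_bigr => i _; rewrite FS; apply: eq_bigr => p /eqP ->.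
Qed.

Lemma sgn_rel0 y : sgn_rel 0 y -> y = 0.
Proof.
case=> l [dl E0 ->].
rewrite (@sum_by_degree l (fun i x => (-1) ^+ `|i|%N *: x)).
- have := @sum_by_degree l (fun _ x => x) (fun _ => erefl) (fun _ _ _ => erefl).
  rewrite -E0 => /esym /cx_indep E; rewrite big_seq big1 // => i il.
  rewrite E ?scaler0 ?undup_uniq // => j.
  rewrite big_seq_cond; apply: big_ind => [|u v|p /andP[/dl dp /eqP <- //]].
    exact: cx_deg0.
  exact: cx_degD.
- by move=> i; rewrite scaler0.
- by move=> i u v; rewrite scalerDr.
Qed.

Definition sgn x : M := sval (cid (sgn_rel_ex x)).

Lemma sgnP x : sgn_rel x (sgn x).
Proof. exact: svalP (cid (sgn_rel_ex x)). Qed.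

Lemma sgn_rel_uniq x y : sgn_rel x y -> sgn x = y.
Proof.
move=> xy; apply/eqP; rewrite -subr_eq0; apply/eqP/sgn_rel0.
have := sgn_relL (-1) xy (sgnP x); rewrite !scaleN1r addNr.
by rewrite [- y + _]addrC.
Qed.

Lemma sgn_hom i x : cx_deg i x -> sgn x = (-1) ^+ `|i|%N *: x.
Proof. by move=> /sgn_rel_hom/sgn_rel_uniq. Qed.

Lemma sgnL a x y : sgn (a *: x + y) = a *: sgn x + sgn y.
Proof. by apply/sgn_rel_uniq/sgn_relL; apply: sgnP. Qed.

Lemma hom_ind (P : M -> Prop) :
  P 0 -> (forall x y, P x -> P y -> P (x + y)) ->
  (forall i x, cx_deg i x -> P x) -> forall x, P x.
Proof.
move=> P0 PD Ph x; have [s [c [dc ->]]] := cx_span x.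
by apply: big_ind => // i _; apply: Ph (dc i).
Qed.

End SignInvolution.

Section Opposite.
Variables (k : comPzRingType).

Section OpCx.
Variable M : cx k.

(* With d' x = (-1)^|x| d x the reversed composition obeys the Leibniz rule
   without a Koszul sign, hence stays bilinear on inhomogeneous elements. *)
Definition op_precx : precx k :=
  @PreCx k (cx_mod M) (fun i x => cx_deg i x) (fun x => cx_d (sgn x)).

Lemma op_d_hom i (x : M) :
  cx_deg i x -> @cx_d k op_precx x = (-1) ^+ `|i|%N *: cx_d x.
Proof. by move=> dx; rewrite /= (sgn_hom dx) cx_dZ. Qed.

Lemma op_dL (a : k) (x y : op_precx) :
  cx_d (a *: x + y) = a *: cx_d x + cx_d y.
Proof. by rewrite /= sgnL cx_dL. Qed.

Lemma op_d_deg i (x : op_precx) : cx_deg i x -> cx_deg (i + 1) (cx_d x).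
Proof.
by move=> dx; rewrite (op_d_hom dx); apply/cx_degZ/cx_d_deg.
Qed.

Lemma op_d0 : @cx_d k op_precx 0 = 0.
Proof. by rewrite (op_d_hom (cx_deg0 M 0)) cx_d0 scaler0. Qed.

Lemma op_dD (x y : op_precx) : cx_d (x + y) = cx_d x + cx_d y.
Proof. by have := op_dL 1 x y; rewrite !scale1r. Qed.

Lemma op_dd (x : op_precx) : cx_d (cx_d x) = 0.
Proof.
move: x; apply: (@hom_ind k M) => [|x y Ex Ey|i x dx].
- by rewrite !op_d0.
- by rewrite !op_dD Ex Ey addr0.
- by rewrite (op_d_hom (op_d_deg dx)) (op_d_hom dx) cx_dZ cx_dd !scaler0.
Qed.

Definition op_cx : cx k :=
  @Cx k op_precx (@cx_deg0 k M) (@cx_degL k M) (@cx_span k M) (@cx_indep k M)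
    op_dL op_d_deg op_dd.

End OpCx.

Lemma op_dE (M : cx k) i (x : M) :
  cx_deg i x -> @cx_d k (op_cx M) x = (-1) ^+ `|i|%N *: @cx_d k M x.
Proof. exact: op_d_hom. Qed.

Lemma op_boundary (M : cx k) i (x : M) :
  @boundary k (op_cx M) i x <-> @boundary k M i x.
Proof.
split=> -[y dy ->]; exists ((-1) ^+ `|(i - 1)%R|%N *: y); try exact: cx_degZ.
  by rewrite (@op_dE M _ _ dy) -cx_dZ.
by rewrite (@op_dE M _ _ (cx_degZ _ dy)) cx_dZ sgnK.
Qed.

Lemma op_cycle (M : cx k) i (x : M) :
  @cycle k (op_cx M) i x <-> @cycle k M i x.
Proof.
split=> -[dx Ex]; split=> //; last by rewrite (@op_dE M _ _ dx) Ex scaler0.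
by move: Ex; rewrite (@op_dE M _ _ dx) => E; rewrite -[LHS](sgnK `|i|%N) E scaler0.
Qed.

Variable A : dgcat k.

Let op_comp (X Y Z : A) (g : op_cx (@dhom k A Z Y)) (f : op_cx (@dhom k A Y X)) :
  op_cx (@dhom k A Z X) := @dcomp k A Z Y X f g.

Lemma op_deg_comp (X Y Z : A) i j (g : op_cx (@dhom k A Z Y))
    (f : op_cx (@dhom k A Y X)) :
  cx_deg i g -> cx_deg j f -> cx_deg (i + j) (op_comp g f).
Proof. by move=> dg df; rewrite addrC; apply: (@deg_dcomp k A). Qed.

Lemma op_d_comp (X Y Z : A) i (g : op_cx (@dhom k A Z Y))
    (f : op_cx (@dhom k A Y X)) : cx_deg i g ->
  cx_d (op_comp g f) =
  op_comp (cx_d g) f + (-1) ^+ `|i|%N *: op_comp g (cx_d f).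
Proof.
move=> dg; move: f; apply: (@hom_ind k (@dhom k A Y X)) => [|f f' Ef Ef'|j f df].
- by rewrite /op_comp op_d0 !dcomp0m op_d0 scaler0 addr0.
- rewrite /op_comp op_dD !dcompDl op_dD; move: Ef Ef'; rewrite /op_comp => -> ->.
  by rewrite scalerDr addrACA.
- rewrite (@op_dE (@dhom k A Z X) _ _ (op_deg_comp dg df)).
  rewrite (@op_dE (@dhom k A Z Y) _ _ dg) (@op_dE (@dhom k A Y X) _ _ df) /op_comp.
  rewrite (@d_dcomp k A _ _ _ j) // dcompZl dcompZr scalerDr !scalerA.
  rewrite [LHS]addrC -!exprD; congr (_ *: _ + _ *: _).
    rewrite -[LHS]signr_odd -[RHS]signr_odd; congr (_ ^+ nat_of_bool _); lia.
  rewrite -[LHS]signr_odd -[RHS]signr_odd; congr (_ ^+ nat_of_bool _); lia.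
Qed.

Definition op_dg : dgcat k.
Proof.
refine (@DGCat k A (fun X Y => op_cx (@dhom k A Y X)) (fun X => did X) op_comp
  _ _ _ _ _ _ op_deg_comp op_d_comp _).
- by move=> X Y Z a g g' f; apply: (@dcompLr k A).
- by move=> X Y Z a g f f'; apply: (@dcompLl k A).
- by move=> X Y Z W h g f; rewrite /op_comp (@dcompA k A).
- by move=> X Y f; apply: (@dcompm1 k A).
- by move=> X Y f; apply: (@dcomp1m k A).
- by move=> X; apply: (@deg_did k A).
- by move=> X Y i f; apply: (@dhom_nonpos k A).
Defined.

End Opposite.

Section OppositeExact.
Variables (k : comPzRingType).

Definition sg (i : int) : k := (-1) ^+ `|i|%N.

Lemma sgS i : sg (i + 1) = - sg i.
Proof.
rewrite /sg -[RHS]mulN1r -exprS -signr_odd -[RHS]signr_odd.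
by congr (_ ^+ nat_of_bool _); lia.
Qed.

Lemma sgP i : sg (i - 1) = - sg i.
Proof. by rewrite -{2}[i](subrK 1) sgS opprK. Qed.

Lemma sg2 i : sg i * sg i = 1.
Proof. by rewrite -expr2 sqrr_sign. Qed.

(** The opposite differentials differ from the original ones by a sign depending on the degree,
    while phi is the same map. The factor [sg (i + 1)] on the second component absorbs the
    discrepancy. *)
Lemma op_Fib_boundary (M N : cx k) (phi : M -> N) i (m : M) (q : N) :
  (forall a x, phi (a *: x) = a *: phi x) ->
  boundary i ((m, q) : Fib (phi : op_cx M -> op_cx N)) <->
  boundary i ((m, sg (i + 1) *: q) : Fib phi).
Proof.
move=> phiZ; split=> -[[m1 q1] [/= dm dq] [Em Eq]].
- exists (sg (i - 1) *: m1, - q1).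
    by split; [exact: cx_degZ | exact: cx_degN].
  congr (_, _); first by rewrite cx_dZ Em /= (sgn_hom (dm : cx_deg _ (m1 : M))) cx_dZ.
  rewrite Eq /= (sgn_hom (dq : cx_deg _ (q1 : N))) cx_dZ -!/(sg _) cx_dN phiZ opprK !(sgP, sgS).
  rewrite opprK scalerBr !scaleNr scalerN scalerA sg2 scale1r opprK.
  by rewrite opprK.
- exists (sg (i - 1) *: m1, - q1).
    by split; [exact: cx_degZ | exact: cx_degN].
  congr (_, _).
    rewrite /= (@sgn_hom _ M (i - 1)) -?/(sg _); last exact: cx_degZ.
    by rewrite !cx_dZ scalerA sg2 scale1r.
  rewrite /= (@sgn_hom _ N (i - 1 - 1)) -?/(sg _); last exact: cx_degN.
  rewrite cx_dZ.
  rewrite -[LHS]scale1r -(sg2 (i + 1)) -scalerA Eq /= cx_dN phiZ !(sgP, sgS).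
  by rewrite scalerBr scalerN !scaleNr !opprK scalerN opprK.
Qed.

Lemma op_Fib_cycle (M N : cx k) (phi : M -> N) i (m : M) (q : N) :
  (forall a x, phi (a *: x) = a *: phi x) ->
  cycle i ((m, q) : Fib (phi : op_cx M -> op_cx N)) <->
  cycle i ((m, sg (i + 1) *: q) : Fib phi).
Proof.
move=> phiZ; split=> -[[/= dm dq] [Em Eq]].
- split; first by split=> //; apply: cx_degZ.
  move: Em Eq; rewrite /= (sgn_hom (dm : cx_deg _ (m : M))) (sgn_hom (dq : cx_deg _ (q : N))) !cx_dZ -!/(sg _).
  move=> /(congr1 (fun x => sg i *: x)); rewrite scalerA sg2 scale1r scaler0.
  by rewrite !(sgP, sgS) => -> ->.
- have {}dq : cx_deg (i - 1) q.
    by rewrite -[q]scale1r -(sg2 (i + 1)) -scalerA; apply: cx_degZ.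
  split=> //=; rewrite (sgn_hom (dm : cx_deg _ (m : M))) (sgn_hom dq) !cx_dZ -!/(sg _) Em.
  by move: Eq; rewrite scaler0 cx_dZ !(sgP, sgS) => ->.
Qed.

Variable A : dgcat k.
Notation Aop := (op_dg A).

Lemma op_compE (X Y Z : A) (g : @dhom k Aop Y Z) (f : @dhom k Aop X Y) :
  @dcomp k Aop X Y Z g f = @dcomp k A Z Y X f g.
Proof. by []. Qed.

(** The sign on h is forced, since the opposite differential is -d in degree -1. A relation, rather
    than a function, serves both directions of the duality. *)
Definition op_rel (X Y Z : A) (xi : h3 X Y Z) (xi' : @h3 k Aop Z Y X) :=
  [/\ h3f xi' = h3g xi, h3g xi' = h3f xi & h3h xi' = - h3h xi].

Lemma op_h3_ex (X Y Z : A) (xi : h3 X Y Z) :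
  exists xi' : @h3 k Aop Z Y X, op_rel xi xi'.
Proof.
case: xi => f g h [df cf] [dg_ cg] dh Eh.
have cf' : @closed0 k Aop Y X f by apply/op_cycle.
have cg' : @closed0 k Aop Z Y g by apply/op_cycle.
have dh' : @cx_deg k (@dhom k Aop Z X) (-1) (- h) by exact: cx_degN.
have Eh' : @cx_d k (@dhom k Aop Z X) (- h) = - (@dcomp k Aop Z Y X f g).
  by rewrite /= (sgn_hom (dh' : cx_deg _ (- h : dhom X Z))) cx_dZ /= expr1 scaleN1r cx_dN opprK Eh.
by exists (H3 cg' cf' dh' Eh').
Qed.

Lemma unop_h3_ex (X Y Z : A) (xi' : @h3 k Aop Z Y X) :
  exists xi : h3 X Y Z, op_rel xi xi'.
Proof.
case: xi' => g f h cg cf dh Eh.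
have cg' := proj1 (@op_cycle k (dhom Y Z) 0 g) cg.
have cf' := proj1 (@op_cycle k (dhom X Y) 0 f) cf.
have dh' : @cx_deg k (@dhom k A X Z) (-1) (- h) by exact: cx_degN.
have Eh' : @cx_d k (@dhom k A X Z) (- h) = - (@dcomp k A X Y Z g f).
  by move: Eh; rewrite /= (sgn_hom (dh : cx_deg _ (h : dhom X Z))) cx_dZ /= expr1 scaleN1r cx_dN.
by exists (H3 cf' cg' dh' Eh'); split=> //=; rewrite opprK.
Qed.

Lemma op_Hbij (M M' N : cx k) i j (phi : M -> N) (phi' : op_cx M -> op_cx N) :
  (forall x, phi' x = phi x) -> Hbij i j phi' <-> Hbij i j phi.
Proof.
move=> E; split=> -[inj sur]; split.
- by move=> x /op_cycle cx_ /op_boundary bx; apply/op_boundary/inj; rewrite ?E.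
- move=> y /op_cycle/sur[x /op_cycle cx_]; rewrite E => /op_boundary bx.
  by exists x.
- by move=> x /op_cycle cx_ /op_boundary; rewrite E => bx; apply/op_boundary/inj.
- move=> y /op_cycle/sur[x /op_cycle cx_ /op_boundary bx].
  by exists x => //; rewrite E.
Qed.

Lemma op_Fib_Hbij (L M N : cx k) (phi : M -> N) i (u : L -> M) (v w : L -> N) :
  (forall a x, phi (a *: x) = a *: phi x) -> (forall x, w x = sg (i + 1) *: v x) ->
  Hbij i i (fun x => (u x, v x) : Fib (phi : op_cx M -> op_cx N))
    (M := op_cx L) <->
  Hbij i i (fun x => (u x, w x) : Fib phi).
Proof.
move=> phiZ E; split=> -[inj sur]; split.
- move=> x /op_cycle cx_ bx; apply/op_boundary/inj => //.
  by apply/op_Fib_boundary => //; rewrite -E.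
- move=> [m q] cy.
  have [|x /op_cycle cx_ bx] := sur (m, sg (i + 1) *: q).
    by apply/op_Fib_cycle => //; rewrite scalerA sg2 scale1r.
  exists x => //; move/(op_Fib_boundary _ _ _ phiZ): bx.
  by rewrite scalerBr scalerA sg2 scale1r -E.
- move=> x /op_cycle cx_ bx; apply/op_boundary/inj => //.
  by move/(op_Fib_boundary _ _ _ phiZ): bx; rewrite -E.
- move=> [m q] /(op_Fib_cycle _ _ _ phiZ) /sur [x /op_cycle cx_ bx].
  exists x => //; apply/(op_Fib_boundary _ _ _ phiZ).
  by rewrite scalerBr -E.
Qed.

Lemma op_left_exact (X Y Z : A) (xi : h3 X Y Z) (xi' : @h3 k Aop Z Y X) :
  op_rel xi xi' -> left_exact xi' <-> right_exact xi.
Proof.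
case=> Ef Eg Eh; rewrite /left_exact /right_exact Ef Eg Eh.
have B W i := @op_Fib_Hbij (dhom Z W) (dhom Y W) (dhom X W)
  (fun v => v ∘ h3f xi) i (fun u => u ∘ h3g xi) (fun u => u ∘ - h3h xi)
  (fun u => sg i *: (u ∘ h3h xi)) (fun a x => dcompZl _ _ _).
split=> H W i le_i0; [apply: (proj1 (B W i _)) (H W i le_i0) |
  apply: (proj2 (B W i _)) (H W i le_i0)] => x;
  by rewrite sgS dcompNr scaleNr scalerN opprK.
Qed.

Lemma op_right_exact (X Y Z : A) (xi : h3 X Y Z) (xi' : @h3 k Aop Z Y X) :
  op_rel xi xi' -> right_exact xi' <-> left_exact xi.
Proof.
case=> Ef Eg Eh; rewrite /left_exact /right_exact Ef Eg Eh.
have B W i := @op_Fib_Hbij (dhom W X) (dhom W Y) (dhom W Z)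
  (fun v => h3g xi ∘ v) i (fun u => h3f xi ∘ u)
  (fun u => sg i *: (- h3h xi ∘ u)) (fun u => h3h xi ∘ u)
  (fun a x => dcompZr _ _ _).
split=> H W i le_i0; [apply: (proj1 (B W i _)) (H W i le_i0) |
  apply: (proj2 (B W i _)) (H W i le_i0)] => x;
  by rewrite sgS dcompNl scaleNr !scalerN opprK scalerA sg2 scale1r.
Qed.

Lemma op_short_exact (X Y Z : A) (xi : h3 X Y Z) (xi' : @h3 k Aop Z Y X) :
  op_rel xi xi' -> short_exact xi' <-> short_exact xi.
Proof.
move=> r; rewrite /short_exact (op_left_exact r) (op_right_exact r).
by split=> -[].
Qed.

Lemma op_has_mor (X Y Z X' Y' Z' : A) (xi1 : h3 X Y Z) (xi2 : h3 X' Y' Z')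
    xi1' xi2' x y z : op_rel xi1 xi1' -> op_rel xi2 xi2' ->
  @has_mor k Aop _ _ _ _ _ _ xi2' xi1' z y x <-> has_mor xi1 xi2 x y z.
Proof.
case=> Ef Eg Eh [Ef2 Eg2 Eh2].
have m1 (U V : A) (s : dhom U V) : cx_deg (-1) s ->
    @cx_d k (@dhom k Aop V U) s = - cx_d s.
  by move=> ds; rewrite (@op_dE _ (dhom U V) _ _ ds) expr1 scaleN1r.
have m2 (U V : A) (s : dhom U V) : cx_deg (-2) s ->
    @cx_d k (@dhom k Aop V U) s = cx_d s.
  by move=> ds; rewrite (@op_dE _ (dhom U V) _ _ ds) /= sqrrN expr1n scale1r.
split=> -[s' [s [t [cz cy cx_ ds' ds dt]]]];
  rewrite ?Ef ?Eg ?Eh ?Ef2 ?Eg2 ?Eh2 => Es' Es Et.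
- move: Es' Es Et; rewrite (m1 _ _ _ ds) (m1 _ _ _ ds') (m2 _ _ _ dt) !op_compE.
  move=> Es' Es Et; exists s, s', t; split=> //; try exact/op_cycle.
  + by rewrite -[LHS]opprK Es opprB.
  + by rewrite -[LHS]opprK Es' opprB.
  + by rewrite Et dcompNl dcompNr; zmod.
- exists s, s', t; split=> //; try exact/op_cycle.
  + by rewrite m1 // Es Ef Ef2 !op_compE opprB.
  + by rewrite m1 // Es' Eg Eg2 !op_compE opprB.
  + by rewrite m2 // Et Eh Eh2 Eg Ef2 !op_compE dcompNl dcompNr; zmod.
Qed.

End OppositeExact.

(** * The homotopy category *)

Section Quotients.
Variables (T : Type) (P : T -> Prop) (R : T -> T -> Prop).

Lemma quo_ex (q : quo P R) : exists x (Px : P x), q = qcls R Px.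
Proof.
case: q => S [x Px ES]; exists x, Px; subst S.
by congr (exist _ _ _); apply: Prop_irrelevance.
Qed.

Lemma qrepr_qin (q : quo P R) x : qin q x -> R (qrepr q) x.
Proof.
have E : qin q x = (P x /\ R (qrepr q) x).
  exact: (congr1 (fun S => S x) (s2valP' (cid2 (svalP q)))).
by rewrite E => -[].
Qed.

Hypothesis Rsym : forall x y, P x -> P y -> R x y -> R y x.
Hypothesis Rtrans : forall x y z, P x -> P y -> P z -> R x y -> R y z -> R x z.

Lemma qcls_eq x y (Px : P x) (Py : P y) : R x y -> qcls R Px = qcls R Py.
Proof.
move=> Rxy; apply: eq_exist; apply/funext => z; apply/propext.
split=> -[Pz Rz]; split=> //; [apply: Rtrans Rz | apply: Rtrans Rz] => //.
exact: Rsym.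
Qed.

Hypothesis Rrefl : forall x, P x -> R x x.

Lemma qcls_inj x y (Px : P x) (Py : P y) : qcls R Px = qcls R Py -> R x y.
Proof.
move=> E; have [] : qin (qcls R Px) y by [rewrite E; split=> //; apply: Rrefl]. 
by [].
Qed.

Lemma qin_eq (q : quo P R) x (Px : P x) : qin q x -> q = qcls R Px.
Proof.
by have [y [Py ->]] := quo_ex q; move=> [_ Ryx]; apply: qcls_eq.
Qed.

End Quotients.

Section H0.
Variables (k : comPzRingType) (A : dgcat k).
Implicit Types X Y Z W : A.

Lemma htp_comp X Y Z (g g' : dhom Y Z) (f f' : dhom X Y) :
  closed0 g -> closed0 f' -> homotopic g g' -> homotopic f f' ->
  homotopic (g ∘ f) (g' ∘ f').
Proof.
move=> [dg_ cg] [df' cf'] [e de /esym Ee] [e' de' /esym Ee'].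
rewrite sub0r in de de'; exists (e ∘ f' + g ∘ e'); first by dgd.
by symmetry; dg.
Qed.

Lemma htp_sym X Y (f g : dhom X Y) : homotopic f g -> homotopic g f.
Proof.
by move=> [e de Ee]; exists (- e); [exact: cx_degN | rewrite cx_dN -Ee opprB].
Qed.

Lemma htp_trans X Y (f g h : dhom X Y) :
  homotopic f g -> homotopic g h -> homotopic f h.
Proof.
move=> [e de Ee] [e' de' Ee']; exists (e + e'); first exact: cx_degD.
by rewrite cx_dD -Ee -Ee' addrA subrK.
Qed.

Lemma htpD X Y (f f' g g' : dhom X Y) :
  homotopic f f' -> homotopic g g' -> homotopic (f + g) (f' + g').
Proof.
move=> [e de Ee] [e' de' Ee']; exists (e + e'); first exact: cx_degD.
by rewrite cx_dD -Ee -Ee' opprD addrACA.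
Qed.

Lemma htpZ X Y a (f f' : dhom X Y) :
  homotopic f f' -> homotopic (a *: f) (a *: f').
Proof.
move=> [e de Ee]; exists (a *: e); first exact: cx_degZ.
by rewrite cx_dZ -Ee scalerBr.
Qed.

Lemma H0_ex X Y (f : H0 X Y) : exists f0 (cf : closed0 f0), f = H0cls cf.
Proof. exact: quo_ex. Qed.

Lemma H0cls_eq X Y (f g : dhom X Y) (cf : closed0 f) (cg : closed0 g) :
  homotopic f g -> H0cls cf = H0cls cg.
Proof.
apply: qcls_eq => [x y _ _|x y z _ _ _].
  exact: htp_sym.
exact: htp_trans.
Qed.

Lemma qin_closed0 X Y (f : H0 X Y) f0 : qin f f0 -> closed0 f0.
Proof. by have [x [cx_ ->]] := H0_ex f; case. Qed.

Lemma qin_H0 X Y (f : H0 X Y) f0 (cf : closed0 f0) : qin f f0 -> f = H0cls cf.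
Proof.
apply: qin_eq => [x y _ _|x y z _ _ _].
  exact: htp_sym.
exact: htp_trans.
Qed.

Lemma qin_H0cls X Y (f g : dhom X Y) (cf : closed0 f) :
  closed0 g -> homotopic f g -> qin (H0cls cf) g.
Proof. by []. Qed.

Lemma H0comp_cls X Y Z (g : dhom Y Z) (f : dhom X Y) cg cf :
  H0comp (H0cls cg) (H0cls cf) = H0cls (@closed0_comp _ _ X Y Z g f cg cf).
Proof.
apply: H0cls_eq; apply: htp_comp => //; try exact: qrepr_H0cls.
exact: qreprP.
Qed.

Lemma H0add_cls X Y (f g : dhom X Y) cf cg :
  H0add (H0cls cf) (H0cls cg) = H0cls (@closed0D _ _ X Y f g cf cg).
Proof. by apply: H0cls_eq; apply: htpD; apply: qrepr_H0cls. Qed.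

Lemma H0scale_cls X Y a (f : dhom X Y) cf :
  H0scale a (H0cls cf) = H0cls (@closed0Z _ _ X Y a f cf).
Proof. by apply: H0cls_eq; apply: htpZ; apply: qrepr_H0cls. Qed.

Lemma H0_addA X Y : associative (@H0add k A X Y).
Proof.
move=> f g h; have [f0 [cf ->]] := H0_ex f; have [g0 [cg ->]] := H0_ex g.
have [h0 [ch ->]] := H0_ex h; rewrite !H0add_cls.
by apply: H0cls_eq; rewrite addrA; apply: homotopic_refl.
Qed.

Lemma H0_addC X Y : commutative (@H0add k A X Y).
Proof.
move=> f g; have [f0 [cf ->]] := H0_ex f; have [g0 [cg ->]] := H0_ex g.
by rewrite !H0add_cls; apply: H0cls_eq; rewrite addrC; apply: homotopic_refl.
Qed.

Lemma H0_add0 X Y : left_id (H0zero X Y) (@H0add k A X Y).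
Proof.
move=> f; have [f0 [cf ->]] := H0_ex f.
by rewrite /H0zero H0add_cls; apply: H0cls_eq; rewrite add0r; apply: homotopic_refl.
Qed.

Lemma H0_addN X Y : left_inverse (H0zero X Y) (H0scale (-1)) (@H0add k A X Y).
Proof.
move=> f; have [f0 [cf ->]] := H0_ex f.
rewrite H0scale_cls H0add_cls; apply: H0cls_eq; rewrite scaleN1r addNr.
exact: homotopic_refl.
Qed.

HB.instance Definition _ X Y := gen_eqMixin (H0 X Y).
HB.instance Definition _ X Y := gen_choiceMixin (H0 X Y).
HB.instance Definition _ X Y := GRing.isZmodule.Build (H0 X Y)
  (@H0_addA X Y) (@H0_addC X Y) (@H0_add0 X Y) (@H0_addN X Y).

Lemma H0_addE X Y (f g : H0 X Y) : f + g = H0add f g.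
Proof. by []. Qed.

Lemma H0_scaleA X Y a b (f : H0 X Y) :
  H0scale a (H0scale b f) = H0scale (a * b) f.
Proof.
have [f0 [cf ->]] := H0_ex f; rewrite !H0scale_cls; apply: H0cls_eq.
by rewrite scalerA; apply: homotopic_refl.
Qed.

Lemma H0_scale1 X Y : left_id 1 (@H0scale k A X Y).
Proof.
move=> f; have [f0 [cf ->]] := H0_ex f; rewrite !H0scale_cls; apply: H0cls_eq.
by rewrite scale1r; apply: homotopic_refl.
Qed.

Lemma H0_scaleDr X Y : right_distributive (@H0scale k A X Y) +%R.
Proof.
move=> a f g; have [f0 [cf ->]] := H0_ex f; have [g0 [cg ->]] := H0_ex g.
rewrite !H0_addE H0add_cls !H0scale_cls H0add_cls.
by apply: H0cls_eq; rewrite scalerDr; apply: homotopic_refl.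
Qed.

Lemma H0_scaleDl X Y (f : H0 X Y) : {morph (@H0scale k A X Y)^~ f : a b / a + b}.
Proof.
move=> a b; have [f0 [cf ->]] := H0_ex f.
rewrite !H0_addE !H0scale_cls H0add_cls.
by apply: H0cls_eq; rewrite scalerDl; apply: homotopic_refl.
Qed.

HB.instance Definition _ X Y := GRing.Zmodule_isLmodule.Build k (H0 X Y)
  (@H0_scaleA X Y) (@H0_scale1 X Y) (@H0_scaleDr X Y) (@H0_scaleDl X Y).

Lemma H0_scaleE X Y a (f : H0 X Y) : a *: f = H0scale a f.
Proof. by []. Qed.

Lemma H0compA X Y Z W (h : H0 Z W) (g : H0 Y Z) (f : H0 X Y) :
  H0comp h (H0comp g f) = H0comp (H0comp h g) f.
Proof.
have [f0 [cf ->]] := H0_ex f; have [g0 [cg ->]] := H0_ex g.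
have [h0 [ch ->]] := H0_ex h; rewrite !H0comp_cls.
by apply: H0cls_eq; rewrite dcompA; apply: homotopic_refl.
Qed.

Lemma H0comp1m X Y (f : H0 X Y) : H0comp (H0id Y) f = f.
Proof.
have [f0 [cf ->]] := H0_ex f; rewrite /H0id !H0comp_cls.
by apply: H0cls_eq; rewrite dcomp1m; apply: homotopic_refl.
Qed.

Lemma H0compm1 X Y (f : H0 X Y) : H0comp f (H0id X) = f.
Proof.
have [f0 [cf ->]] := H0_ex f; rewrite /H0id !H0comp_cls.
by apply: H0cls_eq; rewrite dcompm1; apply: homotopic_refl.
Qed.

Lemma H0compDl X Y Z (g g' : H0 Y Z) (f : H0 X Y) :
  H0comp (g + g') f = H0comp g f + H0comp g' f.
Proof.
have [f0 [cf ->]] := H0_ex f; have [g0 [cg ->]] := H0_ex g.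
have [h0 [ch ->]] := H0_ex g'.
rewrite !H0_addE !(H0comp_cls, H0add_cls).
by apply: H0cls_eq; rewrite dcompDl; apply: homotopic_refl.
Qed.

Lemma H0compDr X Y Z (g : H0 Y Z) (f f' : H0 X Y) :
  H0comp g (f + f') = H0comp g f + H0comp g f'.
Proof.
have [f0 [cf ->]] := H0_ex f; have [g0 [cg ->]] := H0_ex g.
have [h0 [ch ->]] := H0_ex f'.
rewrite !H0_addE !(H0comp_cls, H0add_cls).
by apply: H0cls_eq; rewrite dcompDr; apply: homotopic_refl.
Qed.

Lemma H0compZl X Y Z a (g : H0 Y Z) (f : H0 X Y) :
  H0comp (a *: g) f = a *: H0comp g f.
Proof.
have [f0 [cf ->]] := H0_ex f; have [g0 [cg ->]] := H0_ex g.
rewrite !H0_scaleE !(H0comp_cls, H0scale_cls).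
by apply: H0cls_eq; rewrite dcompZl; apply: homotopic_refl.
Qed.

Lemma H0compZr X Y Z a (g : H0 Y Z) (f : H0 X Y) :
  H0comp g (a *: f) = a *: H0comp g f.
Proof.
have [f0 [cf ->]] := H0_ex f; have [g0 [cg ->]] := H0_ex g.
rewrite !H0_scaleE !(H0comp_cls, H0scale_cls).
by apply: H0cls_eq; rewrite dcompZr; apply: homotopic_refl.
Qed.

Lemma H0comp0m X Y Z (f : H0 X Y) : H0comp (0 : H0 Y Z) f = 0.
Proof. by rewrite -[0 in LHS](scale0r (0 : H0 Y Z)) H0compZl scale0r. Qed.

Lemma H0compm0 X Y Z (g : H0 Y Z) : H0comp g (0 : H0 X Y) = 0.
Proof. by rewrite -[0 in LHS](scale0r (0 : H0 X Y)) H0compZr scale0r. Qed.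

(** Biproduct data on closed representatives: unlike homotopy classes, these can be read directly in
    the opposite DG-category. *)
Record biprod X1 X2 X (i1 : dhom X1 X) (i2 : dhom X2 X) (p1 : dhom X X1)
    (p2 : dhom X X2) : Prop := {
  bpi1 : closed0 i1;
  bpi2 : closed0 i2;
  bpp1 : closed0 p1;
  bpp2 : closed0 p2;
  bp11 : homotopic (p1 ∘ i1) (did X1);
  bp22 : homotopic (p2 ∘ i2) (did X2);
  bp12 : homotopic (p1 ∘ i2) 0;
  bp21 : homotopic (p2 ∘ i1) 0;
  bp_sum : homotopic (i1 ∘ p1 + i2 ∘ p2) (did X) }.

Lemma biprod_H0 X1 X2 X (i1 : H0 X1 X) (i2 : H0 X2 X) (p1 : H0 X X1)
    (p2 : H0 X X2) i10 i20 p10 p20 :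
  qin i1 i10 -> qin i2 i20 -> qin p1 p10 -> qin p2 p20 ->
  H0_biproduct i1 i2 p1 p2 <-> biprod i10 i20 p10 p20.
Proof.
move=> q1 q2 q3 q4.
have [c1 c2 c3 c4] := And4 (qin_closed0 q1) (qin_closed0 q2) (qin_closed0 q3) (qin_closed0 q4).
rewrite (qin_H0 c1 q1) (qin_H0 c2 q2) (qin_H0 c3 q3) (qin_H0 c4 q4).
split=> -[].
- rewrite !H0comp_cls H0add_cls.
  by move=> /H0cls_inj ? /H0cls_inj ? /H0cls_inj ? /H0cls_inj ? /H0cls_inj ?.
- move=> _ _ _ _ E1 E2 E3 E4 E5.
  by split; rewrite ?H0comp_cls ?H0add_cls; apply: H0cls_eq.
Qed.

Lemma H0_additiveP : H0_additive A <->
  (exists Z : A, homotopic (did Z) 0) /\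
  (forall X1 X2 : A, exists (X : A) (i1 : dhom X1 X) (i2 : dhom X2 X)
     (p1 : dhom X X1) (p2 : dhom X X2), biprod i1 i2 p1 p2).
Proof.
have qc X Y (f : dhom X Y) (cf : closed0 f) : qin (H0cls cf) f.
  by apply: qin_H0cls => //; apply: homotopic_refl.
split=> -[[Z EZ] bp]; split.
- by exists Z; apply: H0cls_inj EZ.
- move=> X1 X2; have [X [i1 [i2 [p1 [p2]]]]] := bp X1 X2.
  have [i10 [c1 ->]] := H0_ex i1; have [i20 [c2 ->]] := H0_ex i2.
  have [p10 [c3 ->]] := H0_ex p1; have [p20 [c4 ->]] := H0_ex p2.
  by move=> /(biprod_H0 (qc _ _ _ c1) (qc _ _ _ c2) (qc _ _ _ c3) (qc _ _ _ c4));
    exists X, i10, i20, p10, p20.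
- by exists Z; apply: H0cls_eq.
- move=> X1 X2; have [X [i10 [i20 [p10 [p20 b]]]]] := bp X1 X2.
  have [c1 c2 c3 c4] := And4 (bpi1 b) (bpi2 b) (bpp1 b) (bpp2 b).
  exists X, (H0cls c1), (H0cls c2), (H0cls c3), (H0cls c4).
  by apply/(biprod_H0 (qc _ _ _ c1) (qc _ _ _ c2) (qc _ _ _ c3) (qc _ _ _ c4)).
Qed.

End H0.

(** * Self-duality of abelian truncated DG-categories *)

Section OppositeAbelian.
Variables (k : comPzRingType) (n : nat) (D : abelian_dgcat k n).
Notation Dop := (op_dg D).

Lemma op_homotopic (X Y : D) (f g : dhom X Y) :
  @homotopic k Dop Y X f g <-> homotopic f g.
Proof. exact: (@op_boundary k (dhom X Y)). Qed.

Lemma op_closed0 (X Y : D) (f : dhom X Y) : @closed0 k Dop Y X f <-> closed0 f.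
Proof. exact: (@op_cycle k (dhom X Y)). Qed.

Lemma op_biprod (X1 X2 X : D) (i1 : dhom X1 X) i2 p1 (p2 : dhom X X2) :
  @biprod k Dop X1 X2 X p1 p2 i1 i2 <-> biprod i1 i2 p1 p2.
Proof. by split; case=> *; split; first [exact/op_closed0 | exact/op_homotopic]. Qed.

Lemma op_Hinj (M N : cx k) i j (phi : M -> N) :
  Hinj i j (phi : op_cx M -> op_cx N) <-> Hinj i j phi.
Proof.
by split=> inj x /op_cycle cx_ /op_boundary bx; apply/op_boundary/inj.
Qed.

Lemma op_nmono (X Y : D) (f : dhom X Y) : @nmono k Dop n Y X f <-> nepi n f.
Proof.
split=> H W; have [inj bij] := H W; split=> [|i le_i].
- exact (proj1 (@op_Hinj (@dhom k D Y W) (@dhom k D X W) _ _ (fun u => @dcomp k D _ _ _ u f)) inj).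
- exact (proj1 (@op_Hbij k (@dhom k D Y W) (@dhom k D Y W) (@dhom k D X W) i i (fun u => @dcomp k D _ _ _ u f)
    (fun u => @dcomp k D _ _ _ u f) (fun=> erefl)) (bij i le_i)).
- exact (proj2 (@op_Hinj (@dhom k D Y W) (@dhom k D X W) _ _ (fun u => @dcomp k D _ _ _ u f)) inj).
- exact (proj2 (@op_Hbij k (@dhom k D Y W) (@dhom k D Y W) (@dhom k D X W) i i (fun u => @dcomp k D _ _ _ u f)
    (fun u => @dcomp k D _ _ _ u f) (fun=> erefl)) (bij i le_i)).
Qed.

Lemma op_nepi (X Y : D) (f : dhom X Y) : @nepi k Dop n Y X f <-> nmono n f.
Proof.
split=> H W; have [inj bij] := H W; split=> [|i le_i].
- exact (proj1 (@op_Hinj (@dhom k D W X) (@dhom k D W Y) _ _ (fun u => @dcomp k D _ _ _ f u)) inj).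
- exact (proj1 (@op_Hbij k (@dhom k D W X) (@dhom k D W X) (@dhom k D W Y) i i (fun u => @dcomp k D _ _ _ f u)
    (fun u => @dcomp k D _ _ _ f u) (fun=> erefl)) (bij i le_i)).
- exact (proj2 (@op_Hinj (@dhom k D W X) (@dhom k D W Y) _ _ (fun u => @dcomp k D _ _ _ f u)) inj).
- exact (proj2 (@op_Hbij k (@dhom k D W X) (@dhom k D W X) (@dhom k D W Y) i i (fun u => @dcomp k D _ _ _ f u)
    (fun u => @dcomp k D _ _ _ f u) (fun=> erefl)) (bij i le_i)).
Qed.

(** Kernels trade places with cokernels and axiom (ii) with axiom (iii). The definition is
    transparent, so that the DG-category underlying it converts to [op_dg D] when a lemma is applied
    to it. *)
Definition op_abelian : abelian_dgcat k n.
Proof.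
refine (@AbelianDGCat k n Dop _ _ _ _ _ _).
- by move=> X Y i f le_i /op_cycle cf; apply/op_boundary/(@ab_truncated _ _ D).
- have /H0_additiveP [[Z EZ] bp] := ab_additive D.
  apply/H0_additiveP; split; first by exists Z; apply/op_homotopic.
  move=> X1 X2; have [X [i1 [i2 [p1 [p2 b]]]]] := bp X1 X2.
  by exists X, p1, p2, i1, i2; apply/op_biprod.
- move=> Y Z g /op_closed0 cg; have [X [xi [E r]]] := ab_coker cg.
  have [xi' rel] := op_h3_ex xi; exists X, xi'.
  by case: (rel) => _ -> _; split=> //; apply/(op_left_exact rel).
- move=> X Y f /op_closed0 cf; have [Z [xi [E r]]] := ab_ker cf.
  have [xi' rel] := op_h3_ex xi; exists Z, xi'.
  by case: (rel) => -> _ _; split=> //; apply/(op_right_exact rel).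
- move=> X Y Z xi' r m; have [xi rel] := unop_h3_ex xi'.
  apply/(op_short_exact rel)/ab_epi; first exact/(op_right_exact rel).
  by move: m; case: rel => -> _ _ /op_nmono.
- move=> X Y Z xi' r m; have [xi rel] := unop_h3_ex xi'.
  apply/(op_short_exact rel)/ab_mono; first exact/(op_left_exact rel).
  by move: m; case: rel => _ -> _ /op_nepi.
Defined.

End OppositeAbelian.

(** * Short exact sequences *)

Section Abelian.
Variables (k : comPzRingType) (n : nat).
Implicit Types D : abelian_dgcat k n.

Lemma right_fill D (X Y Z X' Y' Z' : D) (xi : h3 X Y Z) (xi' : h3 X' Y' Z') x y :
  right_exact xi -> closed0 x -> closed0 y ->
  homotopic (h3f xi' ∘ x) (y ∘ h3f xi) -> exists z, has_mor xi xi' x y z.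
Proof.
move=> r cx_ cy h; have [o1 r1] := op_h3_ex xi; have [o2 r2] := op_h3_ex xi'.
have [||||z m] := @left_fill k (op_dg D) _ _ _ _ _ _ o2 o1 y x.
- exact/left_exactP/(op_left_exact r1).
- exact/op_closed0.
- exact/op_closed0.
- case: r1 r2 => _ -> _ [_ -> _]; apply/op_homotopic; exact: htp_sym.
by exists z; apply/(op_has_mor _ _ _ r1 r2).
Qed.

Lemma mor_null_r D (X Y Z X' Y' Z' : D) (xi : h3 X Y Z) (xi' : h3 X' Y' Z') x y z
    (r : dhom Y X') :
  right_exact xi -> has_mor xi xi' x y z -> closed0 r ->
  homotopic x (r ∘ h3f xi) ->
  exists2 l : dhom Z Y', closed0 l & homotopic z (h3g xi' ∘ l).
Proof.
move=> ex m cr h; have [o1 r1] := op_h3_ex xi; have [o2 r2] := op_h3_ex xi'.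
have [||||l cl hl] := @mor_null k (op_dg D) _ _ _ _ _ _ o2 o1 z y x r.
- exact/left_exactP/(op_left_exact r1).
- exact/(op_has_mor _ _ _ r1 r2).
- exact/op_closed0.
- by case: (r1) => _ -> _; apply/op_homotopic.
exists l; first exact/op_closed0.
by move: hl; case: r2 => -> _ _ /op_homotopic.
Qed.

(** Acyclicity in degree i + 1, applied to a cycle of the form (0, b, c). *)
Lemma left_exact_cycle D (X Y Z : D) (xi : h3 X Y Z) (W : D) i (b : dhom W Y) :
  left_exact xi -> i <= 0 -> cycle i b -> boundary i (h3g xi ∘ b) ->
  exists2 a, cycle i a & boundary i (b - h3f xi ∘ a).
Proof.
move=> /left_exactP ac le_i [db Eb] [c dc /esym Ec].
have [||a [b' [c' [[da db' dc'] [Ea Eb' Ec']]]]] := ac W (i + 1) 0 b c.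
- by lia.
- by split; split; dga.
exists a; first by split=> //; dgd.
by exists (- b'); [dgd | rewrite cx_dN Eb' opprB].
Qed.

Lemma right_exact_cycle D (X Y Z : D) (xi : h3 X Y Z) (W : D) i (b : dhom Y W) :
  right_exact xi -> i <= 0 -> cycle i b -> boundary i (b ∘ h3f xi) ->
  exists2 c, cycle i c & boundary i (b - c ∘ h3g xi).
Proof.
move=> r le_i cb bb; have [o ro] := op_h3_ex xi.
have [|||c cc bc] := @left_exact_cycle (op_abelian D) _ _ _ o W i b _ le_i.
- exact/(op_left_exact ro).
- exact/(@op_cycle _ (@dhom k D Y W)).
- by case: (ro) => _ -> _; apply/(@op_boundary _ (@dhom k D X W)).
exists c; first exact/(@op_cycle _ (@dhom k D Z W)).
by move: bc; case: ro => -> _ _ /(@op_boundary _ (@dhom k D Y W)).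
Qed.

(** By truncation both cohomology modules vanish in degrees at most -n, so bijectivity holds there
    and degree 1 - n is what remains. *)
Lemma nepiP D (X Y : D) (f : dhom X Y) :
  (forall (W : D) (u : dhom Y W), cycle (1 - n%:Z) u ->
    boundary (1 - n%:Z) (u ∘ f) -> boundary (1 - n%:Z) u) ->
  nepi n f.
Proof.
move=> inj W; split; first exact: inj.
move=> i le_i; split=> [u cu _|u cu]; first exact: (ab_truncated le_i).
exists 0.
  by split; [exact: cx_deg0 | exact: cx_d0].
by rewrite dcomp0m subr0; apply: (ab_truncated le_i).
Qed.

(** In degree i = 1 - n, a null f ∘ u can be completed to a cycle of T. This is also the source of
    the initial zero of the long exact sequence. *)
Lemma left_exact_nmono D (X Y Z : D) (xi : h3 X Y Z) (W : D) (u : dhom W X) :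
  left_exact xi -> cycle (1 - n%:Z) u -> boundary (1 - n%:Z) (h3f xi ∘ u) ->
  boundary (1 - n%:Z) u.
Proof.
move=> /left_exactP; case: xi => f g h [df cf] [dg_ cg] dh Eh ac [du Eu].
case=> b db /= /esym Eb.
(* The obstruction to completing (u, b) is a cycle of degree exactly -n, hence a boundary by
   truncation. *)
have [|c dc /esym Ec] := @ab_truncated _ _ D _ _ (- n%:Z) (g ∘ b + h ∘ u) (lexx _).
  by split; [dgd | dg].
have [||a' [b' [c' [[da' db' dc'] [Ea' Eb' Ec']]]]] := ac W (1 - n%:Z) u b c.
- by lia.
- by split; split=> //; dga.
- by exists a'.
Qed.

Lemma right_exact_nepi D (X Y Z : D) (xi : h3 X Y Z) (W : D) (u : dhom Z W) :
  right_exact xi -> cycle (1 - n%:Z) u -> boundary (1 - n%:Z) (u ∘ h3g xi) ->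
  boundary (1 - n%:Z) u.
Proof.
move=> r cu bu; have [o ro] := op_h3_ex xi.
apply/(@op_boundary _ (@dhom k D Z W)).
apply: (@left_exact_nmono (op_abelian D) _ _ _ o).
- exact/(op_left_exact ro).
- exact/(@op_cycle _ (@dhom k D Z W)).
- by case: (ro) => -> _ _; apply/(@op_boundary _ (@dhom k D Y W)).
Qed.

Lemma cycle_comp D (X Y Z : D) i (u : dhom Y Z) (f : dhom X Y) :
  cycle i u -> closed0 f -> cycle i (u ∘ f).
Proof.
move=> [du Eu] [df Ef]; split; first by dgd.
by rewrite (d_dcomp _ du) Eu Ef dcomp0m dcompm0 scaler0 addr0.
Qed.

Lemma boundary_compl D (X Y Z : D) i (u : dhom Y Z) (f : dhom X Y) :
  boundary i u -> closed0 f -> boundary i (u ∘ f).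
Proof.
move=> [e de ->] [df Ef]; exists (e ∘ f); first by dgd.
by rewrite (dcomp_dl de Ef).
Qed.

Lemma boundary_compr D (X Y Z : D) i (u : dhom Y Z) (f : dhom X Y) :
  cycle i u -> boundary 0 f -> boundary i (u ∘ f).
Proof.
move=> cu [e de ->]; exists ((-1) ^+ `|i|%N *: (u ∘ e)).
  by apply: cx_degZ; case: cu => du _; dgd.
by rewrite (dcomp_dr _ cu) cx_dZ.
Qed.

Lemma boundaryD (M : cx k) i (x y : M) :
  boundary i x -> boundary i y -> boundary i (x + y).
Proof.
by move=> [e de ->] [e' de' ->]; exists (e + e'); [exact: cx_degD|rewrite cx_dD].
Qed.

Lemma boundaryN (M : cx k) i (x : M) : boundary i x -> boundary i (- x).
Proof. by move=> [e de ->]; exists (- e); [exact: cx_degN|rewrite cx_dN]. Qed.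

Lemma boundary_eq (M : cx k) i (x y : M) :
  boundary i (x - y) -> boundary i y -> boundary i x.
Proof. by move=> bxy bY; have -> : x = x - y + y by [zmod]; exact: boundaryD. Qed.

Lemma homotopic_compr D (X Y Z : D) i (u : dhom Y Z) (f g : dhom X Y) :
  cycle i u -> homotopic f g -> boundary i (u ∘ f - u ∘ g).
Proof. by move=> cu h; rewrite -dcompNr -dcompDr; apply: boundary_compr. Qed.

(** Cancellation: if u ∘ g is null, so is u ∘ g ∘ p, which is homotopic to u ∘ f. *)
Lemma nepi_comp D (X Y Z : D) (g : dhom Y Z) (p : dhom X Y) (f : dhom X Z) :
  closed0 g -> closed0 p -> homotopic (g ∘ p) f ->
  (forall (W : D) (u : dhom Z W), cycle (1 - n%:Z) u ->
    boundary (1 - n%:Z) (u ∘ f) -> boundary (1 - n%:Z) u) ->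
  nepi n g.
Proof.
move=> cg cp h inj; apply: nepiP => W u cu bu; apply: inj => //.
apply: (boundary_eq (homotopic_compr cu (htp_sym h))).
by rewrite dcompA; apply: boundary_compl.
Qed.

Lemma ses_of_nepi D (X Y : D) (g : dhom X Y) :
  closed0 g -> nepi n g -> exists (K : D) (eta : h3 K X Y),
    h3g eta = g /\ short_exact eta.
Proof.
move=> cg eg; have [K [eta [Eg le]]] := ab_ker cg.
by exists K, eta; split=> //; apply: ab_epi => //; rewrite Eg.
Qed.

(* E' is the kernel of u; m and c record how A -> E' -> E compares with A -> B -> E. *)
Lemma octahedron D (A B C E W : D) (xi : h3 A B C) (eps : h3 B E W)
    (u : dhom E C) (lam : dhom B C) :
  short_exact xi -> short_exact eps -> closed0 u -> cx_deg (-1) lam ->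
  cx_d lam = u ∘ h3f eps - h3g xi ->
  exists (E' : D) (eta : h3 E' E C) (eps' : h3 A E' W) (m : dhom A E)
    (c : dhom A C),
    [/\ short_exact eps', h3g eta = u, h3g eps' = h3g eps ∘ h3f eta &
        h3h eps' = h3h eps ∘ h3f xi - h3g eps ∘ m] /\
    [/\ cx_deg (-1) m, cx_deg (-2) c,
      cx_d m = h3f eta ∘ h3f eps' - h3f eps ∘ h3f xi &
      cx_d c = - h3h xi + lam ∘ h3f xi + h3g eta ∘ m + h3h eta ∘ h3f eps'].
Proof.
move=> sx se cu dl El.
have eu : nepi n u.
  apply: (nepi_comp (f := h3g xi) cu (h3f_closed eps)).
    by exists lam => //; rewrite El.
  by move=> V v; apply: right_exact_nepi sx.2.
have [E' [eta [Eeta seta]]] := ses_of_nepi cu eu.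
move: cu eu El; rewrite -Eeta => cu eu El; exists E', eta.
(* E' -> E -> W is an n-epimorphism: if v dies on E', then v ∘ h3g eps factors as z ∘ u by exactness
   of eta; restricted to B this is z ∘ h3g xi and it vanishes, so z vanishes, then v ∘ h3g eps, then
   v. *)
have inj : forall (V : D) (v : dhom W V), cycle (1 - n%:Z) v ->
    boundary (1 - n%:Z) (v ∘ (h3g eps ∘ h3f eta)) -> boundary (1 - n%:Z) v.
  have [ci cps cph] := And3 (h3f_closed eta) (h3g_closed eps) (h3f_closed eps).
  move=> V v cv bv; have cvp := cycle_comp cv cps.
  (* For n = 0 the degree 1 - n is positive and v is 0; exactness of eta is available in degrees at
     most 0. *)
  have [lt1|le1] := ltP 0 (1 - n%:Z).
    by exists 0; [exact: cx_deg0 | rewrite cx_d0 (dhom_nonpos lt1 cv.1)].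
  apply: (right_exact_nepi se.2) => //.
  have [|z cz bz] := right_exact_cycle seta.2 le1 cvp.
    by rewrite -dcompA.
  apply: (boundary_eq bz); apply: boundary_compl => //.
  apply: (right_exact_nepi sx.2) => //.
  apply: (boundary_eq (y := z ∘ (h3g eta ∘ h3f eps))).
    apply: homotopic_compr => //; apply: htp_sym.
    by exists lam => //; rewrite El Eeta.
  rewrite dcompA; apply: (boundary_eq (y := v ∘ h3g eps ∘ h3f eps)).
    have -> : z ∘ h3g eta ∘ h3f eps - v ∘ h3g eps ∘ h3f eps =
        - ((v ∘ h3g eps - z ∘ h3g eta) ∘ h3f eps) by dnorm; zmod.
    by apply: boundaryN; apply: boundary_compl.
  rewrite -dcompA; apply: boundary_compr => //.
  by exists (- h3h eps); [apply/cx_degN/h3h_deg | rewrite cx_dN h3h_d opprK].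
move: sx se seta inj cu El => /=.
case: xi eps eta Eeta eu => f g h [df cf] [dg_ cg] dh Eh.
case=> ph ps th [dph cph] [dps cps] dth Eth.
case=> i k' ka [di ci] [dk ck] dka Eka.
move=> /= Eu eu [lx _] [le _] [leta _] inj _ El.
have {lx} ax := (left_exactP _).1 lx; have {le} ae := (left_exactP _).1 le.
have {leta} aeta := (left_exactP _).1 leta.
(* ph ∘ f lifts to the kernel of u: [lam] moves u ∘ ph ∘ f to g ∘ f, and - h contracts the
   latter. *)
have [|||f' [m [c [[df' dm dc] /= [Em Ec]]]]] :=
  acyclic1 (b := ph ∘ f) (c := - h + lam ∘ f) aeta; try by rewrite /=; dga.
have cf' := closed0_deg df'.
have cpi : closed0 (ps ∘ i) by apply: closed0_deg; dgd.
have dh' : cx_deg (-1) (th ∘ f - ps ∘ m) by dgd.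
have Eh' : cx_d (th ∘ f - ps ∘ m) = - ((ps ∘ i) ∘ f') by dg.
pose eps' := H3 cf' cpi dh' Eh'.
exists eps', m, c; split; last by split.
split=> //; apply: ab_epi; last by apply: nepiP inj.
apply/left_exactP => V j a b e lej [[da db de] /= [Ea Eb Ee]].
(* Acyclicity of eps gives a primitive [be] of f ∘ a in B, that of xi then a primitive [al] of a,
   and that of eta a primitive [b2] of b - f' ∘ al in E'. *)
have [|be [et [ze [[dbe det dze] /= [Ebe Eet Eze]]]]] :=
  ae V j (f ∘ a) (i ∘ b - m ∘ a) e lej.
  by split; split=> /=; dga.
have [|al [be' [ga [[dal dbe' dga_] /= [Eal Ebe' Ega]]]]] :=
  ax V j a be (- (ka ∘ b) + k' ∘ et - lam ∘ be - c ∘ a) lej.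
  by split; split=> /=; dga.
have [||b2 [et' [ga' [[db2 det' dga'] /= [Eb2 Eet' Ega']]]]] :=
  aeta V (j - 1) (b - f' ∘ al) (- (m ∘ al + ph ∘ be' + et))
   (- (ga + lam ∘ be' + c ∘ al)).
- by lia.
- by split; split=> /=; dga.
exists al, (- b2), (ze - ps ∘ et' - th ∘ be').
by split; split=> /=; dga.
Qed.
End Abelian.

(** * Retracts and direct sums of exact sequences *)

Section Retract.
Variables (k : comPzRingType) (A : dgcat k).
Implicit Types X Y Z W : A.

Lemma h3_mor_lbnd X Y Z X' Y' Z' (xi : h3 X Y Z) (xi' : h3 X' Y' Z')
    x y z s s' t W i (a : dhom W X) b c :
  h3_mor xi xi' x y z s s' t -> lbnd xi i a b c ->
  lbnd xi' i (x ∘ a) (y ∘ b + s ∘ a) (z ∘ c + s' ∘ b - t ∘ a).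
Proof.
case: xi xi' => f g h [df cf] [dg_ cg] dh Eh [f' g' h' [df' cf'] [dg' cg'] dh' Eh'].
case=> [[dx _] [dy _] [dz _] ds ds' dt /= Es Es' Et].
move=> [a' [b' [c' [[da db dc] /= [Ea Eb Ec]]]]].
exists (x ∘ a'), (y ∘ b' + s ∘ a'), (z ∘ c' + s' ∘ b' - t ∘ a').
by split; split=> /=; dga.
Qed.

Lemma lbndD X Y Z (xi : h3 X Y Z) W i (a1 : dhom W X) b1 c1 a2 b2 c2 :
  lbnd xi i a1 b1 c1 -> lbnd xi i a2 b2 c2 ->
  lbnd xi i (a1 + a2) (b1 + b2) (c1 + c2).
Proof.
move=> [a' [b' [c' [[da db dc] /= [Ea Eb Ec]]]]].
move=> [a'' [b'' [c'' [[da' db' dc'] /= [Ea' Eb' Ec']]]]].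
by exists (a' + a''), (b' + b''), (c' + c''); split; split; dga.
Qed.

(** The sum of the two round trips through acyclic complexes sends cycles to boundaries. Its three
    components are homotopic to identities only one by one, which is the situation handled by
    [acyclic_endo]. *)
Lemma acyclic_retract X Y Z X1 Y1 Z1 X2 Y2 Z2 (xi : h3 X Y Z)
    (xi1 : h3 X1 Y1 Z1) (xi2 : h3 X2 Y2 Z2)
    p1 r1 q1 i1 m1 j1 p2 r2 q2 i2 m2 j2 :
  has_mor xi xi1 p1 r1 q1 -> has_mor xi1 xi i1 m1 j1 ->
  has_mor xi xi2 p2 r2 q2 -> has_mor xi2 xi i2 m2 j2 ->
  homotopic (i1 ∘ p1 + i2 ∘ p2) (did X) ->
  homotopic (m1 ∘ r1 + m2 ∘ r2) (did Y) ->
  homotopic (j1 ∘ q1 + j2 ∘ q2) (did Z) ->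
  acyclic xi1 -> acyclic xi2 -> acyclic xi.
Proof.
move=> [s1 [s1' [t1 M1]]] [u1 [u1' [v1 N1]]] [s2 [s2' [t2 M2]]] [u2 [u2' [v2 N2]]].
move=> hx hy hz ac1 ac2.
apply: (acyclic_endo (x := i1 ∘ p1 + i2 ∘ p2) (y := m1 ∘ r1 + m2 ∘ r2)
  (z := j1 ∘ q1 + j2 ∘ q2)
  (s := m1 ∘ s1 + u1 ∘ p1 + (m2 ∘ s2 + u2 ∘ p2))
  (s' := j1 ∘ s1' + u1' ∘ r1 + (j2 ∘ s2' + u2' ∘ r2))
  (t := j1 ∘ t1 + v1 ∘ p1 - u1' ∘ s1 + (j2 ∘ t2 + v2 ∘ p2 - u2' ∘ s2))) => //.
- case: xi M1 N1 M2 N2 hx hy hz => f g h [df cf] [dg_ cg] dh Eh.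
  case: xi1 xi2 ac1 ac2 => f1 g1 h1 [df1 cf1] [dg1 cg1] dh1 Eh1.
  case=> f2 g2 h2 [df2 cf2] [dg2 cg2] dh2 Eh2 _ _.
  case=> [[? _] [? _] [? _] ? ? ? /= ? ? ?].
  case=> [[? _] [? _] [? _] ? ? ? /= ? ? ?].
  case=> [[? _] [? _] [? _] ? ? ? /= ? ? ?].
  case=> [[? _] [? _] [? _] ? ? ? /= ? ? ?] _ _ _.
  by split=> /=; first [apply: closed0_deg; dgd | dga].
- move=> W i a b c le_i C.
  have B1 := h3_mor_lbnd N1 (ac1 _ _ _ _ _ le_i (h3_mor_lcyc M1 C)).
  have B2 := h3_mor_lbnd N2 (ac2 _ _ _ _ _ le_i (h3_mor_lcyc M2 C)).
  move: (lbndD B1 B2); congr (lbnd xi i _ _ _); dnorm; zmod.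
Qed.

End Retract.

Section Abelian2.
Variables (k : comPzRingType) (n : nat).
Implicit Types D : abelian_dgcat k n.

Lemma short_exact_retract D (X Y Z X1 Y1 Z1 X2 Y2 Z2 : D) (xi : h3 X Y Z)
    (xi1 : h3 X1 Y1 Z1) (xi2 : h3 X2 Y2 Z2)
    p1 r1 q1 i1 m1 j1 p2 r2 q2 i2 m2 j2 :
  has_mor xi xi1 p1 r1 q1 -> has_mor xi1 xi i1 m1 j1 ->
  has_mor xi xi2 p2 r2 q2 -> has_mor xi2 xi i2 m2 j2 ->
  homotopic (i1 ∘ p1 + i2 ∘ p2) (did X) ->
  homotopic (m1 ∘ r1 + m2 ∘ r2) (did Y) ->
  homotopic (j1 ∘ q1 + j2 ∘ q2) (did Z) ->
  short_exact xi1 -> short_exact xi2 -> short_exact xi.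
Proof.
move=> M1 N1 M2 N2 hx hy hz [l1 e1] [l2 e2]; split.
  apply/left_exactP.
  by apply: (acyclic_retract M1 N1 M2 N2 hx hy hz); apply/left_exactP.
have [o r] := op_h3_ex xi; have [o1 ro1] := op_h3_ex xi1.
have [o2 ro2] := op_h3_ex xi2.
apply/(op_left_exact r)/left_exactP.
apply: (@acyclic_retract k (op_dg D) _ _ _ _ _ _ _ _ _ o o1 o2
  j1 m1 i1 q1 r1 p1 j2 m2 i2 q2 r2 p2).
- exact/(op_has_mor _ _ _ ro1 r).
- exact/(op_has_mor _ _ _ r ro1).
- exact/(op_has_mor _ _ _ ro2 r).
- exact/(op_has_mor _ _ _ r ro2).
- exact/op_homotopic.
- exact/op_homotopic.
- exact/op_homotopic.
- exact/left_exactP/(op_left_exact ro1).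
- exact/left_exactP/(op_left_exact ro2).
Qed.

Lemma direct_sum D (A1 A2 A B1 B2 B C1 C2 C : D)
    (xi1 : h3 A1 B1 C1) (xi2 : h3 A2 B2 C2)
    (i1 : dhom A1 A) (i2 : dhom A2 A) p1 p2 (m1 : dhom B1 B) (m2 : dhom B2 B) r1 r2
    (j1 : dhom C1 C) (j2 : dhom C2 C) q1 q2 :
  biprod i1 i2 p1 p2 -> biprod m1 m2 r1 r2 -> biprod j1 j2 q1 q2 ->
  short_exact xi1 -> short_exact xi2 ->
  exists xi : h3 A B C, [/\ short_exact xi, has_mor xi1 xi i1 m1 j1 &
    has_mor xi2 xi i2 m2 j2].
Proof.
move=> [[di1 ci1] [di2 ci2] [dp1 cp1] [dp2 cp2]].
move=> [al11 da11 /esym Ea11] [al22 da22 /esym Ea22] [al12 da12 /esym Ea12]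
  [al21 da21 /esym Ea21] hx.
move=> [[dm1 cm1] [dm2 cm2] [dr1 cr1] [dr2 cr2]].
move=> [ro11 dr11 /esym Er11] [ro22 dr22 /esym Er22] [ro12 dr12 /esym Er12]
  [ro21 dr21 /esym Er21] hy.
move=> [[dj1 cj1] [dj2 cj2] [dq1 cq1] [dq2 cq2]].
move=> [ta11 dt11 /esym Et11] [ta22 dt22 /esym Et22] [ta12 dt12 /esym Et12]
  [ta21 dt21 /esym Et21] hz.
rewrite !sub0r in da11 da22 da12 da21 dr11 dr22 dr12 dr21 dt11 dt22 dt12 dt21.
rewrite !subr0 in Ea12 Ea21 Er12 Er21 Et12 Et21.
case: xi1 xi2 => f1 g1 h1 cf1 cg1 dh1 Eh1.
case=> f2 g2 h2 cf2 cg2 dh2 Eh2 se1 se2.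
have [[df1 _] [dg1 _] [df2 _] [dg2 _]] := And4 cf1 cg1 cf2 cg2.
pose f := m1 ∘ f1 ∘ p1 + m2 ∘ f2 ∘ p2.
pose g := j1 ∘ g1 ∘ r1 + j2 ∘ g2 ∘ r2.
(* Each r_i ∘ m_j is the identity or zero only up to homotopy, so g ∘ f has extra terms; the
   homotopies [ro] in h compensate for them. *)
pose h := j1 ∘ h1 ∘ p1 + j2 ∘ h2 ∘ p2
  - j1 ∘ g1 ∘ (ro11 ∘ f1 ∘ p1 + ro12 ∘ f2 ∘ p2)
  - j2 ∘ g2 ∘ (ro21 ∘ f1 ∘ p1 + ro22 ∘ f2 ∘ p2).
have cf : closed0 f by apply: closed0_deg; rewrite /f; dgd.
have cg : closed0 g by apply: closed0_deg; rewrite /g; dgd.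
have dh : cx_deg (-1) h by rewrite /h; dgd.
have Eh : cx_d h = - (g ∘ f) by rewrite /f /g /h; dg.
pose xi := H3 cf cg dh Eh.
have N1 : has_mor (H3 cf1 cg1 dh1 Eh1) xi i1 m1 j1.
  exists (m1 ∘ f1 ∘ al11 + m2 ∘ f2 ∘ al21), (j1 ∘ g1 ∘ ro11 + j2 ∘ g2 ∘ ro21),
    (j1 ∘ h1 ∘ al11 + j2 ∘ h2 ∘ al21
     - j1 ∘ g1 ∘ (ro11 ∘ f1 ∘ al11 + ro12 ∘ f2 ∘ al21)
     - j2 ∘ g2 ∘ (ro21 ∘ f1 ∘ al11 + ro22 ∘ f2 ∘ al21)).
  by split=> //=; rewrite /f /g /h; dga.
have N2 : has_mor (H3 cf2 cg2 dh2 Eh2) xi i2 m2 j2.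
  exists (m1 ∘ f1 ∘ al12 + m2 ∘ f2 ∘ al22), (j1 ∘ g1 ∘ ro12 + j2 ∘ g2 ∘ ro22),
    (j1 ∘ h1 ∘ al12 + j2 ∘ h2 ∘ al22
     - j1 ∘ g1 ∘ (ro11 ∘ f1 ∘ al12 + ro12 ∘ f2 ∘ al22)
     - j2 ∘ g2 ∘ (ro21 ∘ f1 ∘ al12 + ro22 ∘ f2 ∘ al22)).
  by split=> //=; rewrite /f /g /h; dga.
have M1 : has_mor xi (H3 cf1 cg1 dh1 Eh1) p1 r1 q1.
  exists (- (ro11 ∘ f1 ∘ p1 + ro12 ∘ f2 ∘ p2)),
    (- (ta11 ∘ g1 ∘ r1 + ta12 ∘ g2 ∘ r2)),
    (ta11 ∘ h1 ∘ p1 + ta12 ∘ h2 ∘ p2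
     - ta11 ∘ g1 ∘ (ro11 ∘ f1 ∘ p1 + ro12 ∘ f2 ∘ p2)
     - ta12 ∘ g2 ∘ (ro21 ∘ f1 ∘ p1 + ro22 ∘ f2 ∘ p2)).
  by split=> //=; rewrite /f /g /h; dga.
have M2 : has_mor xi (H3 cf2 cg2 dh2 Eh2) p2 r2 q2.
  exists (- (ro21 ∘ f1 ∘ p1 + ro22 ∘ f2 ∘ p2)),
    (- (ta21 ∘ g1 ∘ r1 + ta22 ∘ g2 ∘ r2)),
    (ta21 ∘ h1 ∘ p1 + ta22 ∘ h2 ∘ p2
     - ta21 ∘ g1 ∘ (ro11 ∘ f1 ∘ p1 + ro12 ∘ f2 ∘ p2)
     - ta22 ∘ g2 ∘ (ro21 ∘ f1 ∘ p1 + ro22 ∘ f2 ∘ p2)).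
  by split=> //=; rewrite /f /g /h; dga.
by exists xi; split=> //; apply: (short_exact_retract M1 N1 M2 N2).
Qed.

End Abelian2.

Ltac clo := repeat first [assumption | exact: closed0_id | exact: closed0_0
  | exact: h3f_closed | exact: h3g_closed | apply: closed0_comp
  | apply: closed0D].

Ltac htc := apply: htp_comp; try solve [clo | exact: homotopic_refl].

(** * Pullbacks and pushouts of short exact sequences *)

Section Abelian3.
Variables (k : comPzRingType) (n : nat).
Implicit Types D : abelian_dgcat k n.

Lemma split_ses D (A C E : D) (i1 : dhom A E) (i2 : dhom C E) p1 p2 :
  biprod i1 i2 p1 p2 ->
  exists eps : h3 A E C, [/\ short_exact eps, h3f eps = i1 & h3g eps = p2].
Proof.
case=> ci1 ci2 cp1 cp2 E11 E22 E12 E21 hs.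
have [h dh Eh] := E21; rewrite subr0 sub0r in dh Eh.
have Eh' : cx_d (- h) = - (p2 ∘ i1) by rewrite cx_dN -Eh.
exists (H3 ci1 cp2 (cx_degN dh) Eh'); split=> //.
exact: (splitting_exact (xi := H3 ci1 cp2 (cx_degN dh) Eh') ci2 cp1).
Qed.

(** The homotopy pullback is the homotopy kernel of (g, -c) from the biproduct of B and C'. Its
    restriction to B is g up to homotopy, so [octahedron] applies to the split sequence from B to
    C'. *)
Lemma pullback_ses D (A B C C' : D) (xi : h3 A B C) (c : dhom C' C) :
  short_exact xi -> closed0 c ->
  exists (B' : D) (xi' : h3 A B' C') (b : dhom B' B),
    short_exact xi' /\ has_mor xi' xi (did A) b c.
Proof.
move=> sx cc.
have /H0_additiveP [_ /(_ B C') [E [i1 [i2 [p1 [p2 bp]]]]]] := ab_additive D.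
have [eps [se Ef Eg]] := split_ses bp.
case: bp => [ci1 ci2 cp1 cp2 [pi dpi /esym Epi] _ _ _ _]; rewrite sub0r in dpi.
have cu : closed0 (h3g xi ∘ p1 - c ∘ p2).
  apply: closed0_deg; case: (h3g_closed xi) cc cp1 cp2 => ? _ [? _] [? _] [? _].
  by dgd.
(* This is the homotopy from u ∘ i1 to g: [pi] accounts for p1 ∘ i1 and the identity, [h3h eps] for
   p2 ∘ i1 and 0. *)
have dl : cx_deg (-1) (h3g xi ∘ pi + c ∘ h3h eps).
  case: (h3g_closed xi) cc (h3h_deg eps) => ? _ [? _] ?; dgd.
have El : cx_d (h3g xi ∘ pi + c ∘ h3h eps) =
    (h3g xi ∘ p1 - c ∘ p2) ∘ h3f eps - h3g xi.
  case: (h3g_closed xi) cc (h3h_deg eps) (h3h_d eps) => ? _ [? _] ?.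
  by rewrite Ef Eg => ?; dg.
have [E' [eta [eps' [m [c' [[se' Eeta Eg' Eh'] [dm dc' Em Ec']]]]]]] :=
  octahedron sx se cu dl El.
exists E', eps', (p1 ∘ h3f eta); split=> //.
exists (- (pi ∘ h3f xi) - p1 ∘ m), (- h3h eta), c'.
case: cc cp1 cp2 => dc _ [dp1 _] [dp2 _].
case: xi sx dl El Eh' Em Ec' {cu} Eeta => f g h [df cf] [dg_ cg] dh Eh sx.
case: eps se Ef Eg Eg' => phi psi th [dphi cphi] [dpsi cpsi] dth Eth se /= Ef Eg.
case: eta => i u ka [di ci] [du cu] dka Eka /=.
move=> Eg' dl El Eh' Em Ec' Eu; subst phi psi u.
case: eps' se' Eg' Eh' Em Ec' => f' g' h' [df' cf'] [dg' cg'] dh' Eh' _ /=.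
move=> Eg' Eh0 Em Ec'; subst g' h'.
split=> /=; first [exact: closed0_id | apply: closed0_deg; dgd | dga].
Qed.

Lemma pushout_ses D (A A' B C : D) (xi : h3 A B C) (a : dhom A A') :
  short_exact xi -> closed0 a ->
  exists (B' : D) (xi' : h3 A' B' C) (b : dhom B B'),
    short_exact xi' /\ has_mor xi xi' a b (did C).
Proof.
move=> sx ca; have [o r] := op_h3_ex xi.
have [||B' [o' [b [so' m]]]] := @pullback_ses (op_abelian D) C B A A' o a.
- exact/(op_short_exact r).
- exact/op_closed0.
have [xi' r'] := unop_h3_ex o'; exists B', xi', b.
by split; [exact/(op_short_exact r') | exact/(op_has_mor _ _ _ r r')].
Qed.

(* The pullback of xi1 along g is split, because it is so after pushing to xi';
   hence g lifts to B1, and the resulting morphism is corrected by a map B -> A'. *)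
Lemma cartesian_lift D (A A' B B1 B' C C' : D) (xi : h3 A B C)
    (xi1 : h3 A' B1 C) (xi' : h3 A' B' C') a b b' c :
  short_exact xi -> short_exact xi1 -> short_exact xi' ->
  has_mor xi1 xi' (did A') b c -> has_mor xi xi' a b' c ->
  exists b1, has_mor xi xi1 a b1 (did C).
Proof.
move=> sx sx1 sx' m1 m.
have cg := h3g_closed xi.
have [P [w [be [sw mw]]]] := pullback_ses sx1 cg.
have [s [s' [t [ca cb' cc _ ds' _ _ Es' _]]]] := m.
(* The right end of w -> xi1 -> xi' factors through the last map of xi', so [mor_null] extends the
   identity of A' along the first map of w. *)
have hc : homotopic (c ∘ h3g xi) (h3g xi' ∘ b').
  by apply: htp_sym; exists s'; rewrite ?sub0r.
have [r cr hr] := mor_null ((left_exactP _).1 sx'.1) (has_mor_comp mw m1) cb' hc.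
rewrite dcomp1m in hr.
have [si csi hsi] := mor_null_r sw.2 (has_mor_id w) cr hr.
have [s1 [s1' [t1 [_ cbe _ _ ds1' _ _ Es1' _]]]] := mw.
have cb1 : closed0 (be ∘ si) by apply: closed0_comp.
have [|x mx] := left_fill ((left_exactP _).1 sx1.1) cb1 (closed0_id C) (xi := xi).
  rewrite dcomp1m dcompA.
  apply: (htp_trans (g := h3g xi ∘ h3g w ∘ si)).
    htc.
    by exists s1'; rewrite ?sub0r.
  rewrite -dcompA -[X in homotopic _ X]dcompm1.
  htc; exact: htp_sym.
(* Both morphisms to xi' have right end c, so their difference vanishes there and its left end x - a
   extends along f to [r1]. *)
have := has_mor_sub (has_mor_comp mx m1) m.
rewrite dcompm1 dcomp1m subrr => m0.
have [|r1 cr1 hr1] := mor_null ((left_exactP _).1 sx'.1) m0 (closed0_0 _ _).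
  by rewrite dcompm0; apply: homotopic_refl.
have [s2 [s2' [t2 [cx_ cy _ _ _ _ _ _ _]]]] := mx.
have cb2 : closed0 (be ∘ si - h3f xi1 ∘ r1).
  rewrite -scaleN1r addrC; apply: closed0L => //.
  by apply: closed0_comp => //; exact: h3f_closed.
exists (be ∘ si - h3f xi1 ∘ r1).
have := has_mor_sub mx (has_mor_fact xi xi1 cr1); rewrite subr0.
apply: has_mor_homotopic => //; try exact: homotopic_refl.
  exact: closed0_id.
case: hr1 => e de Ee; exists (- e); first exact: cx_degN.
by rewrite cx_dN -Ee; zmod.
Qed.

Lemma cocartesian_lift D (A A' B B1 B' C C' : D) (xi' : h3 A' B' C')
    (xi1 : h3 A B1 C') (xi : h3 A B C) a b b' c :
  short_exact xi' -> short_exact xi1 -> short_exact xi ->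
  has_mor xi' xi1 a b (did C') -> has_mor xi' xi a b' c ->
  exists b1, has_mor xi1 xi (did A) b1 c.
Proof.
move=> sx' sx1 sx m1 m.
have [[o r] [o1 r1] [o' r']] := And3 (op_h3_ex xi) (op_h3_ex xi1) (op_h3_ex xi').
have [||||| b1 mb] := @cartesian_lift (op_abelian D) _ _ _ _ _ _ _ o o1 o' c b b' a.
- exact/(op_short_exact r).
- exact/(op_short_exact r1).
- exact/(op_short_exact r').
- exact/(op_has_mor _ _ _ r' r1).
- exact/(op_has_mor _ _ _ r' r).
by exists b1; apply/(op_has_mor _ _ _ r1 r).
Qed.

(** The map f ∘ p1 + si ∘ p2 compares the split sequence with xi. This is how a class is recognised
    as zero. *)
Lemma section_split D (A B C E : D) (xi : h3 A B C) (ze : h3 A E C)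
    (i2 : dhom C E) p1 (si : dhom C B) :
  biprod (h3f ze) i2 p1 (h3g ze) -> short_exact ze -> closed0 si ->
  homotopic (h3g xi ∘ si) (did C) ->
  exists b, has_mor ze xi (did A) b (did C).
Proof.
case: ze => i1 p2 th ci1 cp2 dth Eth [/= _ ci2 cp1 _ h11 h22 h12 h21 hs] sz csi hsi.
have cb : closed0 (h3f xi ∘ p1 + si ∘ p2).
  by apply: closed0D; apply: closed0_comp => //; exact: h3f_closed.
have [|z mz] := right_fill sz.2 (closed0_id A) cb (xi' := xi).
  rewrite /= dcompm1; apply: htp_sym.
  rewrite -[X in homotopic _ X]addr0 dcompDl; apply: htpD.
    rewrite -dcompA -[X in homotopic _ X]dcompm1.
    by htc.
  rewrite -dcompA -[0](dcompm0 _ si).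
  by htc.
exists (h3f xi ∘ p1 + si ∘ p2).
have [s [s' [t [_ _ cz _ ds' _ _ Es' _]]]] := mz.
apply: has_mor_homotopic mz; try exact: homotopic_refl; try exact: closed0_id.
  exact: cb.
have hz : homotopic (h3g xi ∘ (h3f xi ∘ p1 + si ∘ p2)) (z ∘ p2).
  by exists s'; rewrite ?sub0r.
(* [right_fill] determines z only through z ∘ p2; testing on the section i2 of p2 identifies z with
   the identity. *)
apply: (htp_trans (g := p2 ∘ i2)); first exact: htp_sym.
apply: (htp_trans (g := h3g xi ∘ (h3f xi ∘ p1 + si ∘ p2) ∘ i2)).
  htc.
  rewrite dcompDr !dcompA -[X in homotopic X _]add0r; apply: htpD.
    rewrite -[0](dcomp0m _ p1).
    htc.
    exists (h3h xi); first by rewrite sub0r; exact: h3h_deg.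
    by rewrite h3h_d sub0r.
  by rewrite -[X in homotopic X _]dcomp1m; htc; exact: htp_sym.
apply: (htp_trans (g := z ∘ p2 ∘ i2)).
  by htc.
rewrite -dcompA -[X in homotopic _ X]dcompm1.
by htc.
Qed.

End Abelian3.

Lemma the_eq (T : Type) (x0 x : T) (P : T -> Prop) :
  P x -> (forall y, P y -> y = x) -> the x0 P = x.
Proof.
move=> Px uP; rewrite /the; case: pselect => [e|[]].
  by case: cid => y /= [Py _]; apply: uP.
by exists x; split=> // y /uP.
Qed.

Section Octahedron.
Variables (k : comPzRingType) (n : nat).
Implicit Types D : abelian_dgcat k n.

(** Exhibits eps as a pushout along f. When the image of eps in E(W, C) vanishes, u is the resulting
    extension of g over E. *)
Lemma octahedron_mor D (A B C E W : D) (xi : h3 A B C) (eps : h3 B E W)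
    (u : dhom E C) :
  short_exact xi -> short_exact eps -> closed0 u ->
  homotopic (u ∘ h3f eps) (h3g xi) ->
  exists (E' : D) (eps' : h3 A E' W) b,
    short_exact eps' /\ has_mor eps' eps (h3f xi) b (did W).
Proof.
move=> sx se cu [lam dl /esym El]; rewrite sub0r in dl.
have [E' [eta [eps' [m [c [[se' Eeta Eg' Eh'] [dm dc' Em Ec']]]]]]] :=
  octahedron sx se cu dl El.
exists E', eps', (h3f eta); split=> //; exists (- m), 0, 0.
case: xi sx El Eh' Em Ec' => f g h [df cf] [dg_ cg] dh Eh sx.
case: eps se Eg' => phi psi th [dphi cphi] [dpsi cpsi] dth Eth se /=.
case: eta Eeta => i v ka [di ci] [dv cv] dka Eka /=.
move=> Ev Eg' El Eh' Em Ec'.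
case: eps' se' Eg' Eh' Em Ec' => f' g' h' [df' cf'] [dg' cg'] dh' Eh' _ /=.
move=> Eg' Eh0 Em Ec'; subst g' h'.
by split=> /=; first [exact: closed0_id | apply: closed0_deg; dgd | dga].
Qed.

Lemma octahedron_mor_op D (A B C E W : D) (xi : h3 A B C) (eps : h3 W E B)
    (u : dhom A E) :
  short_exact xi -> short_exact eps -> closed0 u ->
  homotopic (h3g eps ∘ u) (h3f xi) ->
  exists (E' : D) (eps' : h3 W E' C) b,
    short_exact eps' /\ has_mor eps eps' (did W) b (h3g xi).
Proof.
move=> sx se cu h; have [[o r] [o' r']] := conj (op_h3_ex xi) (op_h3_ex eps).
have [||||E' [eps0 [b [s0 m0]]]] :=
    @octahedron_mor (op_abelian D) _ _ _ _ _ o o' u.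
- exact/(op_short_exact r).
- exact/(op_short_exact r').
- exact/op_closed0.
- by case: r r' => _ -> _ [-> _ _]; apply/op_homotopic.
have [eps' re] := unop_h3_ex eps0; exists E', eps', b.
split; first exact/(op_short_exact re).
by apply/(op_has_mor _ _ _ r' re); case: r m0 => ->.
Qed.

(** If u ∘ v is an n-epimorphism then so is u, and its homotopy kernel completes it to a short exact
    sequence. *)
Lemma deflation_comp D (A B C E : D) (xi : h3 A B C) (u : dhom E C) (v : dhom B E) :
  short_exact xi -> closed0 u -> closed0 v -> homotopic (u ∘ v) (h3g xi) ->
  exists (K : D) (eta : h3 K E C), h3g eta = u /\ short_exact eta.
Proof.
move=> sx cu cv h; apply: ses_of_nepi => //.
by apply: nepi_comp cu cv h _ => W w; apply: right_exact_nepi sx.2.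
Qed.

Lemma inflation_comp D (A B C E : D) (xi : h3 A B C) (u : dhom A E) (v : dhom E B) :
  short_exact xi -> closed0 u -> closed0 v -> homotopic (v ∘ u) (h3f xi) ->
  exists (K : D) (eta : h3 A E K), h3f eta = u /\ short_exact eta.
Proof.
move=> sx cu cv h; have [o r] := op_h3_ex xi.
have [||||K [eta' [E0 s]]] := @deflation_comp (op_abelian D) _ _ _ _ o u v.
- exact/(op_short_exact r).
- exact/op_closed0.
- exact/op_closed0.
- by case: r => _ -> _; apply/op_homotopic.
have [eta re] := unop_h3_ex eta'; exists K, eta.
by split; [case: re E0 => _ -> _ | exact/(op_short_exact re)].
Qed.

End Octahedron.

(** * Extension classes and the Baer sum *)

Section Extensions.
Variables (k : comPzRingType) (n : nat) (D : abelian_dgcat k n).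
Implicit Types A B C W X Y Z : D.

Definition erel C A (s s' : ext_rep C A) :=
  exists b, has_mor (projT2 s) (projT2 s') (did A) b (did C).

Lemma erel_refl C A (s : ext_rep C A) : erel s s.
Proof. by exists (did _); apply: has_mor_id. Qed.

Lemma erel_trans C A (s1 s2 s3 : ext_rep C A) :
  erel s1 s2 -> erel s2 s3 -> erel s1 s3.
Proof.
move=> [b m] [b' m']; exists (b' ∘ b).
by have := has_mor_comp m m'; rewrite !dcompm1.
Qed.

(** The identity of s' is lifted through the given morphism s -> s', so the middle map is never
    inverted directly. *)
Lemma erel_sym C A (s s' : ext_rep C A) :
  short_exact (projT2 s) -> short_exact (projT2 s') -> erel s s' -> erel s' s.
Proof.
by move=> ss ss' [b m]; apply: (cartesian_lift ss' ss ss' m (has_mor_id _)).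
Qed.

Definition ecls A B C (xi : h3 A B C) (sx : short_exact xi) : ext C A :=
  qcls (x := existT _ B xi : ext_rep C A)
    (P := fun s : ext_rep C A => short_exact (projT2 s)) _ sx.

Lemma ext_ex C A (d : ext C A) :
  exists B (xi : h3 A B C) (sx : short_exact xi), d = ecls sx.
Proof. by have [[B xi] [sx ->]] := quo_ex d; exists B, xi, sx. Qed.

Lemma qin_short C A (d : ext C A) s : qin d s -> short_exact (projT2 s).
Proof. by have [B [xi [sx ->]]] := ext_ex d; case. Qed.

Lemma qin_ecls A B C (xi : h3 A B C) (sx : short_exact xi) :
  qin (ecls sx) (existT _ B xi : ext_rep C A).
Proof. by split=> //; apply: erel_refl. Qed.

Lemma qin_erel C A (d : ext C A) s s' : qin d s -> qin d s' -> erel s s'.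
Proof.
have [B [xi [sx ->]]] := ext_ex d; move=> [ss r] [ss' r'].
by apply: erel_trans r'; apply: erel_sym r.
Qed.

Lemma ext_eq C A (d d' : ext C A) s s' :
  qin d s -> qin d' s' -> erel s s' -> d = d'.
Proof.
move=> qs qs' r; have [ss ss'] := conj (qin_short qs) (qin_short qs').
have sym (x y : ext_rep C A) : short_exact (projT2 x) -> short_exact (projT2 y) ->
  erel x y -> erel y x by apply: erel_sym.
have tr (x y z : ext_rep C A) : short_exact (projT2 x) -> short_exact (projT2 y) ->
  short_exact (projT2 z) -> erel x y -> erel y z -> erel x z.
  by move=> _ _ _; apply: erel_trans.
rewrite (qin_eq sym tr ss qs) (qin_eq sym tr ss' qs').
exact: qcls_eq.
Qed.

(** Existence of a morphism of extensions with ends a and c. It is the relation between pushout and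
    pullback made explicit in [emor_pp]. *)
Definition emor A A' C C' (a : H0 A A') (c : H0 C C') (d : ext C A)
    (d' : ext C' A') :=
  exists a0 c0 s s' b, [/\ qin a a0, qin c c0, qin d s, qin d' s' &
    has_mor (projT2 s) (projT2 s') a0 b c0].

Lemma qin_homotopic X Y (f : H0 X Y) f0 f1 : qin f f0 -> qin f f1 -> homotopic f0 f1.
Proof.
have [x [cx_ ->]] := H0_ex f; move=> [_ h0] [_ h1].
by apply: htp_trans h1; apply: htp_sym.
Qed.

Lemma qin_cls X Y (f : dhom X Y) (cf : closed0 f) : qin (H0cls cf) f.
Proof. by apply: qin_H0cls => //; apply: homotopic_refl. Qed.

Lemma qin_id X : qin (H0id X) (did X).
Proof. exact: qin_cls. Qed.

Lemma emorP A A' C C' (a : H0 A A') (c : H0 C C') (d : ext C A)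
    (d' : ext C' A') a0 c0 s s' :
  qin a a0 -> qin c c0 -> qin d s -> qin d' s' ->
  emor a c d d' -> exists b, has_mor (projT2 s) (projT2 s') a0 b c0.
Proof.
move=> qa qc qs qs' [a1 [c1 [s1 [s1' [b [qa1 qc1 qs1 qs1' m]]]]]].
have [b1 m1] := qin_erel qs qs1; have [b2 m2] := qin_erel qs1' qs'.
exists (b2 ∘ b ∘ b1).
have := has_mor_comp m1 (has_mor_comp m m2).
rewrite !dcomp1m !dcompm1.
have [t1 [t2 [t3 [_ cb1 _ _ _ _ _ _ _]]]] := m1.
have [t1' [t2' [t3' [_ cb2 _ _ _ _ _ _ _]]]] := m2.
have [t1'' [t2'' [t3'' [_ cb3 _ _ _ _ _ _ _]]]] := m.
apply: has_mor_homotopic.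
- exact: qin_closed0 qa.
- by clo.
- exact: qin_closed0 qc.
- exact: qin_homotopic qa qa1.
- exact: homotopic_refl.
- exact: qin_homotopic qc qc1.
Qed.

Lemma emor_ecls A A' B B' C C' (xi : h3 A B C) (xi' : h3 A' B' C') sx sx' a b c
    (ca : closed0 a) (cc : closed0 c) :
  has_mor xi xi' a b c ->
  emor (H0cls ca) (H0cls cc) (@ecls A B C xi sx) (@ecls A' B' C' xi' sx').
Proof.
move=> m; exists a, c, (existT _ B xi), (existT _ B' xi'), b.
by split; first [exact: qin_cls | exact: qin_ecls | exact: m].
Qed.

Lemma emor_eclsP A A' B B' C C' (xi : h3 A B C) (xi' : h3 A' B' C') sx sx' a c
    (ca : closed0 a) (cc : closed0 c) :
  emor (H0cls ca) (H0cls cc) (@ecls A B C xi sx) (@ecls A' B' C' xi' sx') ->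
  exists b, has_mor xi xi' a b c.
Proof.
exact: (emorP (qin_cls ca) (qin_cls cc) (qin_ecls sx) (qin_ecls sx')).
Qed.

Lemma emor_id A C (d : ext C A) : emor (H0id A) (H0id C) d d.
Proof.
have [B [xi [sx ->]]] := ext_ex d; exact: emor_ecls (has_mor_id xi).
Qed.

Lemma emor_comp A A' A'' C C' C'' (a : H0 A A') (c : H0 C C') (a' : H0 A' A'')
    (c' : H0 C' C'') d d' d'' :
  emor a c d d' -> emor a' c' d' d'' -> emor (H0comp a' a) (H0comp c' c) d d''.
Proof.
have [[a0 [ca ->]] [c0 [cc ->]]] := conj (H0_ex a) (H0_ex c).
have [[a1 [ca' ->]] [c1 [cc' ->]]] := conj (H0_ex a') (H0_ex c').
have [B [xi [sx ->]]] := ext_ex d; have [B' [xi' [sx' ->]]] := ext_ex d'.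
have [B'' [xi'' [sx'' ->]]] := ext_ex d''.
move=> /emor_eclsP [b m] /emor_eclsP [b' m']; rewrite !H0comp_cls.
exact: emor_ecls (has_mor_comp m m').
Qed.

Lemma emorD A A' C C' (a a' : H0 A A') (c c' : H0 C C') d d' :
  emor a c d d' -> emor a' c' d d' -> emor (a + a') (c + c') d d'.
Proof.
have [[a0 [ca ->]] [c0 [cc ->]]] := conj (H0_ex a) (H0_ex c).
have [[a1 [ca' ->]] [c1 [cc' ->]]] := conj (H0_ex a') (H0_ex c').
have [B [xi [sx ->]]] := ext_ex d; have [B' [xi' [sx' ->]]] := ext_ex d'.
move=> /emor_eclsP [b m] /emor_eclsP [b' m'].
rewrite !H0_addE !H0add_cls; exact: emor_ecls (has_mor_add m m').
Qed.

Lemma emorZ A A' C C' r (a : H0 A A') (c : H0 C C') d d' :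
  emor a c d d' -> emor (r *: a) (r *: c) d d'.
Proof.
have [[a0 [ca ->]] [c0 [cc ->]]] := conj (H0_ex a) (H0_ex c).
have [B [xi [sx ->]]] := ext_ex d; have [B' [xi' [sx' ->]]] := ext_ex d'.
move=> /emor_eclsP [b m].
rewrite !H0_scaleE !H0scale_cls; exact: emor_ecls (has_mor_scale r m).
Qed.

Lemma emor_pull_ex A C C' (c : H0 C' C) (d : ext C A) :
  exists e, emor (H0id A) c e d.
Proof.
have [c0 [cc ->]] := H0_ex c; have [B [xi [sx ->]]] := ext_ex d.
have [B' [xi' [b [sx' m]]]] := pullback_ses sx cc.
by exists (ecls sx'); apply: emor_ecls m.
Qed.

Lemma emor_push_ex A A' C (a : H0 A A') (d : ext C A) :
  exists e, emor a (H0id C) d e.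
Proof.
have [a0 [ca ->]] := H0_ex a; have [B [xi [sx ->]]] := ext_ex d.
have [B' [xi' [b [sx' m]]]] := pushout_ses sx ca.
by exists (ecls sx'); apply: emor_ecls m.
Qed.

(** The universal property of the pullback e. For a an identity it gives uniqueness of pullbacks,
    through [emor_id_eq]. *)
Lemma emor_cart A A' C C' (a : H0 A A') (c : H0 C C') d d' e :
  emor (H0id A') c e d' -> emor a c d d' -> emor a (H0id C) d e.
Proof.
have [[a0 [ca ->]] [c0 [cc ->]]] := conj (H0_ex a) (H0_ex c).
have [B [xi [sx ->]]] := ext_ex d; have [B' [xi' [sx' ->]]] := ext_ex d'.
have [E [et [se ->]]] := ext_ex e.
move=> /emor_eclsP [b m] /emor_eclsP [b' m'].
by have [b1 m1] := cartesian_lift sx se sx' m m'; apply: emor_ecls m1.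
Qed.

Lemma emor_cocart A A' C C' (a : H0 A A') (c : H0 C C') d d' e :
  emor a (H0id C) d e -> emor a c d d' -> emor (H0id A') c e d'.
Proof.
have [[a0 [ca ->]] [c0 [cc ->]]] := conj (H0_ex a) (H0_ex c).
have [B [xi [sx ->]]] := ext_ex d; have [B' [xi' [sx' ->]]] := ext_ex d'.
have [E [et [se ->]]] := ext_ex e.
move=> /emor_eclsP [b m] /emor_eclsP [b' m'].
by have [b1 m1] := cocartesian_lift sx se sx' m m'; apply: emor_ecls m1.
Qed.

Lemma emor_id_eq A C (d d' : ext C A) : emor (H0id A) (H0id C) d d' -> d = d'.
Proof.
have [B [xi [sx ->]]] := ext_ex d; have [B' [xi' [sx' ->]]] := ext_ex d'.
move=> /emor_eclsP m.
exact: (ext_eq (qin_ecls sx) (qin_ecls sx') m).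
Qed.

Lemma emor_pull A C C' (c : H0 C' C) (d : ext C A) : emor (H0id A) c (ext_pull c d) d.
Proof.
have [e m] := emor_pull_ex c d; suff -> : ext_pull c d = e by [].
apply: the_eq.
  have [a0 [c0 [s [s' [b [qa qc qs qs' mm]]]]]] := m.
  have [b' m'] := emorP (qin_id A) qc qs qs' m.
  by exists c0, s, s', b'.
move=> e' [c0 [s [s' [b [qc qs qs' mm]]]]].
apply/emor_id_eq/(emor_cart m).
by exists (did A), c0, s, s', b; split=> //; apply: qin_id.
Qed.

Lemma emor_push A A' C (a : H0 A A') (d : ext C A) : emor a (H0id C) d (ext_push a d).
Proof.
have [e m] := emor_push_ex a d; suff -> : ext_push a d = e by [].
apply: the_eq.
  have [a0 [c0 [s [s' [b [qa qc qs qs' mm]]]]]] := m.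
  have [b' m'] := emorP qa (qin_id C) qs qs' m.
  by exists a0, s, s', b'.
move=> e' [a0 [s [s' [b [qc qs qs' mm]]]]].
apply/esym/emor_id_eq; apply: (emor_cocart m).
by exists a0, (did C), s, s', b; split=> //; apply: qin_id.
Qed.

Lemma emor_pullE A C C' (c : H0 C' C) (d : ext C A) e :
  emor (H0id A) c e d -> ext_pull c d = e.
Proof. by move=> m; apply/esym/emor_id_eq/(emor_cart (emor_pull c d)). Qed.

Lemma emor_pushE A A' C (a : H0 A A') (d : ext C A) e :
  emor a (H0id C) d e -> ext_push a d = e.
Proof. by move=> m; apply/emor_id_eq; apply: (emor_cocart (emor_push a d)). Qed.

Lemma emor_pp A A' C C' (a : H0 A A') (c : H0 C C') d d' :
  emor a c d d' <-> ext_push a d = ext_pull c d'.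
Proof.
split=> [m|E].
  by apply/emor_pushE/(emor_cart (emor_pull c d')).
have := emor_push a d; rewrite E => m.
have := emor_comp m (emor_pull c d').
by rewrite H0comp1m H0compm1.
Qed.

Lemma ext_pull_id A C (d : ext C A) : ext_pull (H0id C) d = d.
Proof. exact/emor_pullE/emor_id. Qed.

Lemma ext_push_id A C (d : ext C A) : ext_push (H0id A) d = d.
Proof. exact/emor_pushE/emor_id. Qed.

Lemma ext_pull_comp A C C' C'' (c : H0 C' C) (c' : H0 C'' C') (d : ext C A) :
  ext_pull (H0comp c c') d = ext_pull c' (ext_pull c d).
Proof.
apply: emor_pullE; have := emor_comp (emor_pull c' (ext_pull c d)) (emor_pull c d).
by rewrite H0comp1m.
Qed.

Lemma ext_push_comp A A' A'' C (a : H0 A A') (a' : H0 A' A'') (d : ext C A) :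
  ext_push (H0comp a' a) d = ext_push a' (ext_push a d).
Proof.
apply: emor_pushE; have := emor_comp (emor_push a d) (emor_push a' (ext_push a d)).
by rewrite H0comp1m.
Qed.

Lemma ext_pull_push A A' C C' (a : H0 A A') (c : H0 C' C) (d : ext C A) :
  ext_push a (ext_pull c d) = ext_pull c (ext_push a d).
Proof.
apply/emor_pp; have := emor_comp (emor_pull c d) (emor_push a d).
by rewrite H0comp1m H0compm1.
Qed.

End Extensions.

(** * Six-term exact sequences and the Baer sum *)

Section BaerSum.
Variables (k : comPzRingType) (n : nat) (D : abelian_dgcat k n).
Implicit Types A B C W X Y Z : D.

Lemma ext_zero_ex C A : exists E (ze : h3 A E C) (sz : short_exact ze) i2 p1,
  ext_zero C A = ecls sz /\ biprod (h3f ze) i2 p1 (h3g ze).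
Proof.
rewrite /ext_zero; move: (svalP _); case: cid => -[E ze] /= _ [sz sp].
exists E, ze, sz; case: sp => i1 [i2 [p1 [p2 [bp qi1 qp2]]]].
have [[i20 [ci2 Ei2]] [p10 [cp1 Ep1]]] := conj (H0_ex i2) (H0_ex p1).
have qi2 : qin i2 i20 by rewrite Ei2; apply: qin_cls.
have qp1 : qin p1 p10 by rewrite Ep1; apply: qin_cls.
exists i20, p10; split; last exact: (proj1 (biprod_H0 qi1 qi2 qp1 qp2) bp).
by apply: eq_exist.
Qed.

Section OneExtension.
Variables (A B C : D) (xi : h3 A B C) (sx : short_exact xi).
Let d : ext C A := ecls sx.
Let f : H0 A B := H0cls (h3f_closed xi).
Let g : H0 B C := H0cls (h3g_closed xi).

(** If the pulled back sequence splits, its section followed by the map to B lifts c; the other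
    direction builds a splitting from a lift. *)
Lemma pull_zeroP W (c : H0 W C) :
  ext_pull c d = ext_zero W A <-> exists l, c = H0comp g l.
Proof.
have [c0 [cc ->]] := H0_ex c; split.
- have [E [ze [sz [i2 [p1 [-> bp]]]]]] := ext_zero_ex W A => E0.
  have := emor_pull (H0cls cc) d; rewrite E0 => /emor_eclsP [b m].
  have [s [s' [t [_ cb _ _ ds' _ _ Es' _]]]] := m.
  have [ci2 h22] := conj (bpi2 bp) (bp22 bp).
  exists (H0cls (closed0_comp cb ci2)); rewrite H0comp_cls; apply: H0cls_eq.
  apply: (htp_trans (g := c0 ∘ (h3g ze ∘ i2))).
    rewrite -[X in homotopic X _]dcompm1; htc; exact: htp_sym.
  rewrite !dcompA; htc; apply: htp_sym.
  by exists s'; rewrite ?sub0r.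
- case=> l; have [l0 [cl ->]] := H0_ex l; rewrite H0comp_cls => /H0cls_inj h.
  have := emor_pull (H0cls cc) d.
  have [P [w [sw ->]]] := ext_ex (ext_pull (H0cls cc) d).
  move=> /emor_eclsP [b m].
  (* The lift makes the right end of w -> xi factor through g, so the identity of A extends along
     the first map of w. This retraction in turn gives a section, by [mor_null_r] for the identity
     of w. *)
  have [r cr hr] := mor_null ((left_exactP _).1 sx.1) m cl h.
  have [si csi hsi] := mor_null_r sw.2 (has_mor_id w) cr hr.
  have [E [ze [sz [i2 [p1 [-> bp]]]]]] := ext_zero_ex W A.
  have [b' m'] := section_split bp sz csi (htp_sym hsi).
  by apply/esym/emor_id_eq; apply: (emor_ecls _ _ _ _ m').
Qed.

Lemma push_zeroP W (a : H0 A W) :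
  ext_push a d = ext_zero C W <-> exists r, a = H0comp r f.
Proof.
have [a0 [ca ->]] := H0_ex a; split.
- have [E [ze [sz [i2 [p1 [-> bp]]]]]] := ext_zero_ex C W => E0.
  have := emor_push (H0cls ca) d; rewrite E0 => /emor_eclsP [b m].
  have [s [s' [t [_ cb _ ds _ _ Es _ _]]]] := m.
  have [cp1 h11] := conj (bpp1 bp) (bp11 bp).
  exists (H0cls (closed0_comp cp1 cb)); rewrite H0comp_cls; apply: H0cls_eq.
  apply: (htp_trans (g := p1 ∘ h3f ze ∘ a0)).
    rewrite -[X in homotopic X _]dcomp1m; htc; exact: htp_sym.
  rewrite -!dcompA; htc.
  by exists s; rewrite ?sub0r.
- case=> l; have [l0 [cl ->]] := H0_ex l; rewrite H0comp_cls => /H0cls_inj h.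
  have := emor_push (H0cls ca) d.
  have [P [w [sw ->]]] := ext_ex (ext_push (H0cls ca) d).
  move=> /emor_eclsP [b m].
  have [si csi hsi] := mor_null_r sx.2 m cl h.
  have [E [ze [sz [i2 [p1 [-> bp]]]]]] := ext_zero_ex C W.
  have [b' m'] := section_split bp sz csi (htp_sym hsi).
  by apply/esym/emor_id_eq; apply: (emor_ecls _ _ _ _ m').
Qed.

(** Subtraction takes place among morphisms of extensions, as additivity of the pullback in c is not
    yet available: it will be deduced from this. *)
Lemma pull_eqP W (c c' : H0 W C) :
  ext_pull c d = ext_pull c' d <-> exists l, c - c' = H0comp g l.
Proof.
split.
- move=> E; have := emor_pull c d; have := emor_pull c' d; rewrite E.
  have [w [W' [sw ->]]] := ext_ex (ext_pull c' d).
  have [[c0 [cc ->]] [c1 [cc' ->]]] := conj (H0_ex c) (H0_ex c').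
  move=> /emor_eclsP [b m] /emor_eclsP [b' m'].
  have := has_mor_sub m' m; rewrite subrr => m0.
  have [|l cl hl] := mor_null_r sw.2 m0 (closed0_0 _ _).
    by rewrite dcomp0m; apply: homotopic_refl.
  exists (H0cls cl); rewrite -scaleN1r H0_addE H0_scaleE H0scale_cls H0add_cls.
  rewrite H0comp_cls; apply: H0cls_eq.
  by rewrite scaleN1r.
- move=> [l E]; apply/emor_pullE; have := emor_pull c' d.
  have [W' [w [sw ->]]] := ext_ex (ext_pull c' d).
  have -> : c = c' + H0comp g l by rewrite -E addrC subrK.
  have [[l0 [cl ->]] [c1 [cc' ->]]] := conj (H0_ex l) (H0_ex c').
  move=> /emor_eclsP [b m]; rewrite H0comp_cls H0_addE H0add_cls.
  have := has_mor_add m (has_mor_factr w xi cl); rewrite addr0.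
  exact: emor_ecls.
Qed.

End OneExtension.

Definition hf A B C (xi : h3 A B C) : H0 A B := H0cls (h3f_closed xi).
Definition hg A B C (xi : h3 A B C) : H0 B C := H0cls (h3g_closed xi).

Lemma hgf0 A B C (xi : h3 A B C) : H0comp (hg xi) (hf xi) = 0.
Proof.
rewrite H0comp_cls; apply: H0cls_eq; apply: htp_sym.
exists (h3h xi); first by rewrite sub0r; exact: h3h_deg.
by rewrite h3h_d sub0r.
Qed.

Lemma push_0m A A' C (e : ext C A) : ext_push (0 : H0 A A') e = ext_zero C A'.
Proof.
have [B [xi [sx ->]]] := ext_ex e; apply/push_zeroP; exists 0.
by rewrite H0comp0m.
Qed.

Lemma pull_0m A C C' (e : ext C A) : ext_pull (0 : H0 C' C) e = ext_zero C' A.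
Proof.
have [B [xi [sx ->]]] := ext_ex e; apply/pull_zeroP; exists 0.
by rewrite H0compm0.
Qed.

Lemma pull_zero A C C' (c : H0 C' C) : ext_pull c (ext_zero C A) = ext_zero C' A.
Proof. by rewrite -(push_0m (A := A) _ (ext_zero C A)) -ext_pull_push push_0m. Qed.

Lemma push_zero A A' C (a : H0 A A') : ext_push a (ext_zero C A) = ext_zero C A'.
Proof. by rewrite -(pull_0m (C := C) _ (ext_zero C A)) ext_pull_push pull_0m. Qed.

Lemma push_f0 A B C (xi : h3 A B C) (sx : short_exact xi) : ext_push (hf xi) (ecls sx) = ext_zero C B.
Proof. by apply/push_zeroP; exists (H0id B); rewrite H0comp1m. Qed.

Lemma pull_g0 A B C (xi : h3 A B C) (sx : short_exact xi) : ext_pull (hg xi) (ecls sx) = ext_zero B A.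
Proof. by apply/pull_zeroP; exists (H0id B); rewrite H0compm1. Qed.

(** If e dies in B, then f extends over the middle term of e; the induced map on the last terms is
    the required c. *)
Lemma ext_push_f A B C (xi : h3 A B C) (sx : short_exact xi) W (e : ext W A) :
  ext_push (hf xi) e = ext_zero W B <-> exists c, e = ext_pull c (ecls sx).
Proof.
split=> [|[c ->]]; last by rewrite ext_pull_push push_f0 pull_zero.
have [E [w [sw ->]]] := ext_ex e => /push_zeroP [r].
have [r0 [cr ->]] := H0_ex r; rewrite H0comp_cls => /H0cls_inj h.
have [|z m] := right_fill sw.2 (closed0_id A) cr (xi' := xi).
  by rewrite dcompm1.
have [s [s' [t [_ _ cz _ _ _ _ _ _]]]] := m.
by exists (H0cls cz); apply/esym/emor_pullE/(emor_ecls sw sx _ _ m).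
Qed.

Lemma ext_pull_g A B C (xi : h3 A B C) (sx : short_exact xi) W (e : ext C W) :
  ext_pull (hg xi) e = ext_zero B W <-> exists a, e = ext_push a (ecls sx).
Proof.
split=> [|[a ->]]; last by rewrite -ext_pull_push pull_g0 push_zero.
have [E [w [sw ->]]] := ext_ex e => /pull_zeroP [l].
have [l0 [cl ->]] := H0_ex l; rewrite H0comp_cls => /H0cls_inj h.
have [|x m] := left_fill ((left_exactP _).1 sw.1) cl (closed0_id C) (xi := xi).
  by rewrite dcomp1m; apply: htp_sym.
have [s [s' [t [cx_ _ _ _ _ _ _ _ _]]]] := m.
by exists (H0cls cx_); apply/esym/emor_pushE/(emor_ecls sx sw _ _ m).
Qed.

Lemma ext_push_g A B C (xi : h3 A B C) (sx : short_exact xi) W (e : ext W B) :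
  ext_push (hg xi) e = ext_zero W C <-> exists e', e = ext_push (hf xi) e'.
Proof.
split=> [|[e' ->]]; last by rewrite -ext_push_comp hgf0 push_0m.
have [E [w [sw ->]]] := ext_ex e => /push_zeroP [u].
have [u0 [cu ->]] := H0_ex u; rewrite H0comp_cls => /H0cls_inj h.
have [E' [w' [b [sw' m]]]] := octahedron_mor sx sw cu (htp_sym h).
by exists (ecls sw'); apply/esym/emor_pushE/(emor_ecls sw' sw _ _ m).
Qed.

Lemma ext_pull_f A B C (xi : h3 A B C) (sx : short_exact xi) W (e : ext B W) :
  ext_pull (hf xi) e = ext_zero A W <-> exists e', e = ext_pull (hg xi) e'.
Proof.
split=> [|[e' ->]]; last by rewrite -ext_pull_comp hgf0 pull_0m.
have [E [w [sw ->]]] := ext_ex e => /pull_zeroP [u].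
have [u0 [cu ->]] := H0_ex u; rewrite H0comp_cls => /H0cls_inj h.
have [E' [w' [b [sw' m]]]] := octahedron_mor_op sx sw cu (htp_sym h).
by exists (ecls sw'); apply/esym/emor_pullE/(emor_ecls sw sw' _ _ m).
Qed.

Lemma biproduct_ex X1 X2 : exists X (i1 : H0 X1 X) (i2 : H0 X2 X)
  (p1 : H0 X X1) (p2 : H0 X X2), H0_biproduct i1 i2 p1 p2.
Proof. by have [_] := ab_additive D; apply. Qed.

Section Biproduct.
Variables (C1 C2 C : D) (j1 : H0 C1 C) (j2 : H0 C2 C) (q1 : H0 C C1) (q2 : H0 C C2).
Hypothesis bp : H0_biproduct j1 j2 q1 q2.

Lemma bip_id : H0id C = H0comp j1 q1 + H0comp j2 q2.
Proof. by rewrite H0_addE (bip_sum bp). Qed.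

Lemma pull_biproduct0 A (e : ext C A) :
  ext_pull j1 e = ext_zero C1 A -> ext_pull j2 e = ext_zero C2 A ->
  e = ext_zero C A.
Proof.
have [B [xi [sx ->]]] := ext_ex e.
move=> /pull_zeroP [l1 E1] /pull_zeroP [l2 E2].
rewrite -[LHS]ext_pull_id; apply/pull_zeroP.
exists (H0comp l1 q1 + H0comp l2 q2).
by rewrite H0compDr !H0compA -E1 -E2 bip_id.
Qed.

(* With e given by A -> B -> C, the class e' dies in B, hence e' = w^* e; and
   w - 1 lifts to B because its restrictions to C1 and C2 do. *)
Lemma pull_biproduct_inj A (e e' : ext C A) :
  ext_pull j1 e = ext_pull j1 e' -> ext_pull j2 e = ext_pull j2 e' -> e = e'.
Proof.
have [B [xi [sx ->]]] := ext_ex e => E1 E2.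
have : ext_push (hf xi) e' = ext_zero C B.
  by apply: pull_biproduct0; rewrite -ext_pull_push -?E1 -?E2 ext_pull_push
    push_f0 pull_zero.
move=> /(ext_push_f sx) [w Ee']; move: E1 E2; rewrite Ee' -!ext_pull_comp.
move=> /esym /pull_eqP [l1 E1] /esym /pull_eqP [l2 E2].
rewrite -[LHS]ext_pull_id; apply/esym/pull_eqP.
exists (H0comp l1 q1 + H0comp l2 q2).
rewrite H0compDr !H0compA -E1 -E2 -!scaleN1r !H0compDl !H0compZl -!H0compA.
by rewrite -[in LHS](H0compm1 w) bip_id H0compDr scalerDr addrACA.
Qed.

End Biproduct.

Lemma ext_dsum_emor C1 A1 C2 A2 C A (i1 : H0 A1 A) (i2 : H0 A2 A)
    (j1 : H0 C1 C) (j2 : H0 C2 C) d1 d2 e :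
  ext_dsum i1 i2 j1 j2 d1 d2 e -> emor i1 j1 d1 e /\ emor i2 j2 d2 e.
Proof.
case=> s1 [s2 [s [q1 q2 q]]] [i10 [i20 [j10 [j20 [qi1 qi2 qj1 qj2]]]]].
case=> m1 [m2 [r1 [r2 [m10 [m20 [_ _ _ h1 h2]]]]]].
by split; [exists i10, j10, s1, s, m10 | exists i20, j20, s2, s, m20].
Qed.

Lemma ext_dsum_ex C1 A1 C2 A2 C A (i1 : H0 A1 A) (i2 : H0 A2 A) p1 p2
    (j1 : H0 C1 C) (j2 : H0 C2 C) q1 q2 (d1 : ext C1 A1) (d2 : ext C2 A2) :
  H0_biproduct i1 i2 p1 p2 -> H0_biproduct j1 j2 q1 q2 ->
  exists e, ext_dsum i1 i2 j1 j2 d1 d2 e.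
Proof.
have [B1 [x1 [s1 ->]]] := ext_ex d1; have [B2 [x2 [s2 ->]]] := ext_ex d2.
have [B [m1 [m2 [r1 [r2 bm]]]]] := biproduct_ex B1 B2.
have [[i10 [ci1 Ei1]] [i20 [ci2 Ei2]]] := conj (H0_ex i1) (H0_ex i2).
have [[p10 [cp1 Ep1]] [p20 [cp2 Ep2]]] := conj (H0_ex p1) (H0_ex p2).
have [[j10 [cj1 Ej1]] [j20 [cj2 Ej2]]] := conj (H0_ex j1) (H0_ex j2).
have [[q10 [cq1 Eq1]] [q20 [cq2 Eq2]]] := conj (H0_ex q1) (H0_ex q2).
have [[m10 [cm1 Em1]] [m20 [cm2 Em2]]] := conj (H0_ex m1) (H0_ex m2).
have [[r10 [cr1 Er1]] [r20 [cr2 Er2]]] := conj (H0_ex r1) (H0_ex r2).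
subst i1 i2 p1 p2 j1 j2 q1 q2 m1 m2 r1 r2 => bi bj.
have := (proj1 (biprod_H0 (qin_cls _) (qin_cls _) (qin_cls _) (qin_cls _)) bi).
have := (proj1 (biprod_H0 (qin_cls _) (qin_cls _) (qin_cls _) (qin_cls _)) bj).
have := (proj1 (biprod_H0 (qin_cls _) (qin_cls _) (qin_cls _) (qin_cls _)) bm).
move=> bm' bj' bi'; have [x [sx M1 M2]] := direct_sum bi' bm' bj' s1 s2.
exists (ecls sx), (existT _ B1 x1), (existT _ B2 x2), (existT _ B x).
split; try exact: qin_ecls.
exists i10, i20, j10, j20; split; try exact: qin_cls.
exists (H0cls cm1), (H0cls cm2), (H0cls cr1), (H0cls cr2), m10, m20.
by split=> //; apply: qin_cls.
Qed.

Lemma dsum_pull C1 C2 C A AA (i1 i2 : H0 A AA) p1 p2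
    (j1 : H0 C1 C) (j2 : H0 C2 C) d1 d2 e :
  H0_biproduct i1 i2 p1 p2 -> ext_dsum i1 i2 j1 j2 d1 d2 e ->
  ext_pull j1 (ext_push (H0add p1 p2) e) = d1 /\
  ext_pull j2 (ext_push (H0add p1 p2) e) = d2.
Proof.
move=> bi /ext_dsum_emor [/emor_pp E1 /emor_pp E2].
rewrite -!ext_pull_push -E1 -E2 -!ext_push_comp -H0_addE !H0compDl.
rewrite (bip11 bi) (bip22 bi) (bip12 bi) (bip21 bi).
by rewrite -[H0zero A A]/(0 : H0 A A) addr0 add0r !ext_push_id.
Qed.

Lemma ext_pair C1 C2 A (d1 : ext C1 A) (d2 : ext C2 A) :
  exists C (u : H0 C1 C) (v : H0 C2 C) (e : ext C A),
    ext_pull u e = d1 /\ ext_pull v e = d2.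
Proof.
have [AA [i1 [i2 [p1 [p2 bi]]]]] := biproduct_ex A A.
have [C [j1 [j2 [q1 [q2 bj]]]]] := biproduct_ex C1 C2.
have [e de] := ext_dsum_ex d1 d2 bi bj.
by exists C, j1, j2, (ext_push (H0add p1 p2) e); apply: dsum_pull bi de.
Qed.

(** Pushing h out along the codiagonal gives the pullback of e along (u, v), since both restrict to
    the same classes on the two summands. The diagonal then turns (u, v) into u + v. *)
Lemma dsum_add W C A AA CC (i1 i2 : H0 A AA) p1 p2 (j1 j2 : H0 W CC) q1 q2
    (u v : H0 W C) (e : ext C A) h :
  H0_biproduct i1 i2 p1 p2 -> H0_biproduct j1 j2 q1 q2 ->
  ext_dsum i1 i2 j1 j2 (ext_pull u e) (ext_pull v e) h ->
  ext_push (H0add p1 p2) (ext_pull (H0add j1 j2) h) = ext_pull (u + v) e.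
Proof.
have z0 X Y : H0zero X Y = (0 : H0 X Y) by [].
move=> bi bj dh; have [E1 E2] := dsum_pull bi dh.
pose w := H0comp u q1 + H0comp v q2.
have w1 : H0comp w j1 = u.
  rewrite H0compDl -!H0compA (bip11 bj) (bip21 bj) H0compm1.
  by rewrite z0 H0compm0 addr0.
have w2 : H0comp w j2 = v.
  rewrite H0compDl -!H0compA (bip12 bj) (bip22 bj) H0compm1.
  by rewrite z0 H0compm0 add0r.
have Ew : ext_push (H0add p1 p2) h = ext_pull w e.
  by apply: (pull_biproduct_inj bj); rewrite ?E1 ?E2 -ext_pull_comp ?w1 ?w2.
by rewrite ext_pull_push Ew -ext_pull_comp -H0_addE H0compDr w1 w2.
Qed.

(** By [dsum_add] every choice of biproducts and direct sum yields the same class, so the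
    description in [ext_add] has exactly one solution. *)
Lemma ext_add_pull W C A (u v : H0 W C) (e : ext C A) :
  ext_add (ext_pull u e) (ext_pull v e) = ext_pull (u + v) e.
Proof.
apply: the_eq; last first.
  move=> _ [AA [CC [i1 [i2 [p1 [p2 [j1 [j2 [q1 [q2 [h [bi bj dh ->]]]]]]]]]]]].
  exact: dsum_add bi bj dh.
have [AA [i1 [i2 [p1 [p2 bi]]]]] := biproduct_ex A A.
have [CC [j1 [j2 [q1 [q2 bj]]]]] := biproduct_ex W W.
have [h dh] := ext_dsum_ex (ext_pull u e) (ext_pull v e) bi bj.
exists AA, CC, i1, i2, p1, p2, j1, j2, q1, q2, h; split=> //.
by rewrite (dsum_add bi bj dh).
Qed.

Lemma ext_triple C1 C2 C3 A (d1 : ext C1 A) (d2 : ext C2 A) (d3 : ext C3 A) :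
  exists C (u : H0 C1 C) (v : H0 C2 C) (w : H0 C3 C) (e : ext C A),
    [/\ d1 = ext_pull u e, d2 = ext_pull v e & d3 = ext_pull w e].
Proof.
have [C' [u [v [e' [<- <-]]]]] := ext_pair d1 d2.
have [C [u' [w [e [<- <-]]]]] := ext_pair e' d3.
by exists C, (H0comp u' u), (H0comp u' v), w, e; rewrite !ext_pull_comp.
Qed.

(** The multiple by a of the identity of an extension scales both ends, so scaling on the left end
    agrees with scaling on the right end. *)
Lemma ext_scale_pull W C A (a : k) (u : H0 W C) (e : ext C A) :
  ext_scale a (ext_pull u e) = ext_pull (a *: u) e.
Proof.
rewrite /ext_scale -H0_scaleE.
have /emor_pp -> := emorZ a (emor_id (ext_pull u e)).
by rewrite -ext_pull_comp H0compZr H0compm1.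
Qed.

Lemma ext_addA A C : associative (@ext_add k n D C A).
Proof.
move=> d1 d2 d3; have [C' [u [v [w [e [-> -> ->]]]]]] := ext_triple d1 d2 d3.
by rewrite !ext_add_pull addrA.
Qed.

Lemma ext_addC A C : commutative (@ext_add k n D C A).
Proof.
move=> d1 d2; have [C' [u [v [w [e [-> -> _]]]]]] := ext_triple d1 d2 d1.
by rewrite !ext_add_pull addrC.
Qed.

Lemma ext_add0 A C : left_id (ext_zero C A) (@ext_add k n D C A).
Proof.
move=> d; rewrite -[in LHS](ext_pull_id d) -(pull_0m C d) ext_add_pull add0r.
exact: ext_pull_id.
Qed.

Lemma ext_addN A C : left_inverse (ext_zero C A) (ext_scale (-1)) (@ext_add k n D C A).
Proof.
move=> d; rewrite -(ext_pull_id d) ext_scale_pull ext_add_pull scaleN1r addNr.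
exact: pull_0m.
Qed.

HB.instance Definition _ C A := gen_eqMixin (ext C A).
HB.instance Definition _ C A := gen_choiceMixin (ext C A).
HB.instance Definition _ C A := GRing.isZmodule.Build (ext C A)
  (@ext_addA A C) (@ext_addC A C) (@ext_add0 A C) (@ext_addN A C).

Lemma ext_scaleA A C a b (d : ext C A) :
  ext_scale a (ext_scale b d) = ext_scale (a * b) d.
Proof. by rewrite -(ext_pull_id d) !ext_scale_pull scalerA. Qed.

Lemma ext_scale1 A C : left_id 1 (@ext_scale k n D C A).
Proof. by move=> d; rewrite -(ext_pull_id d) !ext_scale_pull scale1r. Qed.

Lemma ext_scaleDr A C : right_distributive (@ext_scale k n D C A) +%R.
Proof.
move=> a d1 d2; have [C' [u [v [w [e [-> -> _]]]]]] := ext_triple d1 d2 d1.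
rewrite -[_ + _]/(ext_add _ _) -[RHS]/(ext_add _ _).
by rewrite !(ext_add_pull, ext_scale_pull) scalerDr.
Qed.

Lemma ext_scaleDl A C (d : ext C A) :
  {morph (@ext_scale k n D C A)^~ d : a b / a + b}.
Proof.
move=> a b; rewrite -(ext_pull_id d) -[RHS]/(ext_add _ _).
by rewrite !(ext_add_pull, ext_scale_pull) scalerDl.
Qed.

HB.instance Definition _ C A := GRing.Zmodule_isLmodule.Build k (ext C A)
  (@ext_scaleA A C) (@ext_scale1 A C) (@ext_scaleDr A C) (@ext_scaleDl A C).

Lemma ext_pullD C' C A (c : H0 C' C) (d d' : ext C A) :
  ext_pull c (d + d') = ext_pull c d + ext_pull c d'.
Proof.
have [B [u [v [w [e [-> -> _]]]]]] := ext_triple d d' d.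
rewrite -[_ + _]/(ext_add _ _) -[RHS]/(ext_add _ _).
by rewrite -!ext_pull_comp !ext_add_pull -ext_pull_comp H0compDl.
Qed.

Lemma ext_pushD C A A' (a : H0 A A') (d d' : ext C A) :
  ext_push a (d + d') = ext_push a d + ext_push a d'.
Proof.
have [B [u [v [w [e [-> -> _]]]]]] := ext_triple d d' d.
rewrite -[_ + _]/(ext_add _ _) -[RHS]/(ext_add _ _).
by rewrite !(ext_add_pull, ext_pull_push).
Qed.

Lemma ext_pullZ C' C A (c : H0 C' C) a (d : ext C A) :
  ext_pull c (a *: d) = a *: ext_pull c d.
Proof. by rewrite -ext_pull_push. Qed.

Lemma ext_pushZ C A A' (b : H0 A A') a (d : ext C A) :
  ext_push b (a *: d) = a *: ext_push b d.
Proof.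
rewrite -[a *: d]/(ext_scale a d) -[RHS]/(ext_scale _ _) /ext_scale.
by rewrite -!ext_push_comp -H0_scaleE H0compZl H0compZr H0comp1m H0compm1.
Qed.

Lemma ext_pull_addm C' C A (c c' : H0 C' C) (d : ext C A) :
  ext_pull (c + c') d = ext_pull c d + ext_pull c' d.
Proof. by rewrite -ext_add_pull. Qed.

Lemma ext_pull_scalem C' C A a (c : H0 C' C) (d : ext C A) :
  ext_pull (a *: c) d = a *: ext_pull c d.
Proof. by rewrite -ext_scale_pull. Qed.

Lemma ext_push_addm C A A' (a a' : H0 A A') (d : ext C A) :
  ext_push (a + a') d = ext_push a d + ext_push a' d.
Proof.
have [B [u [v [e [E1 E2]]]]] := ext_pair (ext_push a d) (ext_push a' d).
(* Both pushouts are pulled back from one class e, so there are morphisms d -> e with ends (a, u)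
   and (a', v); their sum has ends a + a' and u + v. *)
rewrite -E1 -E2 -[RHS]/(ext_add _ _) ext_add_pull; apply/emor_pp.
by apply: emorD; apply/emor_pp.
Qed.

Lemma ext_push_scalem C A A' r (a : H0 A A') (d : ext C A) :
  ext_push (r *: a) d = r *: ext_push a d.
Proof.
rewrite -[RHS]/(ext_scale _ _) /ext_scale -ext_push_comp -H0_scaleE.
by rewrite H0compZl H0comp1m.
Qed.

End BaerSum.

(** * Coends *)

Section ModuleData.
Variable k : comPzRingType.

(** [moddata] carries no laws; tagging the carrier with a proof of them allows it to bear the
    structure of an [lmodType]. *)
Definition lmt (M : moddata k) (p : is_module M) : Type := M.

Section Lmt.
Variables (M : moddata k) (p : is_module M).

Lemma mod_cancel (x y : M) : m_add x y = y -> x = m_zero.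
Proof.
have [z Ez] := mod_opp p y => /(congr1 (m_add z)).
rewrite [RHS]Ez (mod_addC p x) (mod_addA p) Ez (mod_add0 p) //.
Qed.

Lemma mod_scale0 (x : M) : m_scale 0 x = m_zero.
Proof. by apply: (@mod_cancel _ (m_scale 0 x)); rewrite -(mod_scaleDl p) addr0. Qed.

Lemma mod_addN : left_inverse (@m_zero k M) (m_scale (-1)) (@m_add k M).
Proof.
move=> x; rewrite -{2}[x](mod_scale1 p) -(mod_scaleDl p) addNr.
exact: mod_scale0.
Qed.

HB.instance Definition _ := gen_eqMixin (lmt p).
HB.instance Definition _ := gen_choiceMixin (lmt p).
HB.instance Definition _ := GRing.isZmodule.Build (lmt p)
  (mod_addA p) (mod_addC p) (mod_add0 p) mod_addN.
HB.instance Definition _ := GRing.Zmodule_isLmodule.Build k (lmt p)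
  (mod_scaleA p) (mod_scale1 p) (mod_scaleDr p) (fun x a b => mod_scaleDl p a b x).
End Lmt.

Lemma is_linear0 (M N : moddata k) (u : M -> N) :
  is_module M -> is_module N -> is_linear u -> u m_zero = m_zero.
Proof.
move=> pM pN [_ uZ].
by rewrite -(mod_scale0 pM m_zero) uZ (mod_scale0 pN).
Qed.

End ModuleData.

Section GoodBimodules.
Variables (k : comPzRingType) (n : nat) (D : abelian_dgcat k n).
Notation bim := (bimod k (H0cat D)).
Implicit Types X Y Z : D.

(* The bimodule M is a k-bilinear functor. *)
Record good_bimod (M : bim) : Prop := {
  gb_mod : forall Z X : D, is_module (M Z X);
  gb_pull_lin : forall (Z' Z X : D) (c : H0 Z' Z), is_linear (@b_pull k _ M Z' Z X c);
  gb_push_lin : forall (Z X X' : D) (a : H0 X X'), is_linear (@b_push k _ M Z X X' a);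
  gb_pull_id : forall (Z X : D) (x : M Z X), b_pull (b := M) (H0id Z) x = x;
  gb_push_id : forall (Z X : D) (x : M Z X), b_push (b := M) (H0id X) x = x;
  gb_pull_comp : forall (Z Z' Z'' X : D) (c : H0 Z' Z) (c' : H0 Z'' Z') (x : M Z X),
    b_pull (b := M) (H0comp c c') x = b_pull (b := M) c' (b_pull (b := M) c x);
  gb_push_comp : forall (Z X X' X'' : D) (a : H0 X X') (a' : H0 X' X'') (x : M Z X),
    b_push (b := M) (H0comp a' a) x = b_push (b := M) a' (b_push (b := M) a x);
  gb_push_pull : forall (Z Z' X X' : D) (a : H0 X X') (c : H0 Z' Z) (x : M Z X),
    b_push (b := M) a (b_pull (b := M) c x) = b_pull (b := M) c (b_push (b := M) a x);
  gb_pullD : forall (Z' Z X : D) (c c' : H0 Z' Z) (x : M Z X),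
    b_pull (b := M) (H0add c c') x = m_add (b_pull (b := M) c x) (b_pull (b := M) c' x);
  gb_pullZ : forall (Z' Z X : D) r (c : H0 Z' Z) (x : M Z X),
    b_pull (b := M) (H0scale r c) x = m_scale r (b_pull (b := M) c x);
  gb_pushD : forall (Z X X' : D) (a a' : H0 X X') (x : M Z X),
    b_push (b := M) (H0add a a') x = m_add (b_push (b := M) a x) (b_push (b := M) a' x);
  gb_pushZ : forall (Z X X' : D) r (a : H0 X X') (x : M Z X),
    b_push (b := M) (H0scale r a) x = m_scale r (b_push (b := M) a x) }.

Lemma is_module_lmod (V : lmodType k) :
  is_module (@ModData k V 0 +%R *:%R).
Proof.
split=> /=.
- exact: addrA.
- exact: addrC.
- exact: add0r.
- by move=> x; exists (- x); rewrite addNr.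
- exact: scalerA.
- exact: scale1r.
- by move=> a x y; rewrite scalerDr.
- by move=> a b x; rewrite scalerDl.
Qed.

Lemma good_H0mod : good_bimod (H0mod D).
Proof.
split=> /=.
- by move=> Z X; apply: (is_module_lmod (H0 Z X)).
- by move=> Z' Z X c; split=> *; [apply: H0compDl | apply: H0compZl].
- by move=> Z X X' a; split=> *; [apply: H0compDr | apply: H0compZr].
- by move=> *; apply: H0compm1.
- by move=> *; apply: H0comp1m.
- by move=> *; apply: H0compA.
- by move=> *; rewrite H0compA.
- by move=> *; apply: H0compA.
- by move=> *; apply: H0compDr.
- by move=> *; apply: H0compZr.
- by move=> *; apply: H0compDl.
- by move=> *; apply: H0compZl.
Qed.

Lemma good_E1 : good_bimod (E1 D).
Proof.
split=> /=.
- by move=> Z X; apply: (is_module_lmod (ext Z X)).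
- by move=> Z' Z X c; split=> *; [apply: ext_pullD | apply: ext_pullZ].
- by move=> Z X X' a; split=> *; [apply: ext_pushD | apply: ext_pushZ].
- by move=> *; apply: ext_pull_id.
- by move=> *; apply: ext_push_id.
- by move=> *; apply: ext_pull_comp.
- by move=> *; apply: ext_push_comp.
- by move=> *; apply: ext_pull_push.
- by move=> *; apply: ext_pull_addm.
- by move=> *; apply: ext_pull_scalem.
- by move=> *; apply: ext_push_addm.
- by move=> *; apply: ext_push_scalem.
Qed.

Section Coend.
Variables M N : bim.

Lemma ccls_eq Z X (t t' : cterm M N Z X) : ceq t t' -> ccls t = ccls t'.
Proof.
move=> e; apply: qcls_eq => //.
  by move=> x y _ _; apply: ceq_sym.
by move=> x y z _ _ _; apply: ceq_trans.
Qed.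

Lemma ccls_inj Z X (t t' : cterm M N Z X) : ccls t = ccls t' -> ceq t t'.
Proof. by apply: qcls_inj => x _; apply: ceq_refl. Qed.

Lemma ccls_ex Z X (x : coend_mod M N Z X) : exists t, x = ccls t.
Proof. by have [t [p ->]] := quo_ex x; exists t; case: p. Qed.

Lemma qrepr_ccls Z X (t : cterm M N Z X) : ceq (qrepr (ccls t)) t.
Proof.
by apply: qrepr_qin; split=> //; apply: ceq_refl.
Qed.

Lemma ccls0 Z X : ccls (CZero M N Z X) = m_zero (m := coend_mod M N Z X).
Proof. by []. Qed.

Lemma cclsD Z X (t t' : cterm M N Z X) :
  ccls (CAdd t t') = m_add (m := coend_mod M N Z X) (ccls t) (ccls t').
Proof. by apply: ccls_eq; apply: ceq_add; apply/ceq_sym/qrepr_ccls. Qed.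

Lemma cclsZ Z X a (t : cterm M N Z X) :
  ccls (CScale a t) = m_scale (m := coend_mod M N Z X) a (ccls t).
Proof. by apply: ccls_eq; apply: ceq_scale; apply/ceq_sym/qrepr_ccls. Qed.

Lemma coend_is_module Z X : is_module (coend_mod M N Z X).
Proof.
split.
- move=> x y z; have [[t ->] [[t' ->] [t'' ->]]] :=
    conj (ccls_ex x) (conj (ccls_ex y) (ccls_ex z)).
  by rewrite -!cclsD; apply/ccls_eq/ceq_addA.
- move=> x y; have [[t ->] [t' ->]] := conj (ccls_ex x) (ccls_ex y).
  by rewrite -!cclsD; apply/ccls_eq/ceq_addC.
- move=> x; have [t ->] := ccls_ex x.
  by rewrite -ccls0 -cclsD; apply/ccls_eq/ceq_add0.
- move=> x; have [t ->] := ccls_ex x; exists (ccls (CScale (-1) t)).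
  by rewrite -ccls0 -cclsD; apply/ccls_eq/ceq_opp.
- move=> a b x; have [t ->] := ccls_ex x.
  by rewrite -!cclsZ; apply/ccls_eq/ceq_scaleA.
- move=> x; have [t ->] := ccls_ex x.
  by rewrite -!cclsZ; apply/ccls_eq/ceq_scale1.
- move=> a x y; have [[t ->] [t' ->]] := conj (ccls_ex x) (ccls_ex y).
  by rewrite -!(cclsD, cclsZ); apply/ccls_eq/ceq_scaleDr.
- move=> a b x; have [t ->] := ccls_ex x.
  by rewrite -!(cclsD, cclsZ); apply/ccls_eq/ceq_scaleDl.
Qed.

Lemma tensorDl Z Y X (a a' : M Y X) (b : N Z Y) :
  tensor (m_add a a') b = m_add (tensor a b) (tensor a' b).
Proof. by rewrite -cclsD; apply/ccls_eq/ceq_tensDl. Qed.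

Lemma tensorDr Z Y X (a : M Y X) (b b' : N Z Y) :
  tensor a (m_add b b') = m_add (tensor a b) (tensor a b').
Proof. by rewrite -cclsD; apply/ccls_eq/ceq_tensDr. Qed.

Lemma tensorZl Z Y X r (a : M Y X) (b : N Z Y) :
  tensor (m_scale r a) b = m_scale r (tensor a b).
Proof. by rewrite -cclsZ; apply/ccls_eq/ceq_tensZl. Qed.

Lemma tensorZr Z Y X r (a : M Y X) (b : N Z Y) :
  tensor a (m_scale r b) = m_scale r (tensor a b).
Proof. by rewrite -cclsZ; apply/ccls_eq/ceq_tensZr. Qed.

Lemma tensor_balance Z Y Y' X (y : H0 Y Y') (a : M Y' X) (b : N Z Y) :
  tensor (b_pull (b := M) y a) b = tensor a (b_push (b := N) y b).
Proof. exact/ccls_eq/(@ceq_balance k (H0cat D)). Qed.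

Hypotheses (gM : good_bimod M) (gN : good_bimod N).

Lemma tensor0l Z Y X (b : N Z Y) : tensor (m_zero : M Y X) b = m_zero.
Proof.
by rewrite -(mod_scale0 (gb_mod gM Y X) m_zero) tensorZl
  (mod_scale0 (coend_is_module _ _)).
Qed.

Lemma tensor0r Z Y X (a : M Y X) : tensor a (m_zero : N Z Y) = m_zero.
Proof.
by rewrite -(mod_scale0 (gb_mod gN Z Y) m_zero) tensorZr
  (mod_scale0 (coend_is_module _ _)).
Qed.

Lemma gb_pull0 (K : bim) (gK : good_bimod K) Z' Z X (x : K Z X) :
  b_pull (b := K) (H0zero Z' Z) x = m_zero.
Proof.
have -> : H0zero Z' Z = H0scale 0 (H0zero Z' Z).
  by rewrite -H0_scaleE scale0r.
by rewrite (gb_pullZ gK) (mod_scale0 (gb_mod gK _ _)).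
Qed.

Lemma gb_push0 (K : bim) (gK : good_bimod K) Z X X' (x : K Z X) :
  b_push (b := K) (H0zero X X') x = m_zero.
Proof.
have -> : H0zero X X' = H0scale 0 (H0zero X X').
  by rewrite -H0_scaleE scale0r.
by rewrite (gb_pushZ gK) (mod_scale0 (gb_mod gK _ _)).
Qed.

(** Over a biproduct of Y1 and Y2, two elementary tensors merge into one: by balancing, the cross
    terms contain q1 ∘ j2 or q2 ∘ j1 and vanish. *)
Lemma coendP Z X (x : coend_mod M N Z X) :
  exists (Y : D) (a : M Y X) (b : N Z Y), x = tensor a b.
Proof.
have [t ->] := ccls_ex x; elim: t => [Y a b||t [Y1 [a1 [b1 E1]]] t' [Y2 [a2 [b2 E2]]]|
  r t [Y [a [b E]]]].
- by exists Y, a, b.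
- by exists Z, m_zero, m_zero; rewrite tensor0l.
- have [Y [j1 [j2 [q1 [q2 bp]]]]] := biproduct_ex Y1 Y2.
  exists Y, (m_add (b_pull (b := M) q1 a1) (b_pull (b := M) q2 a2)).
  exists (m_add (b_push (b := N) j1 b1) (b_push (b := N) j2 b2)).
  rewrite cclsD E1 E2 tensorDl !tensorDr !tensor_balance -!(gb_push_comp gN).
  rewrite (bip11 bp) (bip12 bp) (bip21 bp) (bip22 bp) !(gb_push_id gN) !(gb_push0 gN).
  rewrite !tensor0r (mod_add0 (coend_is_module _ _)).
  by rewrite (mod_addC (coend_is_module _ _) (tensor a1 b1) m_zero)
     (mod_add0 (coend_is_module _ _)).
- by exists Y, (m_scale r a), b; rewrite cclsZ E tensorZl.
Qed.

End Coend.

Section CoendMap.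
Variables (M M' N N' : bim) (Z Z' X X' : D).
Variables (phi : forall Y : D, M Y X -> M' Y X') (psi : forall Y : D, N Z Y -> N' Z' Y).
Hypotheses (phi_lin : forall Y, is_linear (@phi Y)) (psi_lin : forall Y, is_linear (@psi Y)).
Hypothesis phi_nat : forall (Y Y' : D) (y : H0 Y Y') (a : M Y' X),
  phi (b_pull (b := M) y a) = b_pull (b := M') y (phi a).
Hypothesis psi_nat : forall (Y Y' : D) (y : H0 Y Y') (b : N Z Y),
  psi (b_push (b := N) y b) = b_push (b := N') y (psi b).

Let tmap := @cterm_map k (H0cat D) M M' N N' Z Z' X X' phi psi.

Lemma cterm_map_ceq (t t' : cterm M N Z X) : ceq t t' ->
  ceq (tmap t) (tmap t').
Proof.
rewrite /tmap; elim=> /= *; try by constructor.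
- by apply: ceq_trans; eassumption.
- by rewrite (phi_lin _).1; apply: ceq_tensDl.
- by rewrite (psi_lin _).1; apply: ceq_tensDr.
- by rewrite (phi_lin _).2; apply: ceq_tensZl.
- by rewrite (psi_lin _).2; apply: ceq_tensZr.
- rewrite phi_nat psi_nat; exact: (@ceq_balance k (H0cat D)).
Qed.

Let cmap := @coend_map k (H0cat D) M M' N N' Z Z' X X' phi psi.

Lemma coend_map_cls t : cmap (ccls t) = ccls (tmap t).
Proof. by apply/ccls_eq/cterm_map_ceq/qrepr_ccls. Qed.

Lemma coend_map_tensor (Y : D) (a : M Y X) (b : N Z Y) :
  cmap (tensor a b) = tensor (phi a) (psi b).
Proof. exact: coend_map_cls. Qed.

Lemma coend_map_lin : is_linear cmap.
Proof.
split=> [x y|a x].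
- have [[t ->] [t' ->]] := conj (ccls_ex x) (ccls_ex y).
  by rewrite -cclsD !coend_map_cls -cclsD.
- have [t ->] := ccls_ex x; by rewrite -cclsZ !coend_map_cls -cclsZ.
Qed.

End CoendMap.

Section CoendGood.
Variables (M N : bim) (gM : good_bimod M) (gN : good_bimod N).

Lemma coend_pull_tensor (Z Z' X Y : D) (c : H0 Z' Z) (a : M Y X) (b : N Z Y) :
  b_pull (b := coend M N) c (tensor a b) = tensor a (b_pull (b := N) c b).
Proof.
apply: (coend_map_tensor (phi := fun Y => id) (psi := fun Y => b_pull (b := N) c)) => //.
- by move=> Y'; apply: gb_pull_lin gN _ _ _ _.
- by move=> *; rewrite (gb_push_pull gN).
Qed.

Lemma coend_push_tensor (Z X X' Y : D) (c : H0 X X') (a : M Y X) (b : N Z Y) :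
  b_push (b := coend M N) c (tensor a b) = tensor (b_push (b := M) c a) b.
Proof.
apply: (coend_map_tensor (phi := fun Y => b_push (b := M) c) (psi := fun Y => id)) => //.
- by move=> Y'; apply: gb_push_lin gM _ _ _ _.
- by move=> *; rewrite (gb_push_pull gM).
Qed.

Lemma good_coend : good_bimod (coend M N).
Proof.
split.
- exact: coend_is_module.
- move=> Z' Z X c; apply: coend_map_lin => //.
  + by move=> Y'; apply: gb_pull_lin gN _ _ _ _.
  + by move=> *; rewrite (gb_push_pull gN).
- move=> Z' Z X c; apply: coend_map_lin => //.
  + by move=> Y'; apply: gb_push_lin gM _ _ _ _.
  + by move=> *; rewrite (gb_push_pull gM).
- move=> Z X x; have [Y [a [b ->]]] := coendP gM gN x.
  by rewrite coend_pull_tensor (gb_pull_id gN).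
- move=> Z X x; have [Y [a [b ->]]] := coendP gM gN x.
  by rewrite coend_push_tensor (gb_push_id gM).
- move=> Z Z' Z'' X c c' x; have [Y [a [b ->]]] := coendP gM gN x.
  by rewrite !coend_pull_tensor (gb_pull_comp gN).
- move=> Z X X' X'' c c' x; have [Y [a [b ->]]] := coendP gM gN x.
  by rewrite !coend_push_tensor (gb_push_comp gM).
- move=> Z Z' X X' c c' x; have [Y [a [b ->]]] := coendP gM gN x.
  by rewrite !(coend_push_tensor, coend_pull_tensor).
- move=> Z' Z X c c' x; have [Y [a [b ->]]] := coendP gM gN x.
  by rewrite !coend_pull_tensor (gb_pullD gN) tensorDr.
- move=> Z' Z X r c x; have [Y [a [b ->]]] := coendP gM gN x.
  by rewrite !coend_pull_tensor (gb_pullZ gN) tensorZr.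
- move=> Z X X' c c' x; have [Y [a [b ->]]] := coendP gM gN x.
  by rewrite !coend_push_tensor (gb_pushD gM) tensorDl.
- move=> Z X X' r c x; have [Y [a [b ->]]] := coendP gM gN x.
  by rewrite !coend_push_tensor (gb_pushZ gM) tensorZl.
Qed.

End CoendGood.

Lemma good_Ext m : good_bimod (Ext D m).
Proof.
by elim: m => [|m IH]; [exact: good_E1 | apply: good_coend IH good_E1].
Qed.

End GoodBimodules.

(** * Vanishing of elementary tensors *)

Section Tensor.
Variables (k : comPzRingType) (Ob : Type) (Hom : Ob -> Ob -> lmodType k).
Variables (comp : forall P Q R, Hom Q R -> Hom P Q -> Hom P R).
Variable idm : forall P, Hom P P.
Variables H N : Ob -> lmodType k.
Variable pull : forall P Q, Hom P Q -> H Q -> H P.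
Variable push : forall P Q, Hom P Q -> N P -> N Q.

(** The coend presentation repeated for a contravariant H and a covariant N over an abstract linear
    category, so that it can also be used over the opposite category with the factors exchanged. *)
Inductive tm : Type :=
  | Tn (Y : Ob) (a : H Y) (b : N Y)
  | T0
  | TA (t t' : tm)
  | TS (r : k) (t : tm).

Inductive teq : tm -> tm -> Prop :=
  | teq_refl t : teq t t
  | teq_sym t t' : teq t t' -> teq t' t
  | teq_trans t t' t'' : teq t t' -> teq t' t'' -> teq t t''
  | teq_add t1 t1' t2 t2' :
      teq t1 t1' -> teq t2 t2' -> teq (TA t1 t2) (TA t1' t2')
  | teq_scale a t t' : teq t t' -> teq (TS a t) (TS a t')
  | teq_addA t t' t'' : teq (TA t (TA t' t'')) (TA (TA t t') t'')
  | teq_addC t t' : teq (TA t t') (TA t' t)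
  | teq_add0 t : teq (TA T0 t) t
  | teq_opp t : teq (TA (TS (-1) t) t) T0
  | teq_scaleA a b t : teq (TS a (TS b t)) (TS (a * b) t)
  | teq_scale1 t : teq (TS 1 t) t
  | teq_scaleDr a t t' : teq (TS a (TA t t')) (TA (TS a t) (TS a t'))
  | teq_scaleDl a b t : teq (TS (a + b) t) (TA (TS a t) (TS b t))
  | teq_tensDl Y (a a' : H Y) (b : N Y) :
      teq (Tn (a + a') b) (TA (Tn a b) (Tn a' b))
  | teq_tensDr Y (a : H Y) (b b' : N Y) :
      teq (Tn a (b + b')) (TA (Tn a b) (Tn a b'))
  | teq_tensZl r Y (a : H Y) (b : N Y) : teq (Tn (r *: a) b) (TS r (Tn a b))
  | teq_tensZr r Y (a : H Y) (b : N Y) : teq (Tn a (r *: b)) (TS r (Tn a b))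
  | teq_balance P Q (y : Hom P Q) (a : H Q) (b : N P) :
      teq (Tn (pull y a) b) (Tn a (push y b)).

Hypothesis pull_id : forall P (x : H P), pull (idm P) x = x.
Hypothesis push_id : forall P (x : N P), push (idm P) x = x.
Hypothesis pull_comp : forall P Q R (g : Hom Q R) (f : Hom P Q) x,
  pull (comp g f) x = pull f (pull g x).
Hypothesis push_comp : forall P Q R (g : Hom Q R) (f : Hom P Q) x,
  push (comp g f) x = push g (push f x).
Hypothesis pullD : forall P Q (f : Hom P Q) x y, pull f (x + y) = pull f x + pull f y.
Hypothesis pullZ : forall P Q (f : Hom P Q) r x, pull f (r *: x) = r *: pull f x.
Hypothesis pullDm : forall P Q (f g : Hom P Q) x, pull (f + g) x = pull f x + pull g x.
Hypothesis pullZm : forall P Q r (f : Hom P Q) x, pull (r *: f) x = r *: pull f x.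
Hypothesis pushDm : forall P Q (f g : Hom P Q) x, push (f + g) x = push f x + push g x.
Hypothesis pushZm : forall P Q r (f : Hom P Q) x, push (r *: f) x = r *: push f x.
Hypothesis pair : forall P1 P2 (n1 : N P1) (n2 : N P2),
  exists P (v1 : Hom P P1) (v2 : Hom P P2) n, push v1 n = n1 /\ push v2 n = n2.

(* An elementwise form of Tor_1(H, N) = 0. *)
Hypothesis tor_free : forall P Q (w : Hom P Q) n x, push w n = 0 ->
  exists U (u : Hom U P) n0, push u n0 = n /\ pull u (pull w x) = 0.

(** The evident reason for x (x) n to vanish: by balancing it equals (pull u x) (x) n0. [tensor_eq0]
    states that there is no other reason. *)
Definition tzero P (n : N P) (x : H P) :=
  exists U (u : Hom U P) n0, push u n0 = n /\ pull u x = 0.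

Lemma pull0 P Q (f : Hom P Q) : pull f 0 = 0.
Proof. by rewrite -[0 in LHS](scale0r (0 : H Q)) pullZ scale0r. Qed.

Lemma tzero0 P (n : N P) : tzero n 0.
Proof. by exists P, (idm P), n; rewrite push_id pull0. Qed.

Lemma tzeroD P (n : N P) x y : tzero n x -> tzero n y -> tzero n (x + y).
Proof.
move=> [U [u [n0 [Eu Ex]]]] [V [v [n1 [Ev Ey]]]].
(* Over a common preimage m of n0 and n1, the maps u p and v q send m to the same n; [tor_free] then
   gives t after which they also pull x back to the same element. *)
have [W [p [q [m [Ep Eq]]]]] := pair n0 n1.
have [|T [t [m0 [Et]]]] := tor_free (w := comp u p - comp v q) (n := m) x.
  by rewrite -scaleN1r pushDm pushZm !push_comp Ep Eq Eu Ev scaleN1r subrr.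
rewrite -scaleN1r pullDm pullZm !pull_comp Ex pull0 add0r pullZ => E.
exists T, (comp (comp v q) t), m0; split; first by rewrite !push_comp Et Eq.
rewrite !pull_comp pullD pullD pullD Ey !pull0 addr0.
by rewrite -[LHS]scale1r -[1](mulr1 1) -mulrNN -scalerA E scaler0.
Qed.

Lemma tzeroZ P (n : N P) r x : tzero n x -> tzero n (r *: x).
Proof.
move=> [U [u [n0 [Eu Ex]]]]; exists U, u, n0; split=> //.
by rewrite pullZ Ex scaler0.
Qed.

Lemma tzeroN P (n : N P) x : tzero n x -> tzero n (- x).
Proof. by move=> /(tzeroZ (-1)); rewrite scaleN1r. Qed.

Lemma tzero_push P Q (w : Hom P Q) n x : tzero n (pull w x) -> tzero (push w n) x.
Proof.
move=> [U [u [n0 [Eu Ex]]]]; exists U, (comp w u), n0.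
by rewrite push_comp Eu pull_comp.
Qed.

(* [pres t n x]: writing every second tensor factor of t as an image of n turns
   t into x (x) n. *)
Fixpoint pres P (n : N P) (t : tm) (x : H P) : Prop :=
  match t with
  | Tn Y a b => exists2 v : Hom P Y, push v n = b & x = pull v a
  | T0 => x = 0
  | TA t t' => exists y z, [/\ pres n t y, pres n t' z & x = y + z]
  | TS r t => exists2 y, pres n t y & x = r *: y
  end.

(** Two ways v and w of obtaining b from n differ by a map killing n; [tor_free] makes the
    corresponding elements of H agree up to [tzero]. *)
Lemma pres_uniq P (n : N P) t x y : pres n t x -> pres n t y -> tzero n (x - y).
Proof.
elim: t x y => [Y a b||t IH t' IH'|r t IH] x y /=.
- move=> [v Ev ->] [w Ew ->].
  have -> : pull v a - pull w a = pull (v - w) a.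
    by rewrite -!scaleN1r pullDm pullZm.
  by apply: tor_free; rewrite -scaleN1r pushDm pushZm Ev Ew scaleN1r subrr.
- by move=> -> ->; rewrite subrr; apply: tzero0.
- move=> [x1 [x2 [p1 p2 ->]]] [y1 [y2 [q1 q2 ->]]].
  by rewrite opprD addrACA; apply: tzeroD; [apply: IH | apply: IH'].
- by move=> [x1 p1 ->] [y1 q1 ->]; rewrite -scalerBr; apply/tzeroZ/IH.
Qed.

Lemma pres_pull P Q (w : Hom P Q) n t x :
  pres (push w n) t x -> pres n t (pull w x).
Proof.
elim: t x => [Y a b||t IH t' IH'|r t IH] x /=.
- by move=> [v Ev ->]; exists (comp v w); rewrite ?push_comp ?pull_comp.
- by move=> ->; rewrite pull0.
- move=> [x1 [x2 [p1 p2 ->]]]; exists (pull w x1), (pull w x2).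
  by split; [apply: IH | apply: IH' | rewrite pullD].
- by move=> [x1 p1 ->]; exists (pull w x1); [apply: IH | rewrite pullZ].
Qed.

(** Each elementary tensor in t forces n to be replaced by a preimage from which its second factor
    also comes; [pair] provides one. *)
Lemma pres_ex P (n : N P) t : exists Q (q : Hom Q P) m x,
  push q m = n /\ pres m t x.
Proof.
elim: t P n => [Y a b||t IH t' IH'|r t IH] P n.
- have [Q [q [v [m [Eq Ev]]]]] := pair n b.
  by exists Q, q, m, (pull v a); split=> //; exists v.
- by exists P, (idm P), n, 0; rewrite push_id.
- have [Q [q [m [x [Eq px]]]]] := IH P n.
  have [R [r [m' [y [Er py]]]]] := IH' Q m.
  exists R, (comp q r), m', (pull r x + y); rewrite push_comp Er Eq; split=> //.
  by exists (pull r x), y; split=> //; apply: pres_pull; rewrite Er.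
- have [Q [q [m [x [Eq px]]]]] := IH P n.
  by exists Q, q, m, (r *: x); split=> //; exists x.
Qed.

Lemma tzero_eq P (n : N P) x y z : z = x + y -> tzero n x -> tzero n y -> tzero n z.
Proof. by move=> ->; apply: tzeroD. Qed.

(** The value of a term relative to n is, up to [tzero], an invariant of its class; every generating
    relation is checked in turn. *)
Lemma teq_pres t t' : teq t t' -> forall P (n : N P) x y,
  pres n t x -> pres n t' y -> tzero n (x - y).
Proof.
elim=> {t t'}.
- by move=> t P n x y; apply: pres_uniq.
- move=> t t' _ IH P n x y px py; rewrite -opprB; apply: tzeroN.
  exact: IH.
- move=> t t' t'' _ IH _ IH' P n x y px py.
  (* The middle term t' may have no value relative to n. It has one relative to a preimage m, and
     [tzero_push] carries the conclusion back to n. *)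
  have [Q [q [m [z [Eq pz]]]]] := pres_ex n t'; rewrite -Eq in px py *.
  apply: tzero_push; apply: (tzero_eq (x := pull q x - z) (y := z - pull q y)).
  + by rewrite -!scaleN1r pullD pullZ !scaleN1r; zmod.
  + by apply: IH pz; apply: pres_pull.
  + by apply: IH' pz _; apply: pres_pull.
- move=> t1 t1' t2 t2' _ IH _ IH' P n x y.
  move=> [x1 [x2 [p1 p2 ->]]] [y1 [y2 [q1 q2 ->]]].
  by rewrite opprD addrACA; apply: tzeroD; [apply: IH | apply: IH'].
- move=> a t t' _ IH P n x y [x1 p1 ->] [y1 q1 ->].
  by rewrite -scalerBr; apply/tzeroZ/IH.
- move=> t t' t'' P n x y [x1 [_ [p1 [x2 [x3 [p2 p3 ->]]] ->]]].
  move=> [_ [y3 [[y1 [y2 [q1 q2 ->]]] q3 ->]]].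
  apply: (tzero_eq (x := x1 - y1) (y := (x2 - y2) + (x3 - y3))); first by zmod.
    exact: pres_uniq p1 q1.
  by apply: tzeroD; [apply: pres_uniq p2 q2 | apply: pres_uniq p3 q3].
- move=> t t' P n x y [x1 [x2 [p1 p2 ->]]] [y1 [y2 [q1 q2 ->]]].
  apply: (tzero_eq (x := x1 - y2) (y := x2 - y1)); first by zmod.
    exact: pres_uniq p1 q2.
  exact: pres_uniq p2 q1.
- move=> t P n x y [_ [x1 [-> p1 ->]]] q1; rewrite add0r.
  exact: pres_uniq p1 q1.
- move=> t P n x y [_ [x2 [[x1 p1 ->] p2 ->]]] ->.
  rewrite subr0 scaleN1r addrC; exact: pres_uniq p2 p1.
- move=> a b t P n x y [_ [x1 p1 ->] ->] [y1 q1 ->].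
  by rewrite scalerA -scalerBr; apply/tzeroZ/(pres_uniq p1 q1).
- by move=> t P n x y [x1 p1 ->] q1; rewrite scale1r; apply: pres_uniq p1 q1.
- move=> a t t' P n x y [_ [x1 [x2 [p1 p2 ->]]] ->].
  move=> [_ [_ [[y1 q1 ->] [y2 q2 ->] ->]]].
  rewrite scalerDr opprD addrACA -!scalerBr.
  by apply: tzeroD; apply: tzeroZ; [apply: pres_uniq p1 q1|apply: pres_uniq p2 q2].
- move=> a b t P n x y [x1 p1 ->] [_ [_ [[y1 q1 ->] [y2 q2 ->] ->]]].
  rewrite scalerDl opprD addrACA -!scalerBr.
  by apply: tzeroD; apply: tzeroZ; [apply: pres_uniq p1 q1|apply: pres_uniq p1 q2].
- move=> Y a a' b P n x y [v Ev ->] [_ [_ [[v1 E1 ->] [v2 E2 ->] ->]]].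
  rewrite pullD opprD addrACA.
  by apply: tzeroD; apply: (pres_uniq (t := Tn _ b)); [exists v|exists v1|exists v|exists v2].
- move=> Y a b b' P n x y [v Ev ->] [_ [_ [[v1 E1 ->] [v2 E2 ->] ->]]].
  rewrite -pullDm; apply: (pres_uniq (t := Tn a (b + b'))); first by exists v.
  by exists (v1 + v2) => //; rewrite pushDm E1 E2.
- move=> r Y a b P n x y [v Ev ->] [_ [w Ew ->] ->].
  by rewrite pullZ -scalerBr; apply/tzeroZ/(pres_uniq (t := Tn a b)); [exists v|exists w].
- move=> r Y a b P n x y [v Ev ->] [_ [w Ew ->] ->].
  rewrite -pullZm; apply: (pres_uniq (t := Tn a (r *: b))); first by exists v.
  by exists (r *: w) => //; rewrite pushZm Ew.
- move=> Q R g a b P n x y [v Ev ->] [w Ew ->].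
  rewrite -pull_comp; apply: (pres_uniq (t := Tn a (push g b))); last by exists w.
  by exists (comp g v) => //; rewrite push_comp Ev.
Qed.

Lemma tensor_eq0 Y (a : H Y) (b : N Y) : teq (Tn a b) T0 -> tzero b a.
Proof.
move=> /teq_pres /(_ Y b a 0); rewrite subr0; apply=> //.
by exists (idm Y).
Qed.

End Tensor.

Section TensorZero.
Variables (k : comPzRingType) (n : nat) (D : abelian_dgcat k n).
Notation bim := (bimod k (H0cat D)).

Lemma hom_deflation (A B C E : D) (xi : h3 A B C) (u : H0 E C) (v : H0 B E) :
  short_exact xi -> H0comp u v = hg xi ->
  exists (K : D) (eta : h3 K E C), short_exact eta /\ hg eta = u.
Proof.
move=> sx; have [[u0 [cu ->]] [v0 [cv ->]]] := conj (H0_ex u) (H0_ex v).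
rewrite H0comp_cls => /H0cls_inj h.
have [K [eta [E0 s]]] := deflation_comp sx cu cv h.
exists K, eta; split=> //; apply: H0cls_eq; rewrite E0; exact: homotopic_refl.
Qed.

Lemma hom_inflation (A B C E : D) (xi : h3 A B C) (u : H0 A E) (v : H0 E B) :
  short_exact xi -> H0comp v u = hf xi ->
  exists (K : D) (eta : h3 A E K), short_exact eta /\ hf eta = u.
Proof.
move=> sx; have [[u0 [cu ->]] [v0 [cv ->]]] := conj (H0_ex u) (H0_ex v).
rewrite H0comp_cls => /H0cls_inj h.
have [K [eta [E0 s]]] := inflation_comp sx cu cv h.
exists K, eta; split=> //; apply: H0cls_eq; rewrite E0; exact: homotopic_refl.
Qed.

Definition effaceable (M : bim) (X : D) := forall (Y : D) (x : M Y X),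
  exists (A B : D) (xi : h3 A B Y), short_exact xi /\
    b_pull (b := M) (hg xi) x = m_zero.

Definition coeffaceable (M : bim) (Z : D) := forall (Y : D) (x : M Z Y),
  exists (B C : D) (xi : h3 Y B C), short_exact xi /\
    b_push (b := M) (hf xi) x = m_zero.

Definition half_exact (M : bim) (Z : D) := forall (A B C : D) (xi : h3 A B C),
  short_exact xi -> forall x : M Z B, b_push (b := M) (hg xi) x = m_zero ->
  exists y : M Z A, x = b_push (b := M) (hf xi) y.

Definition cohalf_exact (M : bim) (X : D) := forall (A B C : D) (xi : h3 A B C),
  short_exact xi -> forall x : M B X, b_pull (b := M) (hf xi) x = m_zero ->
  exists y : M C X, x = b_pull (b := M) (hg xi) y.

Variables (M N : bim) (gM : good_bimod M) (gN : good_bimod N) (X Z : D).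

Let MX (Y : D) : lmodType k := lmt (gb_mod gM Y X).
Let NZ (Y : D) : lmodType k := lmt (gb_mod gN Z Y).
Let hom (P Q : D) : lmodType k := H0 P Q.
Let pl (P Q : D) (f : hom P Q) (x : MX Q) : MX P := b_pull (b := M) f x.
Let ps (P Q : D) (f : hom P Q) (x : NZ P) : NZ Q := b_push (b := N) f x.

Let pairN (P1 P2 : D) (n1 : NZ P1) (n2 : NZ P2) :
  exists (P : D) (v1 : hom P P1) (v2 : hom P P2) (n0 : NZ P),
    ps v1 n0 = n1 /\ ps v2 n0 = n2.
Proof.
have [P [j1 [j2 [q1 [q2 bp]]]]] := biproduct_ex P1 P2.
exists P, q1, q2, (ps j1 n1 + ps j2 n2); rewrite /ps.
rewrite !(gb_push_lin gN _ _).1 -!(gb_push_comp gN).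
rewrite (bip11 bp) (bip12 bp) (bip21 bp) (bip22 bp) !(gb_push_id gN) !(gb_push0 gN).
by split; [exact: (addr0 n1) | exact: (add0r n2)].
Qed.

Let pairM (P1 P2 : D) (n1 : MX P1) (n2 : MX P2) :
  exists (P : D) (v1 : hom P1 P) (v2 : hom P2 P) (n0 : MX P),
    pl v1 n0 = n1 /\ pl v2 n0 = n2.
Proof.
have [P [j1 [j2 [q1 [q2 bp]]]]] := biproduct_ex P1 P2.
exists P, j1, j2, (pl q1 n1 + pl q2 n2); rewrite /pl.
rewrite !(gb_pull_lin gM _ _).1 -!(gb_pull_comp gM).
rewrite (bip11 bp) (bip12 bp) (bip21 bp) (bip22 bp) !(gb_pull_id gM) !(gb_pull0 gM).
by split; [exact: (addr0 n1) | exact: (add0r n2)].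
Qed.

(** Take a deflation g : B -> Q killing x, and let U be the kernel of (w, g) on the biproduct of P
    and B. The element (m, 0) goes to 0 in N(Q), so it lifts to U by half exactness; on U the map
    through P is minus the map through B, which kills x. *)
Let tor_freeN : effaceable M X -> half_exact N Z ->
  forall (P Q : D) (w : hom P Q) (m : NZ P) (x : MX Q), ps w m = 0 ->
  exists (U : D) (u : hom U P) (n0 : NZ U), ps u n0 = m /\ pl u (pl w x) = 0.
Proof.
move=> eM hN P Q w m x Em; have [A [B [xi [sx Ex]]]] := eM Q x.
have [E [j1 [j2 [q1 [q2 bp]]]]] := biproduct_ex P B.
pose u : H0 E Q := H0comp w q1 + H0comp (hg xi) q2.
have uj1 : H0comp u j1 = w.
  rewrite H0compDl -!H0compA (bip11 bp) (bip21 bp) H0compm1.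
  by rewrite (H0compm0 _ (hg xi)) addr0.
have uj2 : H0comp u j2 = hg xi.
  rewrite H0compDl -!H0compA (bip12 bp) (bip22 bp) H0compm1.
  by rewrite (H0compm0 _ w) add0r.
have [K [eta [se Eu]]] := hom_deflation sx uj2.
have [|n0 En0] := hN _ _ _ _ se (b_push (b := N) j1 m).
  by rewrite -(gb_push_comp gN) Eu uj1.
exists K, (H0comp q1 (hf eta)), n0; split.
  by rewrite /ps (gb_push_comp gN) -En0 -(gb_push_comp gN) (bip11 bp) (gb_push_id gN).
rewrite /pl -(gb_pull_comp gM).
have -> : H0comp w (H0comp q1 (hf eta)) =
    H0scale (-1) (H0comp (hg xi) (H0comp q2 (hf eta))).
  rewrite -H0_scaleE scaleN1r; apply/eqP; rewrite -addr_eq0; apply/eqP.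
  by rewrite !H0compA -H0compDl -/u -Eu hgf0.
rewrite (gb_pullZ gM) (gb_pull_comp gM) Ex.
rewrite (is_linear0 (gb_mod gM _ _) (gb_mod gM _ _) (gb_pull_lin gM _ _)).
exact: (scaler0 (MX K) (-1)).
Qed.

Let tor_freeM : coeffaceable N Z -> cohalf_exact M X ->
  forall (P Q : D) (w : hom Q P) (m : MX P) (x : NZ Q), pl w m = 0 ->
  exists (U : D) (u : hom P U) (n0 : MX U), pl u n0 = m /\ ps u (ps w x) = 0.
Proof.
move=> eN hM P Q w m x Em; have [B [C [xi [sx Ex]]]] := eN Q x.
have [E [j1 [j2 [q1 [q2 bp]]]]] := biproduct_ex P B.
pose u : H0 Q E := H0comp j1 w + H0comp j2 (hf xi).
have uj1 : H0comp q1 u = w.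
  rewrite H0compDr !H0compA (bip11 bp) (bip12 bp) H0comp1m.
  by rewrite (H0comp0m _ (hf xi)) addr0.
have uj2 : H0comp q2 u = hf xi.
  rewrite H0compDr !H0compA (bip21 bp) (bip22 bp) H0comp1m.
  by rewrite (H0comp0m _ w) add0r.
have [K [eta [se Eu]]] := hom_inflation sx uj2.
have [|n0 En0] := hM _ _ _ _ se (b_pull (b := M) q1 m).
  by rewrite -(gb_pull_comp gM) Eu uj1.
exists K, (H0comp (hg eta) j1), n0; split.
  by rewrite /pl (gb_pull_comp gM) -En0 -(gb_pull_comp gM) (bip11 bp) (gb_pull_id gM).
rewrite /ps -(gb_push_comp gN).
have -> : H0comp (H0comp (hg eta) j1) w =
    H0scale (-1) (H0comp (H0comp (hg eta) j2) (hf xi)).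
  rewrite -H0_scaleE scaleN1r; apply/eqP; rewrite -addr_eq0; apply/eqP.
  by rewrite -!H0compA -H0compDr -/u -Eu hgf0.
rewrite (gb_pushZ gN) (gb_push_comp gN) Ex.
rewrite (is_linear0 (gb_mod gN _ _) (gb_mod gN _ _) (gb_push_lin gN _ _)).
exact: (scaler0 (NZ K) (-1)).
Qed.

Let tmN := tm MX NZ.
Let tmM := tm NZ MX.

Fixpoint to_tmN (t : cterm M N Z X) : tmN :=
  match t with
  | Tensor Y a b => @Tn k D MX NZ Y a b
  | CZero => T0 MX NZ
  | CAdd t t' => TA (to_tmN t) (to_tmN t')
  | CScale r t => TS r (to_tmN t)
  end.

Fixpoint to_tmM (t : cterm M N Z X) : tmM :=
  match t with
  | Tensor Y a b => @Tn k D NZ MX Y b a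
  | CZero => T0 NZ MX
  | CAdd t t' => TA (to_tmM t) (to_tmM t')
  | CScale r t => TS r (to_tmM t)
  end.

Lemma ceq_teqN t t' : ceq t t' -> @teq k D hom MX NZ pl ps (to_tmN t) (to_tmN t').
Proof.
elim=> /= *; try by constructor.
- by apply: teq_trans; eassumption.
- exact: (@teq_balance k D hom MX NZ pl ps).
Qed.

Lemma ceq_teqM t t' : ceq t t' ->
  @teq k D (fun P Q => hom Q P) NZ MX (fun P Q => @ps Q P) (fun P Q => @pl Q P)
    (to_tmM t) (to_tmM t').
Proof.
elim=> /= *; try by constructor.
- by apply: teq_trans; eassumption.
- by apply: teq_sym; exact: (@teq_balance k D (fun P Q => hom Q P) NZ MX (fun P Q => @ps Q P) (fun P Q => @pl Q P)).
Qed.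

Lemma tensor_zero_eff (Y : D) (a : M Y X) (b : N Z Y) :
  effaceable M X -> half_exact N Z -> tensor a b = m_zero ->
  exists (U : D) (u : H0 U Y) b0,
    b_push (b := N) u b0 = b /\ b_pull (b := M) u a = m_zero.
Proof.
move=> eM hN /ccls_inj /ceq_teqN.
apply: (@tensor_eq0 k D hom (fun P Q R => @H0comp k D P Q R) (fun P => H0id P)
  MX NZ pl ps).
- by move=> *; apply: gb_pull_id gM _ _ _.
- by move=> *; apply: gb_push_id gN _ _ _.
- by move=> *; apply: gb_pull_comp gM _ _ _ _ _ _ _.
- by move=> *; apply: gb_push_comp gN _ _ _ _ _ _ _.
- by move=> *; apply: (gb_pull_lin gM _ _).1.
- by move=> *; apply: (gb_pull_lin gM _ _).2.
- by move=> *; apply: (gb_pullD gM).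
- by move=> *; apply: (gb_pullZ gM).
- by move=> *; apply: (gb_pushD gN).
- by move=> *; apply: (gb_pushZ gN).
- exact: pairN.
- exact: tor_freeN.
Qed.

(** The abstract vanishing result over the opposite category: N takes the place of the contravariant
    functor and M that of the covariant one. *)
Lemma tensor_zero_coeff (Y : D) (a : M Y X) (b : N Z Y) :
  coeffaceable N Z -> cohalf_exact M X -> tensor a b = m_zero ->
  exists (U : D) (u : H0 Y U) a0,
    b_pull (b := M) u a0 = a /\ b_push (b := N) u b = m_zero.
Proof.
move=> eM hN /ccls_inj /ceq_teqM.
apply: (@tensor_eq0 k D (fun P Q => hom Q P) (fun P Q R g f => @H0comp k D R Q P f g)
  (fun P => H0id P) NZ MX (fun P Q => @ps Q P) (fun P Q => @pl Q P)).
- by move=> *; apply: gb_push_id gN _ _ _.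
- by move=> *; apply: gb_pull_id gM _ _ _.
- by move=> *; apply: gb_push_comp gN _ _ _ _ _ _ _.
- by move=> *; apply: gb_pull_comp gM _ _ _ _ _ _ _.
- by move=> *; apply: (gb_push_lin gN _ _).1.
- by move=> *; apply: (gb_push_lin gN _ _).2.
- by move=> *; apply: (gb_pushD gN).
- by move=> *; apply: (gb_pushZ gN).
- by move=> *; apply: (gb_pullD gM).
- by move=> *; apply: (gb_pullZ gM).
- exact: pairM.
- exact: tor_freeM.
Qed.

End TensorZero.

(** * Higher extensions *)

Section HigherExtensions.
Variables (k : comPzRingType) (n : nat) (D : abelian_dgcat k n).
Notation bim := (bimod k (H0cat D)).
Implicit Types A B C W X Y Z : D.

(** A conflation prescribes its middle term up to isomorphism in C. The inverse is one only up to
    the homotopy [rho], and the term - g ∘ rho ∘ f adapts h to it. *)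
Lemma ses_middle_iso A B B' C (xs : h3 A B' C) (b0 : dhom B B') (b1 : dhom B' B) :
  short_exact xs -> closed0 b0 -> closed0 b1 ->
  homotopic (b1 ∘ b0) (did B) -> homotopic (b0 ∘ b1) (did B') ->
  exists xi : h3 A B C, [/\ short_exact xi, has_mor xi xs (did A) b0 (did C),
    h3f xi = b1 ∘ h3f xs & h3g xi = h3g xs ∘ b0].
Proof.
case: xs => f g h cf cg dh Eh ss cb0 cb1 h1 [rho drho /esym Erho].
rewrite sub0r in drho.
have [[df _] [dg_ _] [db0 _] [db1 _]] := And4 cf cg cb0 cb1.
have dh' : cx_deg (-1) (h - g ∘ rho ∘ f) by dgd.
have Eh' : cx_d (h - g ∘ rho ∘ f) = - (g ∘ b0 ∘ (b1 ∘ f)) by dg.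
pose xi := H3 (closed0_comp cb1 cf) (closed0_comp cg cb0) dh' Eh'.
have M : has_mor xi (H3 cf cg dh Eh) (did A) b0 (did C).
  exists (- (rho ∘ f)), 0, 0.
  by split=> //=; first [exact: closed0_id | dga].
have N : has_mor (H3 cf cg dh Eh) xi (did A) b1 (did C).
  exists 0, (g ∘ rho), 0.
  by split=> //=; first [exact: closed0_id | dga].
(* Zero morphisms to and from xs itself, to fill the second summand in [short_exact_retract]. *)
have M0 := has_mor_sub M M; have N0 := has_mor_sub N N; rewrite !subrr in M0 N0.
exists xi; split=> //.
by apply: (short_exact_retract M N M0 N0) => //; rewrite ?dcomp1m dcomp0m addr0 //;
  apply: homotopic_refl.
Qed.

Lemma conflation_rep A B C (f : H0 A B) (g : H0 B C) (d : ext C A) :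
  conflation f g d -> exists (xi : h3 A B C) (sx : short_exact xi),
    [/\ f = hf xi, g = hg xi & d = ecls sx].
Proof.
move=> [[B' xs] [b [f0 [g0 [qd qf qg [b' E1 E2] [Ef Eg]]]]]].
have ss := qin_short qd; rewrite /= in b f0 g0 qf qg b' E1 E2 Ef Eg ss.
have Ef' : f = H0comp b' f0 by rewrite -Ef H0compA E1 H0comp1m.
move: E1 E2 Eg Ef'; rewrite (qin_H0 (h3f_closed xs) qf) (qin_H0 (h3g_closed xs) qg).
have [[b0 [cb ->]] [b1 [cb1 ->]]] := conj (H0_ex b) (H0_ex b').
rewrite !H0comp_cls => /H0cls_inj h1 /H0cls_inj h2 <- ->.
have [xi [sx m Ff Fg]] := ses_middle_iso ss cb cb1 h1 h2.
exists xi, sx; split.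
- by apply: H0cls_eq; rewrite Ff; apply: homotopic_refl.
- by apply: H0cls_eq; rewrite Fg; apply: homotopic_refl.
- apply: (ext_eq qd (qin_ecls sx)); apply: erel_sym => //.
  by exists b0.
Qed.

Section CoendExact.
Variables (M1 M2 M3 N : bim).
Hypotheses (g1 : good_bimod M1) (g2 : good_bimod M2) (g3 : good_bimod M3).
Hypothesis gN : good_bimod N.

(** If psi a (x) b = 0, then b = u_* b0 where u^* a is killed by psi, hence u^* a = phi x; balancing
    rewrites a (x) b as phi x (x) b0. *)
Lemma coend_exact_eff Z X1 X2 X3 (phi : forall Y : D, M1 Y X1 -> M2 Y X2)
    (psi : forall Y : D, M2 Y X2 -> M3 Y X3) :
  (forall Y, is_linear (@phi Y)) -> (forall Y, is_linear (@psi Y)) ->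
  (forall (Y Y' : D) (y : H0 Y Y') x,
    phi Y (b_pull (b := M1) y x) = b_pull (b := M2) y (phi Y' x)) ->
  (forall (Y Y' : D) (y : H0 Y Y') x,
    psi Y (b_pull (b := M2) y x) = b_pull (b := M3) y (psi Y' x)) ->
  (forall Y y, psi Y y = m_zero <-> exists x, phi Y x = y) ->
  effaceable M3 X3 -> half_exact N Z ->
  forall y : coend_mod M2 N Z X2,
    @coend_map k (H0cat D) M2 M3 N N Z Z X2 X3 psi (fun Y => id) y = m_zero <->
    exists x, @coend_map k (H0cat D) M1 M2 N N Z Z X1 X2 phi (fun Y => id) x = y.
Proof.
move=> lphi lpsi nphi npsi ex eM hN y; split=> [|[x <-]].
- have [Y [a [b ->]]] := coendP g2 gN y.
  rewrite coend_map_tensor // => /(tensor_zero_eff g3 gN eM hN).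
  move=> [U [u [b0 [<- Ea]]]]; rewrite -npsi in Ea.
  have [x Ex] := (ex _ _).1 Ea; exists (tensor x b0).
  by rewrite coend_map_tensor // Ex tensor_balance.
- have [Y [a [b ->]]] := coendP g1 gN x; rewrite !coend_map_tensor //.
  have -> : psi Y (phi Y a) = m_zero by apply/ex; exists a.
  exact: tensor0l.
Qed.

Variable M : bim.
Hypothesis gM : good_bimod M.

Lemma coend_exact_coeff X Z1 Z2 Z3 (phi : forall Y : D, M1 Z1 Y -> M2 Z2 Y)
    (psi : forall Y : D, M2 Z2 Y -> M3 Z3 Y) :
  (forall Y, is_linear (@phi Y)) -> (forall Y, is_linear (@psi Y)) ->
  (forall (Y Y' : D) (y : H0 Y Y') x,
    phi Y' (b_push (b := M1) y x) = b_push (b := M2) y (phi Y x)) ->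
  (forall (Y Y' : D) (y : H0 Y Y') x,
    psi Y' (b_push (b := M2) y x) = b_push (b := M3) y (psi Y x)) ->
  (forall Y y, psi Y y = m_zero <-> exists x, phi Y x = y) ->
  coeffaceable M3 Z3 -> cohalf_exact M X ->
  forall y : coend_mod M M2 Z2 X,
    @coend_map k (H0cat D) M M M2 M3 Z2 Z3 X X (fun Y => id) psi y = m_zero <->
    exists x, @coend_map k (H0cat D) M M M1 M2 Z1 Z2 X X (fun Y => id) phi x = y.
Proof.
move=> lphi lpsi nphi npsi ex eM hN y; split=> [|[x <-]].
- have [Y [a [b ->]]] := coendP gM g2 y.
  rewrite coend_map_tensor // => /(tensor_zero_coeff gM g3 eM hN).
  move=> [U [u [b0 [<- Ea]]]]; rewrite -npsi in Ea.
  have [x Ex] := (ex _ _).1 Ea; exists (tensor b0 x).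
  by rewrite coend_map_tensor // Ex tensor_balance.
- have [Y [a [b ->]]] := coendP gM g1 x; rewrite !coend_map_tensor //.
  have -> : psi Y (phi Y b) = m_zero by apply/ex; exists b.
  exact: tensor0r.
Qed.

End CoendExact.

Let gE := good_Ext D.

(** Pullback acts on the last factor only, and that factor is killed by its own deflation. *)
Lemma effaceable_Ext m X : effaceable (Ext D m) X.
Proof.
case: m => [|m] Y x.
  have [B [xi [sx ->]]] := ext_ex x.
  by exists X, B, xi; split=> //; apply: pull_g0.
have [Z [a [b ->]]] := coendP (gE m) (gE 0) x.
have [B [xi [sx Eb]]] := ext_ex b; exists Z, B, xi; split=> //.
rewrite (coend_pull_tensor (gE 0)) Eb [b_pull _ _](pull_g0 sx).
by rewrite tensor0r; last exact: gE 0.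
Qed.

Lemma coeffaceable_E1 Z : coeffaceable (E1 D) Z.
Proof.
move=> Y x; have [B [xi [sx ->]]] := ext_ex x.
by exists B, Z, xi; split=> //; apply: push_f0.
Qed.

Lemma half_exact_E1 Z : half_exact (E1 D) Z.
Proof. by move=> A B C xi sx x /(ext_push_g sx). Qed.

Section Sequence.
Variables (A B C : D) (xi : h3 A B C) (sx : short_exact xi).
Let d := ecls sx.

Lemma delta_contra_nat m :
  (forall W, is_linear (@delta_contra k n D C A d m W)) /\
  (forall W W' (c : H0 W' W) (x : Ext D m W C),
    delta_contra d (b_pull (b := Ext D m) c x) =
    b_pull (b := Ext D m.+1) c (delta_contra d x)).
Proof.
elim: m => [|m [IHl IHn]].
  split=> [W|W W' c x]; first split=> [x y|a x].
  - exact: tensorDr.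
  - exact: tensorZr.
  - exact/esym/(coend_pull_tensor (gE 0)).
split=> [W|W W' c x].
  by apply: coend_map_lin.
have [Y [a [b ->]]] := coendP (gE m) (gE 0) x.
rewrite (coend_pull_tensor (gE 0)).
rewrite [LHS]coend_map_tensor //.
rewrite [X in _ = b_pull _ X]coend_map_tensor //.
by rewrite (coend_pull_tensor (gE 0)).
Qed.

Lemma ext_exact_B m W (y : Ext D m W B) :
  b_push (b := Ext D m) (hg xi) y = m_zero <->
  exists x : Ext D m W A, b_push (b := Ext D m) (hf xi) x = y.
Proof.
elim: m W y => [|m IH] W y.
  split=> [/(ext_push_g sx) [x ->]|[x <-]]; first by exists x.
  by apply/(ext_push_g sx); exists x.
apply: (@coend_exact_eff (Ext D m) (Ext D m) (Ext D m) (E1 D)) => //.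
- exact: gE 0.
- by move=> Y; apply: gb_push_lin (gE m) _ _ _ _.
- by move=> Y; apply: gb_push_lin (gE m) _ _ _ _.
- by move=> *; apply: (gb_push_pull (gE m)).
- by move=> *; apply: (gb_push_pull (gE m)).
- exact: effaceable_Ext.
- exact: half_exact_E1.
Qed.

Lemma ext_exact_C m W (y : Ext D m W C) :
  delta_contra d y = m_zero <->
  exists x : Ext D m W B, b_push (b := Ext D m) (hg xi) x = y.
Proof.
elim: m W y => [|m IH] W y.
  split=> [|[x <-]].
    (* From delta (x) y = 0 one gets y = u_* b0 with u^* delta = 0; so u lifts through g and y comes
       from B. *)
    move=> /(tensor_zero_eff (gE 0) (gE 0) (@effaceable_Ext 0 A) (@half_exact_E1 W)).
    move=> [U [u [b0 [<- /(pull_zeroP sx) [l ->]]]]].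
    by exists (ext_push l b0); rewrite [RHS]ext_push_comp.
  rewrite /= -(tensor_balance (M := E1 D) (N := E1 D)) [b_pull _ _](pull_g0 sx).
  by rewrite tensor0l; last exact: gE 0.
have [dl dn] := delta_contra_nat m.
apply: (@coend_exact_eff (Ext D m) (Ext D m) (Ext D m.+1) (E1 D)) => //.
all: first [exact: (gE m) | exact: (gE m.+1) | exact: (gE 0)
  | by move=> Y; apply: gb_push_lin (gE m) _ _ _ _
  | by move=> Y; apply: gb_push_lin (gE m.+1) _ _ _ _
  | by move=> *; apply: (gb_push_pull (gE m))
  | by move=> *; apply: (gb_push_pull (gE m.+1))
  | by move=> *; apply: dn | exact: effaceable_Ext | exact: half_exact_E1].
Qed.

Lemma ext_exact_A m W (y : Ext D m.+1 W A) :
  b_push (b := Ext D m.+1) (hf xi) y = m_zero <->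
  exists x : Ext D m W C, delta_contra d x = y.
Proof.
elim: m W y => [|m IH] W y.
  split=> [|[x <-]].
    have [Y [a [b ->]]] := coendP (gE 0) (gE 0) y.
    rewrite (coend_push_tensor (gE 0)).
    (* Here b = u_* b0, and u^* a dies in B, hence equals c^* delta; balancing gives a (x) b = delta
       (x) c_* b0. *)
    move=> /(tensor_zero_eff (gE 0) (gE 0) (@effaceable_Ext 0 B) (@half_exact_E1 W)).
    move=> [U [u [b0 [<- Ea]]]].
    have [c Ec] : exists c, ext_pull u a = ext_pull c d.
      by apply/(ext_push_f sx); rewrite ext_pull_push.
    exists (ext_push c b0).
    rewrite -[RHS](tensor_balance (M := E1 D) (N := E1 D)) [b_pull _ _]Ec.
    by rewrite [RHS](tensor_balance (M := E1 D) (N := E1 D)).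
  rewrite [LHS](coend_push_tensor (gE 0)) [b_push _ _](push_f0 sx).
  by rewrite tensor0l; last exact: gE 0.
have [dl dn] := delta_contra_nat m.
apply: (@coend_exact_eff (Ext D m) (Ext D m.+1) (Ext D m.+1) (E1 D)) => //.
all: first [exact: (gE m) | exact: (gE m.+1) | exact: (gE 0)
  | by move=> Y; apply: gb_push_lin (gE m) _ _ _ _
  | by move=> Y; apply: gb_push_lin (gE m.+1) _ _ _ _
  | by move=> *; apply: (gb_push_pull (gE m))
  | by move=> *; apply: (gb_push_pull (gE m.+1))
  | by move=> *; apply: dn | exact: effaceable_Ext | exact: half_exact_E1].
Qed.

End Sequence.

(** Pullback acts on the last factor E, whose exactness is known; the induction hypothesis is the
    condition on the other factor in the dual Tor-vanishing. *)
Lemma cohalf_exact_Ext m X : cohalf_exact (Ext D m) X.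
Proof.
elim: m => [|m IH] A B C xi sx y.
  by move=> /(ext_pull_f sx).
move=> E0; suff [x Ex] : exists x, @coend_map k (H0cat D) (Ext D m) (Ext D m)
    (E1 D) (E1 D) C B X X (fun Y => id) (fun Y => ext_pull (hg xi)) x = y.
  by exists x.
apply: (proj1 (@coend_exact_coeff (E1 D) (E1 D) (E1 D) _ _ _ (Ext D m) _
  X C B A (fun Y => ext_pull (hg xi)) (fun Y => ext_pull (hf xi)) _ _ _ _ _ _ _ y) E0).
all: try exact: (gE m); try exact: (gE 0).
- by move=> Y; apply: gb_pull_lin (gE 0) _ _ _ _.
- by move=> Y; apply: gb_pull_lin (gE 0) _ _ _ _.
- by move=> *; apply/esym/ext_pull_push.
- by move=> *; apply/esym/ext_pull_push.
- move=> Y z; split=> [/(ext_pull_f sx) [x ->]|[x <-]]; first by exists x.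
  by apply/(ext_pull_f sx); exists x.
- exact: coeffaceable_E1.
- exact: IH.
Qed.

Section CoSequence.
Variables (A B C : D) (xi : h3 A B C) (sx : short_exact xi).
Let d := ecls sx.

Lemma ext_coexact_B m X (y : Ext D m B X) :
  b_pull (b := Ext D m) (hf xi) y = m_zero <->
  exists x : Ext D m C X, b_pull (b := Ext D m) (hg xi) x = y.
Proof.
split=> [/(cohalf_exact_Ext sx) [x ->]|[x <-]]; first by exists x.
by rewrite -(gb_pull_comp (gE m)) hgf0 [LHS](gb_pull0 (gE m)).
Qed.

(** Delta is the outermost factor here, so the vanishing of y (x) delta is analysed at once for
    every m, in contrast with the recursive [delta_contra]. *)
Lemma ext_coexact_A m X (y : Ext D m A X) :
  tensor (M := Ext D m) (N := E1 D) y (d : E1 D C A) = m_zero <->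
  exists x : Ext D m B X, b_pull (b := Ext D m) (hf xi) x = y.
Proof.
split=> [|[x <-]].
  move=> /(tensor_zero_coeff (gE m) (gE 0) (@coeffaceable_E1 C) (@cohalf_exact_Ext m X)).
  move=> [U [u [b0 [<- /(push_zeroP sx) [l ->]]]]].
  by exists (b_pull (b := Ext D m) l b0); rewrite -(gb_pull_comp (gE m)).
rewrite tensor_balance [b_push _ _](push_f0 sx).
by rewrite tensor0r; last exact: gE 0.
Qed.

Lemma ext_coexact_C m X (y : Ext D m.+1 C X) :
  b_pull (b := Ext D m.+1) (hg xi) y = m_zero <->
  exists x : Ext D m A X, tensor (M := Ext D m) (N := E1 D) x (d : E1 D C A) = y.
Proof.
split=> [|[x <-]].
  have [Y [a [b ->]]] := coendP (gE m) (gE 0) y.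
  rewrite (coend_pull_tensor (gE 0)).
  move=> /(tensor_zero_coeff (gE m) (gE 0) (@coeffaceable_E1 B) (@cohalf_exact_Ext m X)).
  move=> [U [u [a0 [<- Eb]]]].
  have [c Ec] : exists c, ext_push u b = ext_push c d.
    by apply/(ext_pull_g sx); rewrite -ext_pull_push.
  exists (b_pull (b := Ext D m) c a0).
  by rewrite !tensor_balance; congr (tensor _ _); exact: esym Ec.
rewrite [LHS](coend_pull_tensor (gE 0)) [b_pull _ _](pull_g0 sx).
by rewrite tensor0r; last exact: gE 0.
Qed.

End CoSequence.

End HigherExtensions.

(** * Loops and suspensions *)

Section Connecting.
Variables (k : comPzRingType) (n : nat).
Implicit Types D : abelian_dgcat k n.

Definition lconn D (A B C LC : D) (xi : h3 A B C) (hC : dhom LC C) (w : dhom LC A)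
    (h' : dhom LC B) (eta : dhom LC C) :=
  [/\ closed0 w, cx_deg (-1) h', cx_d h' = - (h3f xi ∘ w), cx_deg (-2) eta &
      cx_d eta = h3g xi ∘ h' - h3h xi ∘ w - hC].

Definition rconn D (A B C SA : D) (xi : h3 A B C) (hA : dhom A SA) (w : dhom C SA)
    (h' : dhom B SA) (eta : dhom A SA) :=
  [/\ closed0 w, cx_deg (-1) h', cx_d h' = - (w ∘ h3g xi), cx_deg (-2) eta &
      cx_d eta = h' ∘ h3f xi - w ∘ h3h xi - hA].

Section Left.
Variables (D : abelian_dgcat k n) (A B C LC : D) (xi : h3 A B C) (hC : dhom LC C).
Hypotheses (lx : left_exact xi) (lC : is_loop hC).

(** The morphism h_C alone is a cycle (0, 0, h_C) of T of degree 1, and w is the first component of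
    a primitive. *)
Lemma lconn_ex : exists w h' eta, lconn xi hC w h' eta.
Proof.
have [[dC EC] _] := lC; have ac := (left_exactP _).1 lx.
have [|||w [b [c [[dw db dc] [Eb Ec]]]]] := acyclic1 (b := 0) (c := hC) ac.
- exact: cx_deg0.
- by [].
- by rewrite dcompm0.
exists w, (- b), (- c); split; first exact: closed0_deg.
- exact: cx_degN.
- by rewrite cx_dN Eb subr0.
- exact: cx_degN.
- by rewrite cx_dN Ec; dnorm; zmod.
Qed.

Lemma lconn_uniq w1 h1 e1 w2 h2 e2 :
  lconn xi hC w1 h1 e1 -> lconn xi hC w2 h2 e2 -> homotopic w1 w2.
Proof.
have ac := (left_exactP _).1 lx.
move=> [[dw1 _] dh1 Eh1 de1 Ee1] [[dw2 _] dh2 Eh2 de2 Ee2].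
apply: (acyclic0 (b := h2 - h1) (c := e2 - e1) ac); first by split; dgd.
  by dg.
by dg.
Qed.

Section Data.
Variables (w : dhom LC A) (h' : dhom LC B) (eta : dhom LC C).
Hypothesis cw : lconn xi hC w h' eta.

(** A primitive b of f ∘ a makes g ∘ b + h ∘ a a cycle of degree i - 1 in C, which the loop object
    converts, up to sign, into c of degree i. *)
Lemma lconn_exactA (W : D) i (a : dhom W A) : i <= 0 -> cycle i a ->
  boundary i (h3f xi ∘ a) <->
  exists2 c : dhom W LC, cycle i c & boundary i (a - w ∘ c).
Proof.
move=> le_i [da Ea]; have ac := (left_exactP _).1 lx.
have [[dC EC] lC'] := lC; have [[dw _] dh' Eh' de Ee] := cw.
case: xi ac Eh' Ee => f g h [df cf] [dg_ cg] dh Eh ac /= Eh' Ee; split.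
- move=> [b db /esym Eb].
  have [|c [dc Ec] [e de' /esym Ee']] := (lC' W i le_i).2 (- (g ∘ b + h ∘ a)).
    by split; [dgd|dg].
  exists c => //.
  have [||a' [b' [c' [[da' db' dc'] /= [Ea' _ _]]]]] :=
    ac W i (a - w ∘ c) (b + h' ∘ c) (eta ∘ c - e).
  + by lia.
  + by split; split=> /=; dga.
  + by exists a'.
- move=> [c [dc Ec] [e de' /esym Ee']].
  by exists (- (h' ∘ c) + f ∘ e); [dgd|dg].
Qed.

(** If w ∘ c = d a, then h' ∘ c + f ∘ a is closed because d h' = - f ∘ w, and eta compares its image
    under g with h_C ∘ c. *)
Lemma lconn_exactC (W : D) i (c : dhom W LC) : i <= 0 -> cycle i c ->
  boundary i (w ∘ c) <->
  exists2 b : dhom W B, cycle (i - 1) b & boundary (i - 1) (h3g xi ∘ b - hC ∘ c).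
Proof.
move=> le_i [dc Ec]; have ac := (left_exactP _).1 lx.
have [[dC EC] lC'] := lC; have [[dw _] dh' Eh' de Ee] := cw.
case: xi ac Eh' Ee => f g h [df cf] [dg_ cg] dh Eh ac /= Eh' Ee; split.
- move=> [a da /esym Ea]; exists (h' ∘ c + f ∘ a).
    by split; [dgd|dg].
  by exists (eta ∘ c - h ∘ a); [dgd|dg].
- move=> [b [db Eb] [e de' /esym Ee']].
  have [||a' [b' [c' [[da' db' dc'] /= [Ea' _ _]]]]] :=
    ac W i (w ∘ c) (b - h' ∘ c) (e - eta ∘ c).
  + by lia.
  + by split; split=> /=; dga.
  + by exists a'.
Qed.

End Data.
End Left.

(** Equivalent sequences admit the same w, so the connecting morphism depends only on the class
    delta. *)
Lemma lconn_mor D (A B B' C LC : D) (xi : h3 A B C) (xi' : h3 A B' C)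
    (hC : dhom LC C) b w h' eta :
  has_mor xi xi' (did A) b (did C) -> lconn xi hC w h' eta ->
  exists h2 eta2, lconn xi' hC w h2 eta2.
Proof.
case: xi xi' => f g h [df cf] [dg_ cg] dh Eh [f' g' h0 [df' cf'] [dg' cg'] dh0 Eh0].
move=> [s [s' [t [_ [db _] _ ds ds' dt /= Es Es' Et]]]].
move=> [[dw cw] dh' /= Eh' de Ee].
exists (b ∘ h' - s ∘ w), (eta + s' ∘ h' + t ∘ w).
by split=> //=; dga.
Qed.

Section Right.
Variables (D : abelian_dgcat k n) (A B C SA : D) (xi : h3 A B C) (hA : dhom A SA).

Lemma op_loop : is_suspension hA -> @is_loop k (op_dg D) A SA hA.
Proof.
move=> [cA H]; split; first exact/(@op_cycle _ (@dhom k D A SA)).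
move=> W i le_i; have := H W i le_i => Hb.
exact: (proj2 (@op_Hbij k (@dhom k D SA W) (@dhom k D SA W) (@dhom k D A W) i (i - 1)
  (fun u => @dcomp k D _ _ _ u hA) (fun u => @dcomp k D _ _ _ u hA) (fun=> erefl)) Hb).
Qed.

(* The sign of w is forced by h being replaced by -h in the opposite category. *)
Lemma op_conn (o : @h3 k (op_dg D) C B A) w h' eta : op_rel xi o ->
  rconn xi hA w h' eta <->
  @lconn (op_abelian D) C B A SA o hA (- w) h' eta.
Proof.
case=> Ef Eg Eh; rewrite /lconn /rconn Ef Eg Eh.
have m1 (U V : D) (s : dhom U V) : cx_deg (-1) s ->
    @cx_d k (@dhom k (op_dg D) V U) s = - cx_d s.
  by move=> ds; rewrite (@op_dE _ (dhom U V) _ _ ds) expr1 scaleN1r.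
have m2 (U V : D) (s : dhom U V) : cx_deg (-2) s ->
    @cx_d k (@dhom k (op_dg D) V U) s = cx_d s.
  by move=> ds; rewrite (@op_dE _ (dhom U V) _ _ ds) /= sqrrN expr1n scale1r.
split=> -[cw dh' Eh' de Ee].
- have cw' : closed0 (- w) by rewrite -scaleN1r; apply: closed0Z.
  split=> //.
  + exact/op_closed0.
  + by rewrite (m1 _ _ _ dh') Eh' op_compE dcompNl.
  + by rewrite (m2 _ _ _ de) Ee !op_compE dcompNl dcompNr opprK.
- have {}cw : closed0 w.
    by move/op_closed0: cw => cw; rewrite -[w]opprK -scaleN1r; apply: closed0Z.
  split=> //.
  + by move: Eh'; rewrite (m1 _ _ _ dh') op_compE dcompNl opprK => <-; rewrite opprK.
  + by move: Ee; rewrite (m2 _ _ _ de) !op_compE dcompNl dcompNr opprK.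
Qed.

Hypotheses (rx : right_exact xi) (sA : is_suspension hA).

Lemma rconn_ex : exists w h' eta, rconn xi hA w h' eta.
Proof.
have [o r] := op_h3_ex xi.
have [||w [h' [eta c]]] := @lconn_ex (op_abelian D) _ _ _ _ o hA.
- exact/(op_left_exact r).
- exact: op_loop.
exists (- w), h', eta; apply/(op_conn _ _ _ r).
by rewrite opprK.
Qed.

Lemma rconn_uniq w1 h1 e1 w2 h2 e2 :
  rconn xi hA w1 h1 e1 -> rconn xi hA w2 h2 e2 -> homotopic w1 w2.
Proof.
have [o r] := op_h3_ex xi.
move=> /(op_conn _ _ _ r) c1 /(op_conn _ _ _ r) c2.
have /op_homotopic [e de Ee] := @lconn_uniq (op_abelian D) _ _ _ _ o hA
  ((op_left_exact r).2 rx) _ _ _ _ _ _ c1 c2.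
exists (- e); first exact: cx_degN.
by rewrite cx_dN -Ee; zmod.
Qed.

Section Data.
Variables (w : dhom C SA) (h' : dhom B SA) (eta : dhom A SA).
Hypothesis cw : rconn xi hA w h' eta.

Lemma rconn_exactC (W : D) i (c : dhom C W) : i <= 0 -> cycle i c ->
  boundary i (c ∘ h3g xi) <->
  exists2 a : dhom SA W, cycle i a & boundary i (c - a ∘ w).
Proof.
move=> le_i cc; have [o r] := op_h3_ex xi.
have E := @lconn_exactA (op_abelian D) _ _ _ _ o hA ((op_left_exact r).2 rx)
  (op_loop sA) _ _ _ ((op_conn _ _ _ r).1 cw) W i c le_i
  ((@op_cycle _ (@dhom k D C W) _ _).2 cc).
have := conj E r => -[{}E [Ef _ _]].
rewrite Ef in E.
have E1 := @op_boundary _ (@dhom k D B W) i (c ∘ h3g xi).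
split.
  move=> /E1 /E [a /(@op_cycle _ (@dhom k D SA W)) ca].
  move=> /(@op_boundary _ (@dhom k D C W)) ba.
  exists (- a); first by rewrite -scaleN1r; case: ca => da Ea; split;
    [apply: cx_degZ | rewrite cx_dZ Ea scaler0].
  by move: ba; rewrite op_compE dcompNr dcompNl.
move=> [a ca ba]; apply/E1/E; exists (- a).
  apply/(@op_cycle _ (@dhom k D SA W)); rewrite -scaleN1r; case: ca => da Ea; split.
    exact: cx_degZ.
  by rewrite cx_dZ Ea scaler0.
by apply/(@op_boundary _ (@dhom k D C W)); rewrite op_compE dcompNr dcompNl opprK.
Qed.

Lemma rconn_exactA (W : D) i (a : dhom SA W) : i <= 0 -> cycle i a ->
  boundary i (a ∘ w) <->
  exists2 b : dhom B W, cycle (i - 1) b & boundary (i - 1) (b ∘ h3f xi - a ∘ hA).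
Proof.
move=> le_i ca; have [o r] := op_h3_ex xi.
have E := @lconn_exactC (op_abelian D) _ _ _ _ o hA ((op_left_exact r).2 rx)
  (op_loop sA) _ _ _ ((op_conn _ _ _ r).1 cw) W i a le_i
  ((@op_cycle _ (@dhom k D SA W) _ _).2 ca).
have := conj E r => -[{}E [_ Eg _]].
rewrite Eg in E.
have E1 := @op_boundary _ (@dhom k D C W) i (a ∘ (- w)).
split.
  move=> /boundaryN; rewrite -dcompNr => /E1 /E [b /(@op_cycle _ (@dhom k D B W)) cb].
  by move=> /(@op_boundary _ (@dhom k D A W)) bb; exists b.
move=> [b cb bb]; rewrite -[w]opprK dcompNr; apply: boundaryN; apply/E1/E.
exists b; first exact/(@op_cycle _ (@dhom k D B W)).
exact/(@op_boundary _ (@dhom k D A W)).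
Qed.

End Data.
End Right.

Lemma rconn_mor D (A B B' C SA : D) (xi : h3 A B C) (xi' : h3 A B' C)
    (hA : dhom A SA) b w h' eta :
  has_mor xi' xi (did A) b (did C) -> rconn xi hA w h' eta ->
  exists h2 eta2, rconn xi' hA w h2 eta2.
Proof.
move=> m c; have [[o r] [o' r']] := conj (op_h3_ex xi) (op_h3_ex xi').
have m' := (op_has_mor _ _ _ r' r).2 m.
have [h2 [e2 c2]] := @lconn_mor (op_abelian D) _ _ _ _ _ _ _ _ _ _ _ _ m'
  ((op_conn _ _ _ _ r).1 c).
by exists h2, e2; apply/(op_conn _ _ _ _ r').
Qed.

End Connecting.

Section Products.
Variables (k : comPzRingType) (n : nat) (D : abelian_dgcat k n).

Lemma cycle_dcomp (X Y Z : D) i j l (u : dhom Y Z) (v : dhom X Y) :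
  cycle i u -> cycle j v -> i + j = l -> cycle l (u ∘ v).
Proof.
move=> [du Eu] [dv Ev] <-; split; first exact: deg_dcomp.
by rewrite (d_dcomp _ du) Eu Ev dcomp0m dcompm0 scaler0 addr0.
Qed.

Lemma boundary_dcompr (X Y Z : D) i j l (u : dhom Y Z) (v : dhom X Y) :
  cycle i u -> boundary j v -> i + j = l -> boundary l (u ∘ v).
Proof.
move=> cu [e de ->] El; exists ((-1) ^+ `|i|%N *: (u ∘ e)).
  by apply: cx_degZ; case: cu => du _; dgd.
by rewrite (dcomp_dr _ cu) cx_dZ.
Qed.

Lemma boundary_dcompl (X Y Z : D) i j l (u : dhom Y Z) (v : dhom X Y) :
  boundary i u -> cycle j v -> i + j = l -> boundary l (u ∘ v).
Proof.
move=> [e de ->] [dv Ev] El; exists (e ∘ v); first by dgd.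
by rewrite (dcomp_dl de Ev).
Qed.

Lemma cycle_cast (M : precx k) i j (x : M) : cycle i x -> i = j -> cycle j x.
Proof. by move=> c <-. Qed.

Lemma boundary_cast (M : precx k) i j (x : M) : boundary i x -> i = j -> boundary j x.
Proof. by move=> b <-. Qed.

Lemma boundary_trans (M : cx k) i (x y z : M) :
  boundary i (x - y) -> boundary i (y - z) -> boundary i (x - z).
Proof. by move=> b b'; have -> : x - z = x - y + (y - z) by [zmod]; exact: boundaryD. Qed.

Lemma boundary_sym (M : cx k) i (x y : M) : boundary i (x - y) -> boundary i (y - x).
Proof. by move=> b; have -> : y - x = - (x - y) by [zmod]; exact: boundaryN. Qed.

Lemma qin_comp (X Y Z : D) (g : H0 Y Z) (f : H0 X Y) g0 f0 :
  qin g g0 -> qin f f0 -> qin (H0comp g f) (g0 ∘ f0).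
Proof.
move=> qg qf; rewrite (qin_H0 (qin_closed0 qg) qg) (qin_H0 (qin_closed0 qf) qf).
by rewrite H0comp_cls; apply: qin_cls.
Qed.

Lemma qin_boundary_eq (X Y : D) (f g : H0 X Y) f0 g0 :
  qin f f0 -> qin g g0 -> boundary 0 (f0 - g0) -> f = g.
Proof.
move=> qf qg b; rewrite (qin_H0 (qin_closed0 qf) qf) (qin_H0 (qin_closed0 qg) qg).
exact: H0cls_eq.
Qed.

Lemma H0_qin (X Y : D) (f : H0 X Y) : exists f0, qin f f0.
Proof. by have [f0 [cf ->]] := H0_ex f; exists f0; apply: qin_cls. Qed.

End Products.

(** * Iterated loop objects and the left part of the sequence *)

Section IteratedLoops.
Variables (k : comPzRingType) (n : nat) (D : abelian_dgcat k n) (L : loops D).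
Implicit Types W X Y : D.

(** The universal morphism of degree -j out of the j-fold loop object; it turns the groups in the
    sequence into cohomology of the Hom-complexes. *)
Fixpoint lpnh (j : nat) (X : D) {struct j} : dhom (lpn L j X) X :=
  match j return dhom (lpn L j X) X with
  | 0 => did X
  | j'.+1 => lph L X ∘ lpnh j' (lp L X)
  end.

Lemma lpnh_cycle j X : cycle (- j%:Z) (lpnh j X).
Proof.
elim: j X => [|j IH] X; first exact: closed0_id.
rewrite [lpnh _ _]/=.
by apply: (cycle_dcomp (lphP L X).1 (IH _) _); lia.
Qed.

Lemma lpnh_inj j X W (u : dhom W (lpn L j X)) :
  closed0 u -> boundary (- j%:Z) (lpnh j X ∘ u) -> boundary 0 u.
Proof.
elim: j X u => [|j IH] X u cu; first by rewrite dcomp1m.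
rewrite /= -dcompA => b; apply: IH => //.
apply: ((lphP L X).2 W (- j%:Z) _).1; first by lia.
  by apply: (cycle_dcomp (lpnh_cycle j (lp L X)) cu _); rewrite addr0.
by apply: (boundary_cast b); lia.
Qed.

Lemma lpnh_surj j X W (c : dhom W X) : cycle (- j%:Z) c ->
  exists2 u : dhom W (lpn L j X), closed0 u & boundary (- j%:Z) (c - lpnh j X ∘ u).
Proof.
elim: j X c => [|j IH] X c cc.
  by exists c => //; rewrite dcomp1m subrr; exists 0; rewrite ?cx_d0 //; apply: cx_deg0.
have [||c1 cc1 b1] := ((lphP L X).2 W (- j%:Z) _).2 c; first by lia.
  by apply: (cycle_cast cc); lia.
have [u cu b] := IH _ _ cc1; exists u => //=; rewrite -dcompA.
apply: (boundary_trans (y := lph L X ∘ c1)).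
  by apply: (boundary_cast b1); lia.
rewrite -dcompNr -dcompDr.
by apply: (boundary_dcompr (lphP L X).1 b _); lia.
Qed.

Lemma lp_map_cls X Y (f : dhom X Y) (cf : closed0 f) :
  exists2 f', qin (lp_map L (H0cls cf)) f' &
    boundary (-1) (lph L Y ∘ f' - f ∘ lph L X).
Proof.
have [||f' cf' b] := ((lphP L Y).2 _ 0 _).2 (f ∘ lph L X); first by [].
  by apply: (cycle_dcomp cf (lphP L X).1 _).
exists f'; last exact: boundary_sym.
suff -> : lp_map L (H0cls cf) = H0cls cf' by apply: qin_cls.
apply: the_eq.
  exists f, f'; split; [exact: qin_cls | exact: qin_cls | exact: boundary_sym].
move=> g' [f0 [g0 [qf qg bg]]].
apply: (qin_boundary_eq qg (qin_cls cf')).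
apply: ((lphP L Y).2 _ 0 _).1 => //.
  rewrite -scaleN1r addrC; apply: closed0L => //.
  exact: qin_closed0 qg.
rewrite dcompDr dcompNr sub0r; apply: (boundary_trans bg _).
apply: (boundary_trans (y := f ∘ lph L X)); last by [].
rewrite -dcompNl -dcompDl.
by apply: (boundary_dcompl (qin_homotopic qf (qin_cls cf)) (lphP L X).1).
Qed.

Lemma lpn_map_cls j X Y (f : dhom X Y) (cf : closed0 f) :
  exists2 f', qin (lpn_map L j (H0cls cf)) f' &
    boundary (- j%:Z) (lpnh j Y ∘ f' - f ∘ lpnh j X).
Proof.
elim: j X Y f cf => [|j IH] X Y f cf.
  exists f; first exact: qin_cls.
  by rewrite /= dcomp1m dcompm1 subrr; exists 0; rewrite ?cx_d0 //; apply: cx_deg0.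
have [f1 qf1 b1] := lp_map_cls cf.
have [f' qf' b] := IH _ _ _ (qin_closed0 qf1).
exists f'; first by rewrite /= (qin_H0 (qin_closed0 qf1) qf1).
rewrite /= -dcompA dcompA.
apply: (boundary_trans (y := lph L Y ∘ (f1 ∘ lpnh j (lp L X)))).
  rewrite -dcompA -dcompNr -dcompDr.
  by apply: (boundary_dcompr (lphP L Y).1 b _); lia.
rewrite !dcompA -dcompNl -dcompDl.
by apply: (boundary_dcompl b1 (lpnh_cycle j (lp L X)) _); lia.
Qed.

(* The class u corresponds to that of c under H^0(W, Omega^j X) = H^{-j}(W, X). *)
Definition lrep j X W (u : H0 W (lpn L j X)) (c : dhom W X) :=
  cycle (- j%:Z) c /\ exists2 u0, qin u u0 & boundary (- j%:Z) (c - lpnh j X ∘ u0).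

Lemma lrep_ex j X W (u : H0 W (lpn L j X)) : exists c, lrep u c.
Proof.
have [u0 q] := H0_qin u; exists (lpnh j X ∘ u0); split.
  by apply: (cycle_dcomp (lpnh_cycle j X) (qin_closed0 q) _); rewrite addr0.
by exists u0 => //; rewrite subrr; exists 0; rewrite ?cx_d0 //; apply: cx_deg0.
Qed.

Lemma lrep_surj j X W (c : dhom W X) : cycle (- j%:Z) c ->
  exists u : H0 W (lpn L j X), lrep u c.
Proof.
move=> cc; have [u0 cu b] := lpnh_surj cc.
by exists (H0cls cu); split=> //; exists u0 => //; apply: qin_cls.
Qed.

Lemma lrep_eq j X W (u v : H0 W (lpn L j X)) c c' :
  lrep u c -> lrep v c' -> u = v <-> boundary (- j%:Z) (c - c').
Proof.
move=> [cc [u0 qu bu]] [cc' [v0 qv bv]]; split=> [E|b].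
  move: qu; rewrite E => qu.
  apply: (boundary_trans bu _); apply: boundary_trans (boundary_sym bv).
  rewrite -dcompNr -dcompDr.
  apply: (boundary_dcompr (lpnh_cycle j X) (qin_homotopic qu qv) _).
  by rewrite addr0.
apply: (qin_boundary_eq qu qv); apply: (lpnh_inj (j := j)).
  rewrite -scaleN1r addrC; apply: closed0L; first exact: qin_closed0 qv.
  exact: qin_closed0 qu.
rewrite dcompDr dcompNr; apply: (boundary_trans (boundary_sym bu) _).
exact: boundary_trans b bv.
Qed.

Lemma lrep0 j X W : lrep (H0zero W (lpn L j X)) 0.
Proof.
split; first by split; [exact: cx_deg0 | exact: cx_d0].
exists 0; first exact: qin_cls.
by rewrite dcompm0 subrr; exists 0; rewrite ?cx_d0 //; apply: cx_deg0.
Qed.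

Lemma lrep_eq0 j X W (u : H0 W (lpn L j X)) c :
  lrep u c -> u = H0zero _ _ <-> boundary (- j%:Z) c.
Proof. by move=> r; have := lrep_eq r (lrep0 j X W); rewrite subr0. Qed.

Lemma lrep_map j X Y W (f : dhom X Y) (cf : closed0 f) (u : H0 W (lpn L j X)) c :
  lrep u c -> lrep (H0comp (lpn_map L j (H0cls cf)) u) (f ∘ c).
Proof.
move=> [cc [u0 qu bu]]; have [f' qf bf] := lpn_map_cls j cf.
split; first by apply: (cycle_dcomp cf cc _); rewrite add0r.
exists (f' ∘ u0); first exact: qin_comp.
apply: (boundary_trans (y := f ∘ (lpnh j X ∘ u0))).
  rewrite -dcompNr -dcompDr.
  by apply: (boundary_dcompr cf bu _); rewrite add0r.
rewrite !dcompA -dcompNl -dcompDl.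
by apply: (boundary_dcompl (boundary_sym bf) (qin_closed0 qu) _); rewrite addr0.
Qed.

Lemma lrepS j X W (u : H0 W (lpn L j (lp L X))) c :
  lrep u c -> lrep (j := j.+1) (u : H0 W (lpn L j.+1 X)) (lph L X ∘ c).
Proof.
move=> [cc [u0 qu bu]]; split.
  by apply: (cycle_dcomp (lphP L X).1 cc _); lia.
exists u0 => //=; rewrite -dcompA -dcompNr -dcompDr.
by apply: (boundary_dcompr (lphP L X).1 bu _); lia.
Qed.

Section Triangle.
Variables (A B C : D) (xi : h3 A B C) (sx : short_exact xi).

Lemma left_conn_rep : exists w (cw : closed0 w) h' eta,
  left_conn L (ecls sx) = H0cls cw /\ lconn xi (lph L C) w h' eta.
Proof.
have [w [h' [eta c]]] := lconn_ex sx.1 (lphP L C).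
have cw : closed0 w by case: c.
exists w, cw, h', eta; split=> //; apply: the_eq.
  exists w, (existT _ B xi); split; [exact: qin_cls | exact: qin_ecls |].
  by case: c => _ *; exists h', eta.
move=> w' [w0 [s [qw qs [h2 [eta2 [dh Eh de Ee]]]]]].
have [b m] := qin_erel qs (qin_ecls sx).
have c0 : lconn (projT2 s) (lph L C) w0 h2 eta2.
  by split=> //; exact: qin_closed0 qw.
have [h0 [eta3 c3]] := lconn_mor m c0.
exact: qin_boundary_eq qw (qin_cls cw) (lconn_uniq sx.1 c3 c).
Qed.

Lemma loop_exact_B j W (u : H0 W (lpn L j B)) :
  H0comp (lpn_map L j (hg xi)) u = H0zero _ _ <->
  exists v, H0comp (lpn_map L j (hf xi)) v = u.
Proof.
have [c r] := lrep_ex u.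
rewrite (lrep_eq0 (lrep_map (h3g_closed xi) r)); split.
- move=> b; have le_j : - j%:Z <= 0 by lia.
  have [a ca ba] := left_exact_cycle sx.1 le_j r.1 b.
  have [v rv] := lrep_surj ca; exists v.
  by apply/(lrep_eq (lrep_map (h3f_closed xi) rv) r)/boundary_sym.
- move=> [v Ev]; have [a ra] := lrep_ex v.
  have /(lrep_eq (lrep_map (h3f_closed xi) ra) r) b := Ev.
  apply: (boundary_eq (y := h3g xi ∘ (h3f xi ∘ a))).
    rewrite -dcompNr -dcompDr.
    by apply: (boundary_dcompr (h3g_closed xi) (boundary_sym b) _); rewrite add0r.
  rewrite dcompA; apply: (boundary_dcompl (i := 0) _ ra.1); last by rewrite add0r.
  by exists (- h3h xi); [apply/cx_degN/h3h_deg | rewrite cx_dN h3h_d opprK].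
Qed.

Lemma loop_exact_A j W (u : H0 W (lpn L j A)) :
  H0comp (lpn_map L j (hf xi)) u = H0zero _ _ <->
  exists v, H0comp (lpn_map L j (left_conn L (ecls sx))) v = u.
Proof.
have [w [cw [h' [eta [-> cd]]]]] := left_conn_rep.
have [c r] := lrep_ex u.
rewrite (lrep_eq0 (lrep_map (h3f_closed xi) r)).
have le_j : - j%:Z <= 0 by lia.
rewrite (lconn_exactA sx.1 (lphP L C) cd le_j r.1).
split=> [[a ca ba]|[v Ev]].
  have [v rv] := lrep_surj ca; exists v.
  by apply/(lrep_eq (lrep_map cw rv) r)/boundary_sym.
have [a ra] := lrep_ex v; exists a; first exact: ra.1.
by apply/boundary_sym/(lrep_eq (lrep_map cw ra) r).
Qed.

Lemma loop_exact_C j W (u : H0 W (lpn L j.+1 C)) :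
  H0comp (lpn_map L j (left_conn L (ecls sx))) u = H0zero _ _ <->
  exists v, H0comp (lpn_map L j.+1 (hg xi)) v = u.
Proof.
have [w [cw [h' [eta [-> cd]]]]] := left_conn_rep.
(* The class u is first read as a map to the j-fold loops of [lp L C], represented by c; [lrepS]
   then represents the same class by h_C ∘ c, in degree - j - 1. *)
have [c r] := @lrep_ex j (lp L C) W u.
have Ej : - j%:Z - 1 = - j.+1%:Z by lia.
rewrite (lrep_eq0 (lrep_map cw r)).
have le_j : - j%:Z <= 0 by lia.
rewrite (lconn_exactC sx.1 (lphP L C) cd le_j r.1) Ej.
split=> [[b cb bb]|[v Ev]].
  have [v rv] := lrep_surj cb; exists v.
  exact/(lrep_eq (lrep_map (h3g_closed xi) rv) (lrepS r)).
have [b rb] := lrep_ex v; exists b; first exact: rb.1.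
exact/(lrep_eq (lrep_map (h3g_closed xi) rb) (lrepS r)).
Qed.

(** For n > 0 the relevant degree -(n-1) is 1 - n, where [left_exact_nmono] gives injectivity. *)
Lemma loop_mono W (u : H0 W (lpn L n.-1 A)) : (0 < n)%N ->
  H0comp (lpn_map L n.-1 (hf xi)) u = H0zero _ _ -> u = H0zero _ _.
Proof.
move=> hn; have [c r] := lrep_ex u.
rewrite (lrep_eq0 (lrep_map (h3f_closed xi) r)) (lrep_eq0 r).
have -> : - n.-1%:Z = 1 - n%:Z by lia.
apply: left_exact_nmono sx.1 _.
by case: r => cc _; apply: (cycle_cast cc); lia.
Qed.

End Triangle.
End IteratedLoops.

(** * Iterated suspensions and the left part of the dual sequence *)

Section IteratedSuspensions.
Variables (k : comPzRingType) (n : nat) (D : abelian_dgcat k n) (S : suspensions D).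
Implicit Types W X Y : D.

Fixpoint sunh (j : nat) (X : D) {struct j} : dhom X (sun S j X) :=
  match j return dhom X (sun S j X) with
  | 0 => did X
  | j'.+1 => sunh j' (su S X) ∘ suh S X
  end.

Lemma sunh_cycle j X : cycle (- j%:Z) (sunh j X).
Proof.
elim: j X => [|j IH] X; first exact: closed0_id.
rewrite [sunh _ _]/=.
by apply: (cycle_dcomp (IH _) (suhP S X).1 _); lia.
Qed.

Lemma sunh_inj j X W (u : dhom (sun S j X) W) :
  closed0 u -> boundary (- j%:Z) (u ∘ sunh j X) -> boundary 0 u.
Proof.
elim: j X u => [|j IH] X u cu; first by rewrite dcompm1.
rewrite /= dcompA => b; apply: IH => //.
apply: ((suhP S X).2 W (- j%:Z) _).1; first by lia.
  by apply: (cycle_dcomp cu (sunh_cycle j (su S X)) _); rewrite add0r.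
by apply: (boundary_cast b); lia.
Qed.

Lemma sunh_surj j X W (c : dhom X W) : cycle (- j%:Z) c ->
  exists2 u : dhom (sun S j X) W, closed0 u & boundary (- j%:Z) (c - u ∘ sunh j X).
Proof.
elim: j X c => [|j IH] X c cc.
  by exists c => //; rewrite dcompm1 subrr; exists 0; rewrite ?cx_d0 //; apply: cx_deg0.
have [||c1 cc1 b1] := ((suhP S X).2 W (- j%:Z) _).2 c; first by lia.
  by apply: (cycle_cast cc); lia.
have [u cu b] := IH _ _ cc1; exists u => //=; rewrite dcompA.
apply: (boundary_trans (y := c1 ∘ suh S X)).
  by apply: (boundary_cast b1); lia.
rewrite -dcompNl -dcompDl.
by apply: (boundary_dcompl b (suhP S X).1 _); lia.
Qed.

Lemma su_map_cls X Y (f : dhom X Y) (cf : closed0 f) :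
  exists2 f', qin (su_map S (H0cls cf)) f' &
    boundary (-1) (f' ∘ suh S X - suh S Y ∘ f).
Proof.
have [||f' cf' b] := ((suhP S X).2 _ 0 _).2 (suh S Y ∘ f); first by [].
  by apply: (cycle_dcomp (suhP S Y).1 cf _).
exists f'; last exact: boundary_sym.
suff -> : su_map S (H0cls cf) = H0cls cf' by apply: qin_cls.
apply: the_eq.
  exists f, f'; split; [exact: qin_cls | exact: qin_cls | exact: boundary_sym].
move=> g' [f0 [g0 [qf qg bg]]].
apply: (qin_boundary_eq qg (qin_cls cf')).
apply: ((suhP S X).2 _ 0 _).1 => //.
  rewrite -scaleN1r addrC; apply: closed0L => //.
  exact: qin_closed0 qg.
rewrite dcompDl dcompNl sub0r; apply: (boundary_trans bg _).
apply: (boundary_trans (y := suh S Y ∘ f)); last by [].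
rewrite -dcompNr -dcompDr.
by apply: (boundary_dcompr (suhP S Y).1 (qin_homotopic qf (qin_cls cf))).
Qed.

Lemma sun_map_cls j X Y (f : dhom X Y) (cf : closed0 f) :
  exists2 f', qin (sun_map S j (H0cls cf)) f' &
    boundary (- j%:Z) (f' ∘ sunh j X - sunh j Y ∘ f).
Proof.
elim: j X Y f cf => [|j IH] X Y f cf.
  exists f; first exact: qin_cls.
  by rewrite /= dcomp1m dcompm1 subrr; exists 0; rewrite ?cx_d0 //; apply: cx_deg0.
have [f1 qf1 b1] := su_map_cls cf.
have [f' qf' b] := IH _ _ _ (qin_closed0 qf1).
exists f'; first by rewrite /= (qin_H0 (qin_closed0 qf1) qf1).
rewrite /= dcompA -dcompA.
apply: (boundary_trans (y := sunh j (su S Y) ∘ f1 ∘ suh S X)).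
  rewrite dcompA -dcompNl -dcompDl.
  by apply: (boundary_dcompl b (suhP S X).1 _); lia.
rewrite -!dcompA -dcompNr -dcompDr.
by apply: (boundary_dcompr (sunh_cycle j (su S Y)) b1 _); lia.
Qed.

(* The class u corresponds to that of c under H^0(Sigma^j X, W) = H^{-j}(X, W). *)
Definition srep j X W (u : H0 (sun S j X) W) (c : dhom X W) :=
  cycle (- j%:Z) c /\ exists2 u0, qin u u0 & boundary (- j%:Z) (c - u0 ∘ sunh j X).

Lemma srep_ex j X W (u : H0 (sun S j X) W) : exists c, srep u c.
Proof.
have [u0 q] := H0_qin u; exists (u0 ∘ sunh j X); split.
  by apply: (cycle_dcomp (qin_closed0 q) (sunh_cycle j X) _); rewrite add0r.
by exists u0 => //; rewrite subrr; exists 0; rewrite ?cx_d0 //; apply: cx_deg0.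
Qed.

Lemma srep_surj j X W (c : dhom X W) : cycle (- j%:Z) c ->
  exists u : H0 (sun S j X) W, srep u c.
Proof.
move=> cc; have [u0 cu b] := sunh_surj cc.
by exists (H0cls cu); split=> //; exists u0 => //; apply: qin_cls.
Qed.

Lemma srep_eq j X W (u v : H0 (sun S j X) W) c c' :
  srep u c -> srep v c' -> u = v <-> boundary (- j%:Z) (c - c').
Proof.
move=> [cc [u0 qu bu]] [cc' [v0 qv bv]]; split=> [E|b].
  move: qu; rewrite E => qu.
  apply: (boundary_trans bu _); apply: boundary_trans (boundary_sym bv).
  rewrite -dcompNl -dcompDl.
  apply: (boundary_dcompl (qin_homotopic qu qv) (sunh_cycle j X) _).
  by rewrite add0r.
apply: (qin_boundary_eq qu qv); apply: (sunh_inj (j := j)).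
  rewrite -scaleN1r addrC; apply: closed0L; first exact: qin_closed0 qv.
  exact: qin_closed0 qu.
rewrite dcompDl dcompNl; apply: (boundary_trans (boundary_sym bu) _).
exact: boundary_trans b bv.
Qed.

Lemma srep0 j X W : srep (H0zero (sun S j X) W) 0.
Proof.
split; first by split; [exact: cx_deg0 | exact: cx_d0].
exists 0; first exact: qin_cls.
by rewrite dcomp0m subrr; exists 0; rewrite ?cx_d0 //; apply: cx_deg0.
Qed.

Lemma srep_eq0 j X W (u : H0 (sun S j X) W) c :
  srep u c -> u = H0zero _ _ <-> boundary (- j%:Z) c.
Proof. by move=> r; have := srep_eq r (srep0 j X W); rewrite subr0. Qed.

Lemma srep_map j X Y W (f : dhom X Y) (cf : closed0 f) (u : H0 (sun S j Y) W) c :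
  srep u c -> srep (H0comp u (sun_map S j (H0cls cf))) (c ∘ f).
Proof.
move=> [cc [u0 qu bu]]; have [f' qf bf] := sun_map_cls j cf.
split; first by apply: (cycle_dcomp cc cf _); rewrite addr0.
exists (u0 ∘ f'); first exact: qin_comp.
apply: (boundary_trans (y := u0 ∘ sunh j Y ∘ f)).
  rewrite -dcompNl -dcompDl.
  by apply: (boundary_dcompl bu cf _); rewrite addr0.
rewrite -!dcompA -dcompNr -dcompDr.
by apply: (boundary_dcompr (qin_closed0 qu) (boundary_sym bf) _); rewrite add0r.
Qed.

Lemma srepS j X W (u : H0 (sun S j (su S X)) W) c :
  srep u c -> srep (j := j.+1) (u : H0 (sun S j.+1 X) W) (c ∘ suh S X).
Proof.
move=> [cc [u0 qu bu]]; split.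
  by apply: (cycle_dcomp cc (suhP S X).1 _); lia.
exists u0 => //=; rewrite dcompA -dcompNl -dcompDl.
by apply: (boundary_dcompl bu (suhP S X).1 _); lia.
Qed.

Section Triangle.
Variables (A B C : D) (xi : h3 A B C) (sx : short_exact xi).

Lemma right_conn_rep : exists w (cw : closed0 w) h' eta,
  right_conn S (ecls sx) = H0cls cw /\ rconn xi (suh S A) w h' eta.
Proof.
have [w [h' [eta c]]] := rconn_ex sx.2 (suhP S A).
have cw : closed0 w by case: c.
exists w, cw, h', eta; split=> //; apply: the_eq.
  exists w, (existT _ B xi); split; [exact: qin_cls | exact: qin_ecls |].
  by case: c => _ *; exists h', eta.
move=> w' [w0 [s [qw qs [h2 [eta2 [dh Eh de Ee]]]]]].
have [b m] := qin_erel (qin_ecls sx) qs.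
have c0 : rconn (projT2 s) (suh S A) w0 h2 eta2.
  by split=> //; exact: qin_closed0 qw.
have [h0 [eta3 c3]] := rconn_mor m c0.
exact: qin_boundary_eq qw (qin_cls cw) (rconn_uniq sx.2 c3 c).
Qed.

Lemma suspension_exact_B j W (u : H0 (sun S j B) W) :
  H0comp u (sun_map S j (hf xi)) = H0zero _ _ <->
  exists v, H0comp v (sun_map S j (hg xi)) = u.
Proof.
have [c r] := srep_ex u.
rewrite (srep_eq0 (srep_map (h3f_closed xi) r)); split.
- move=> b; have le_j : - j%:Z <= 0 by lia.
  have [a ca ba] := right_exact_cycle sx.2 le_j r.1 b.
  have [v rv] := srep_surj ca; exists v.
  by apply/(srep_eq (srep_map (h3g_closed xi) rv) r)/boundary_sym.
- move=> [v Ev]; have [a ra] := srep_ex v.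
  have /(srep_eq (srep_map (h3g_closed xi) ra) r) b := Ev.
  apply: (boundary_eq (y := a ∘ h3g xi ∘ h3f xi)).
    rewrite -dcompNl -dcompDl.
    by apply: (boundary_dcompl (boundary_sym b) (h3f_closed xi) _); rewrite addr0.
  rewrite -dcompA; apply: (boundary_dcompr (j := 0) ra.1); last by rewrite addr0.
  by exists (- h3h xi); [apply/cx_degN/h3h_deg | rewrite cx_dN h3h_d opprK].
Qed.

Lemma suspension_exact_C j W (u : H0 (sun S j C) W) :
  H0comp u (sun_map S j (hg xi)) = H0zero _ _ <->
  exists v, H0comp v (sun_map S j (right_conn S (ecls sx))) = u.
Proof.
have [w [cw [h' [eta [-> cd]]]]] := right_conn_rep.
have [c r] := srep_ex u.
rewrite (srep_eq0 (srep_map (h3g_closed xi) r)).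
have le_j : - j%:Z <= 0 by lia.
rewrite (rconn_exactC sx.2 (suhP S A) cd le_j r.1).
split=> [[a ca ba]|[v Ev]].
  have [v rv] := srep_surj ca; exists v.
  by apply/(srep_eq (srep_map cw rv) r)/boundary_sym.
have [a ra] := srep_ex v; exists a; first exact: ra.1.
by apply/boundary_sym/(srep_eq (srep_map cw ra) r).
Qed.

Lemma suspension_exact_A j W (u : H0 (sun S j.+1 A) W) :
  H0comp u (sun_map S j (right_conn S (ecls sx))) = H0zero _ _ <->
  exists v, H0comp v (sun_map S j.+1 (hf xi)) = u.
Proof.
have [w [cw [h' [eta [-> cd]]]]] := right_conn_rep.
have [c r] := @srep_ex j (su S A) W u.
have Ej : - j%:Z - 1 = - j.+1%:Z by lia.
rewrite (srep_eq0 (srep_map cw r)).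
have le_j : - j%:Z <= 0 by lia.
rewrite (rconn_exactA sx.2 (suhP S A) cd le_j r.1) Ej.
split=> [[b cb bb]|[v Ev]].
  have [v rv] := srep_surj cb; exists v.
  exact/(srep_eq (srep_map (h3f_closed xi) rv) (srepS r)).
have [b rb] := srep_ex v; exists b; first exact: rb.1.
exact/(srep_eq (srep_map (h3f_closed xi) rb) (srepS r)).
Qed.

Lemma suspension_mono W (u : H0 (sun S n.-1 C) W) : (0 < n)%N ->
  H0comp u (sun_map S n.-1 (hg xi)) = H0zero _ _ -> u = H0zero _ _.
Proof.
move=> hn; have [c r] := srep_ex u.
rewrite (srep_eq0 (srep_map (h3g_closed xi) r)) (srep_eq0 r).
have -> : - n.-1%:Z = 1 - n%:Z by lia.
apply: right_exact_nepi sx.2 _.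
by case: r => cc _; apply: (cycle_cast cc); lia.
Qed.

End Triangle.
End IteratedSuspensions.

(** * Naturality and assembly of the long exact sequences *)

Section Functors.
Variables (k : comPzRingType) (n : nat) (D : abelian_dgcat k n).
Variables (M : bimod k (H0cat D)) (gM : good_bimod M).

Lemma presheaf_functor X : is_functor (presheaf M X).
Proof.
split=> [W|W W' c|W x|W W' W'' c' c x].
- exact: gb_mod gM W X.
- exact: gb_pull_lin gM _ _ _ _.
- exact: gb_pull_id gM _ _ _.
- exact: gb_pull_comp gM _ _ _ _ _ _ _.
Qed.

Lemma copresheaf_functor Z : is_functor (copresheaf M Z).
Proof.
split=> [W|W W' c|W x|W W' W'' c' c x].
- exact: gb_mod gM Z W.
- exact: gb_push_lin gM _ _ _ _.
- exact: gb_push_id gM _ _ _.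
- exact: gb_push_comp gM _ _ _ _ _ _ _.
Qed.

Lemma pushT_natural (X X' : D) (a : H0 X X') : is_natural (pushT M a).
Proof.
split=> [W|W W' c x]; first exact: gb_push_lin gM _ _ _ _.
exact: gb_push_pull gM _ _ _ _ _ _ _.
Qed.

Lemma pullT_natural (Z Z' : D) (c : H0 Z' Z) : is_natural (pullT M c).
Proof.
split=> [W|W W' a x]; first exact: gb_pull_lin gM _ _ _ _.
exact/esym/(gb_push_pull gM).
Qed.

End Functors.

Section ConnectingNatural.
Variables (k : comPzRingType) (n : nat) (D : abelian_dgcat k n).
Variables (A C : D) (d : ext C A).

Lemma conn_contra_natural : is_natural (conn_contra d).
Proof.
split=> [W|W W' c x]; last exact: ext_pull_comp.
by split=> [x y|a x]; [apply: ext_pull_addm | apply: ext_pull_scalem].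
Qed.

Lemma conn_covar_natural : is_natural (conn_covar d).
Proof.
split=> [W|W W' c x]; last exact: ext_push_comp.
by split=> [x y|a x]; [apply: ext_push_addm | apply: ext_push_scalem].
Qed.

Lemma ext_conn_contra_natural m : is_natural (ext_conn_contra d m).
Proof.
have [B [xi [sx ->]]] := ext_ex d; have [dl dn] := delta_contra_nat sx m.
by split=> [W|W W' c x]; [apply: dl | apply: dn].
Qed.

Lemma ext_conn_covar_natural m : is_natural (ext_conn_covar d m).
Proof.
split=> [W|W W' c x].
  by split=> [x y|a x]; [apply: tensorDl | apply: tensorZl].
exact/esym/(coend_push_tensor (good_Ext D m)).
Qed.

End ConnectingNatural.

Theorem corollary3p16 (k : comPzRingType) (n : nat) (hn : (0 < n)%N)
    (D : abelian_dgcat k n) (L : loops D) (S : suspensions D)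
    (A B C : D) (f : H0 A B) (g : H0 B C) (delta : ext C A)
    (conf : conflation f g delta) :
  long_exact n
    (LX := fun j => presheaf (H0mod D) (lpn L j A))
    (LY := fun j => presheaf (H0mod D) (lpn L j B))
    (LZ := fun j => presheaf (H0mod D) (lpn L j C))
    (EX := fun m => presheaf (Ext D m) A)
    (EY := fun m => presheaf (Ext D m) B)
    (EZ := fun m => presheaf (Ext D m) C)
    (fun j => pushT (H0mod D) (lpn_map L j f))
    (fun j => pushT (H0mod D) (lpn_map L j g))
    (fun j => pushT (H0mod D) (lpn_map L j (left_conn L delta)))
    (conn_contra delta)
    (fun m => pushT (Ext D m) f)
    (fun m => pushT (Ext D m) g)
    (ext_conn_contra delta)
  /\
  long_exact n
    (LX := fun j => copresheaf (H0mod D) (sun S j C))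
    (LY := fun j => copresheaf (H0mod D) (sun S j B))
    (LZ := fun j => copresheaf (H0mod D) (sun S j A))
    (EX := fun m => copresheaf (Ext D m) C)
    (EY := fun m => copresheaf (Ext D m) B)
    (EZ := fun m => copresheaf (Ext D m) A)
    (fun j => pullT (H0mod D) (sun_map S j g))
    (fun j => pullT (H0mod D) (sun_map S j f))
    (fun j => pullT (H0mod D) (sun_map S j (right_conn S delta)))
    (conn_covar delta)
    (fun m => pullT (Ext D m) g)
    (fun m => pullT (Ext D m) f)
    (ext_conn_covar delta).
Proof.
(* One exact sequence with middle term B itself now represents f, g and delta simultaneously, which
   is the form used by all exactness lemmas. *)
have [xi [sx [-> -> ->]]] := conflation_rep conf.
have [gH gE] := conj (good_H0mod D) (good_Ext D).
split; split.
- by move=> j _; apply: presheaf_functor gH _.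
- by move=> j _; apply: presheaf_functor gH _.
- by move=> j _; apply: presheaf_functor gH _.
- by move=> m; apply: presheaf_functor (gE m) _.
- by move=> m; apply: presheaf_functor (gE m) _.
- by move=> m; apply: presheaf_functor (gE m) _.
- by move=> j _; apply: pushT_natural gH _ _ _.
- by move=> j _; apply: pushT_natural gH _ _ _.
- by move=> j _; apply: pushT_natural gH _ _ _.
- exact: conn_contra_natural.
- by move=> m; apply: pushT_natural (gE m) _ _ _.
- by move=> m; apply: pushT_natural (gE m) _ _ _.
- exact: ext_conn_contra_natural.
- by move=> W x; apply: (loop_mono sx hn).
- by move=> j _ W y; apply: (loop_exact_B sx).
- by move=> j _ W y; apply: (loop_exact_C sx).
- by move=> j _ W y; apply: (loop_exact_A sx).
- move=> W y; rewrite /= /conn_contra (pull_zeroP sx).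
  by split=> -[l E]; exists l; rewrite E.
- move=> W y; rewrite [X in X <-> _](ext_push_f sx).
  by split=> -[c E]; exists c; apply: esym E.
- by move=> m W y; apply: (ext_exact_B sx).
- by move=> m W y; apply: (ext_exact_C sx).
- by move=> m W y; apply: (ext_exact_A sx).
- by move=> j _; apply: copresheaf_functor gH _.
- by move=> j _; apply: copresheaf_functor gH _.
- by move=> j _; apply: copresheaf_functor gH _.
- by move=> m; apply: copresheaf_functor (gE m) _.
- by move=> m; apply: copresheaf_functor (gE m) _.
- by move=> m; apply: copresheaf_functor (gE m) _.
- by move=> j _; apply: pullT_natural gH _ _ _.
- by move=> j _; apply: pullT_natural gH _ _ _.
- by move=> j _; apply: pullT_natural gH _ _ _.
- exact: conn_covar_natural.
- by move=> m; apply: pullT_natural (gE m) _ _ _.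
- by move=> m; apply: pullT_natural (gE m) _ _ _.
- exact: ext_conn_covar_natural.
- by move=> W x; apply: (suspension_mono sx hn).
- by move=> j _ W y; apply: (suspension_exact_B sx).
- by move=> j _ W y; apply: (suspension_exact_A sx).
- by move=> j _ W y; apply: (suspension_exact_C sx).
- move=> W y; rewrite /= /conn_covar (push_zeroP sx).
  by split=> -[l E]; exists l; rewrite E.
- move=> W y; rewrite [X in X <-> _](ext_pull_g sx).
  by split=> -[c E]; exists c; apply: esym E.
- by move=> m W y; apply: (ext_coexact_B sx).
- by move=> m W y; apply: (ext_coexact_A sx).
- by move=> m W y; apply: (ext_coexact_C sx).
Qed.
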